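(* Let $\mathfrak M$ be a Hilbert space and let $c>0$, $c\neq1$. (1) Each Stieltjes family $\mathcal Q$ in $\mathfrak M$ satisfying $\mathcal Q(c\lambda)=\mathcal Q(\lambda)$ for all $\lambda\in\mathbb C\setminus\mathbb R_+$ is of the form $\mathcal Q(\lambda)\equiv\mathcal A$, where $\mathcal A$ is a nonnegative selfadjoint relation. (2) Each inverse Stieltjes family $\mathcal R$ in $\mathfrak M$ satisfying $\mathcal R(c\lambda)=\mathcal R(\lambda)$ for all $\lambda\in\mathbb C\setminus\mathbb R_+$ is of the form $\mathcal R(\lambda)\equiv-\mathcal A$, where $\mathcal A$ is a nonnegative selfadjoint relation. (3) Each Stieltjes family $\mathcal Q$ in $\mathfrak M$ satisfying $\mathcal Q(c\lambda)=c^{-1}\mathcal Q(\lambda)$ for all $\lambda\in\mathbb C\setminus\mathbb R_+$ is of the form $\mathcal Q(\lambda)=-\lambda^{-1}\mathcal B$, where $\mathcal B$ is a nonnegative selfadjoint relation. (4) Each inverse Stieltjes family $\mathcal R$ in $\mathfrak M$ satisfying $\mathcal R(c\lambda)=c\,\mathcal R(\lambda)$ for all $\lambda\in\mathbb C\setminus\mathbb R_+$ is of the form $\mathcal R(\lambda)=\lambda\,\mathcal C$, where $\mathcal C$ is a nonnegative selfadjoint relation. (5) Each Stieltjes family $\mathcal Q$ in $\mathfrak M$ satisfying $\mathcal Q(c\lambda)=c\,\mathcal Q(\lambda)$ for all $\lambda\in\mathbb C\setminus\mathbb R_+$, and each inverse Stieltjes family $\mathcal R$ in $\mathfrak M$ satisfying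 $\mathcal R(c\lambda)=c^{-1}\mathcal R(\lambda)$ for all $\lambda\in\mathbb C\setminus\mathbb R_+$, is constant and equal to a relation of the form $$\big\{\{Pf,(I-P)f\}:\ f\in\mathfrak M\big\},$$ where $P$ is an orthogonal projection in $\mathfrak M$.
   Context: All Hilbert spaces are complex and separable; $\mathbb R_+=[0,+\infty)$, $\mathbb C_\pm$ are the open upper/lower half-planes; $\mathbf B(\mathfrak M)$ is the algebra of bounded everywhere defined operators. A linear relation in $\mathfrak M$ is a linear subspace $H$ of $\mathfrak M\times\mathfrak M$, with elements $\{f,f'\}$; operators are identified with graphs. $H^{-1}=\{\{f',f\}:\{f,f'\}\in H\}$, $aH=\{\{f,af'\}\}$ for a scalar $a$, $H+aI=\{\{f,f'+af\}\}$. Adjoint: $H^*=\{\{k,k'\}:(h',k)=(h,k')\ \forall\{h,h'\}\in H\}$; $H$ is selfadjoint if $H=H^*$; $H\ge0$ (nonnegative) if $(f',f)\ge0$ on $H$; $H\le0$ if $-H\ge0$; $H$ is dissipative (accumulative) if $\operatorname{Im}(f',f)\ge0$ ($\le0$) on $H$; maximal means having no proper extension with the same property. A family of linear relations $\mathcal M(\lambda)$, $\lambda\in\mathbb C\setminus\mathbb R$, in $\mathfrak M$ is a Nevanlinna family if: (i) $\mathcal M(\lambda)$ is maximal dissipative for $\lambda\in\mathbb C_+$ (resp. maximal accumulative for $\lambda\in\mathbb C_-$); (ii) $\mathcal M(\lambda)^*=\mathcal M(\bar\lambda)$; (iii) for some (hence all) $\mu\in\mathbb C_+$ ($\mathbb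 C_-$) the family $(\mathcal M(\lambda)+\mu)^{-1}\in\mathbf B(\mathfrak M)$ is holomorphic for $\lambda\in\mathbb C_+$ ($\mathbb C_-$). A family $\mathcal M(\lambda)$, $\lambda\in\mathbb C\setminus\mathbb R_+$, is a Stieltjes family (respectively inverse Stieltjes family) in $\mathfrak M$ if it is a Nevanlinna family and, moreover, (i) $\mathcal M(x)\ge0$ for all $x<0$ (respectively $\mathcal M(x)\le0$ for all $x<0$), (ii) for some (hence all) $\mu\in\mathbb C_+$ ($\mathbb C_-$) the operator family $(\mathcal M(\lambda)+\mu)^{-1}\in\mathbf B(\mathfrak M)$, $\lambda\in\mathbb C_+$ ($\mathbb C_-$), admits an analytic continuation to $(-\infty,0)$. *)

(* Defs.v *)
From HB Require Import structures.
From mathcomp Require Import all_boot all_order all_algebra complex.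
From mathcomp Require Import all_classical all_reals all_analysis.

Set Implicit Arguments.
Unset Strict Implicit.
Unset Printing Implicit Defensive.

Import Order.TTheory GRing.Theory Num.Theory.
Import numFieldNormedType.Exports.

Local Open Scope classical_set_scope.
Local Open Scope ring_scope.
Local Open Scope complex_scope.

(* A complex Hilbert space is a complete normed module over R[i] whose norm
   comes from the inner product dot, which is linear in its first argument and
   conjugate-linear in the second. *)
Definition hilbert_norm (R : realType) (M : completeNormedModType R[i])
    (dot : {dot M for Num.conj}) : Prop :=
  forall f : M, `|f| ^+ 2 = dot f f.

Definition separable (T : topologicalType) : Prop :=
  exists2 D : set T, countable D & dense D.

Definition upper_half_plane (R : realType) : set R[i] :=
  [set z | 0 < complex.Im z].
Definition lower_half_plane (R : realType) : set R[i] :=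
  [set z | complex.Im z < 0].
Definition nonreal (R : realType) : set R[i] :=
  ~` [set x%:C | x in [set: R]].
Definition negative_axis (R : realType) : set R[i] :=
  [set x%:C | x in [set x : R | x < 0]].
Definition slit_plane (R : realType) : set R[i] :=
  ~` [set x%:C | x in [set x : R | 0 <= x]].

Definition bounded_operator (R : realType) (M : completeNormedModType R[i])
    (T : M -> M) : Prop :=
  linear T /\ exists k : R[i], forall f : M, `|T f| <= k * `|f|.

Definition orthogonal_projection (R : realType)
    (M : completeNormedModType R[i]) (dot : {dot M for Num.conj})
    (P : M -> M) : Prop :=
  [/\ bounded_operator P,
      forall f, P (P f) = P f
    & forall f g, dot (P f) g = dot f (P g)].

(* Complex differentiability in operator norm: for T in B(M) and e >= 0,
   the bound [forall f, `|T f| <= e * `|f|] says that T has norm at most e.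
   R[i]^o is R[i] with the topology given by its modulus. *)
Definition op_differentiable_at (R : realType)
    (M : completeNormedModType R[i]) (F : R[i] -> M -> M) (z : R[i]) : Prop :=
  exists2 D : M -> M, bounded_operator D &
    forall e : R[i], 0 < e ->
      \forall w \near (z : R[i]^o), forall f : M,
        `|F w f - F z f - (w - z) *: D f| <= e * `|w - z| * `|f|.

Definition op_holomorphic (R : realType) (M : completeNormedModType R[i])
    (U : set R[i]) (F : R[i] -> M -> M) : Prop :=
  open (U : set R[i]^o) /\
  forall z : R[i], U z -> bounded_operator (F z) /\ op_differentiable_at F z.

Definition linear_relation (R : realType) (M : completeNormedModType R[i])
    (H : set (M * M)) : Prop :=
  H 0 /\ forall (a : R[i]) (u v : M * M), H u -> H v -> H (a *: u + v).

Definition graph (R : realType) (M : completeNormedModType R[i])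
    (T : M -> M) : set (M * M) :=
  [set (f, T f) | f in [set: M]].

Definition rel_inv (R : realType) (M : completeNormedModType R[i])
    (H : set (M * M)) : set (M * M) :=
  [set (h.2, h.1) | h in H].

Definition rel_scale (R : realType) (M : completeNormedModType R[i])
    (a : R[i]) (H : set (M * M)) : set (M * M) :=
  [set (h.1, a *: h.2) | h in H].

Definition rel_shift (R : realType) (M : completeNormedModType R[i])
    (H : set (M * M)) (a : R[i]) : set (M * M) :=
  [set (h.1, h.2 + a *: h.1) | h in H].

Definition adjoint (R : realType) (M : completeNormedModType R[i])
    (dot : {dot M for Num.conj}) (H : set (M * M)) : set (M * M) :=
  [set k | forall h, H h -> dot h.2 k.1 = dot h.1 k.2].

Definition selfadjoint (R : realType) (M : completeNormedModType R[i])
    (dot : {dot M for Num.conj}) (H : set (M * M)) : Prop :=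
  linear_relation H /\ H = adjoint dot H.

(* In R[i], [0 <= z] means that z is real and nonnegative. *)
Definition nonnegative (R : realType) (M : completeNormedModType R[i])
    (dot : {dot M for Num.conj}) (H : set (M * M)) : Prop :=
  forall h, H h -> 0 <= dot h.2 h.1.

Definition nonpositive (R : realType) (M : completeNormedModType R[i])
    (dot : {dot M for Num.conj}) (H : set (M * M)) : Prop :=
  nonnegative dot (rel_scale (-1) H).

Definition nonneg_selfadjoint (R : realType) (M : completeNormedModType R[i])
    (dot : {dot M for Num.conj}) (H : set (M * M)) : Prop :=
  selfadjoint dot H /\ nonnegative dot H.

Definition dissipative (R : realType) (M : completeNormedModType R[i])
    (dot : {dot M for Num.conj}) (H : set (M * M)) : Prop :=
  forall h, H h -> 0 <= complex.Im (dot h.2 h.1).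

Definition accumulative (R : realType) (M : completeNormedModType R[i])
    (dot : {dot M for Num.conj}) (H : set (M * M)) : Prop :=
  forall h, H h -> complex.Im (dot h.2 h.1) <= 0.

Definition maximal_relation (R : realType) (M : completeNormedModType R[i])
    (property : set (M * M) -> Prop) (H : set (M * M)) : Prop :=
  [/\ linear_relation H, property H
    & forall K, linear_relation K -> property K -> H `<=` K -> K = H].

(* (H + mu)^-1 is the graph of the operator T. *)
Definition is_resolvent (R : realType) (M : completeNormedModType R[i])
    (H : set (M * M)) (mu : R[i]) (T : M -> M) : Prop :=
  rel_inv (rel_shift H mu) = graph T.

Definition resolvent_holomorphic_on (R : realType)
    (M : completeNormedModType R[i]) (U : set R[i])
    (Q : R[i] -> set (M * M)) (mu : R[i]) : Prop :=
  exists2 F : R[i] -> M -> M, op_holomorphic U F &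
    forall z, U z -> is_resolvent (Q z) mu (F z).

(* The continuation F lives on some open set containing U and ]-oo, 0[, and at
   a point x < 0 it takes the value (Q x + mu)^-1. *)
Definition resolvent_continues_to_negative_axis (R : realType)
    (M : completeNormedModType R[i]) (U : set R[i])
    (Q : R[i] -> set (M * M)) (mu : R[i]) : Prop :=
  exists (V : set R[i]) (F : R[i] -> M -> M),
    [/\ U `|` @negative_axis R `<=` V, op_holomorphic V F
      & forall z, (U `|` @negative_axis R) z -> is_resolvent (Q z) mu (F z)].

(* Families are total functions on R[i]; only their values on the relevant
   domain are ever constrained or used. *)
Definition nevanlinna_family (R : realType) (M : completeNormedModType R[i])
    (dot : {dot M for Num.conj}) (Q : R[i] -> set (M * M)) : Prop :=
  [/\ forall z, upper_half_plane z ->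
        maximal_relation (dissipative dot) (Q z),
      forall z, lower_half_plane z ->
        maximal_relation (accumulative dot) (Q z),
      forall z, nonreal z -> adjoint dot (Q z) = Q (Num.conj z),
      exists2 mu, upper_half_plane mu &
        resolvent_holomorphic_on (@upper_half_plane R) Q mu
    & exists2 mu, lower_half_plane mu &
        resolvent_holomorphic_on (@lower_half_plane R) Q mu].

Definition signed_stieltjes_family (R : realType)
    (M : completeNormedModType R[i]) (dot : {dot M for Num.conj})
    (sign : set (M * M) -> Prop) (Q : R[i] -> set (M * M)) : Prop :=
  [/\ forall z, slit_plane z -> linear_relation (Q z),
      nevanlinna_family dot Q,
      forall z, negative_axis z -> sign (Q z),
      exists2 mu, upper_half_plane mu &
        resolvent_continues_to_negative_axis (@upper_half_plane R) Q mu
    & exists2 mu, lower_half_plane mu &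
        resolvent_continues_to_negative_axis (@lower_half_plane R) Q mu].

Definition stieltjes_family (R : realType) (M : completeNormedModType R[i])
    (dot : {dot M for Num.conj}) (Q : R[i] -> set (M * M)) : Prop :=
  signed_stieltjes_family dot (nonnegative dot) Q.

Definition inverse_stieltjes_family (R : realType)
    (M : completeNormedModType R[i]) (dot : {dot M for Num.conj})
    (Q : R[i] -> set (M * M)) : Prop :=
  signed_stieltjes_family dot (nonpositive dot) Q.

Definition projection_relation (R : realType)
    (M : completeNormedModType R[i]) (P : M -> M) : set (M * M) :=
  [set (P f, f - P f) | f in [set: M]].

(* Main.v *)
Require Import Defs.
From HB Require Import structures.
From mathcomp Require Import all_boot all_order all_algebra complex.
From mathcomp Require Import all_classical all_reals all_analysis.
From mathcomp Require Import ring lra.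

Set Implicit Arguments.
Unset Strict Implicit.
Unset Printing Implicit Defensive.

Import Order.TTheory GRing.Theory Num.Theory.
Import numFieldNormedType.Exports.

Local Open Scope classical_set_scope.
Local Open Scope ring_scope.
Local Open Scope complex_scope.

(** Passing to - R(z)^-1 turns an inverse Stieltjes family into a Stieltjes one,
    and the symmetry Q(conj z) = Q(z)^* leaves only the upper half-plane and the
    negative axis to consider; replacing c by 1/c we may take c > 1.  In the
    variable w = log z a scalar function f with f(cz) = f(z) becomes holomorphic
    and periodic on the strip 0 < Im w <= pi, so by Cauchy's theorem (Goursat's
    bisection proof) the mean over a period of f times exp(i v w), v in
    (2 pi / log c) Z, does not depend on Im w.
    - If f vanishes on the negative axis, all its Fourier coefficients on every
      line vanish, hence f = 0.
    - If f = z q with Im q >= 0 and f is real on the negative axis, then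
      |z| Im q has mean O(sin (Im w)) on each line; letting Im w tend to 0 kills
      every non-constant Fourier coefficient of f on the negative axis, so f is
      constant.
    A Stieltjes family is nondecreasing on the negative axis, because a function
    with Im <= 0 above the axis and real on it has a nonpositive derivative there.
    Degree 0: monotone and c-invariant on the axis, hence constant there, hence
    constant by the first fact.  Degree -1: the bounded functions
    (Q(z)^-1 - z)^-1 have degree -1 too, and the second fact applies to z times
    their quadratic forms.  Degree 1: monotonicity gives c Q(x) <= Q(x) for
    x < 0, which leaves only 0 and infinity in the spectrum, so that Q(x) is a
    projection relation and (Q(z) + z)^-1 extends P / z from the axis. *)

(** * Integrals over segments *)

(** The definition of the families gives holomorphy of (Q z + mu)^-1 for a fixed mu, but dilating a
    homogeneous Q of degree 1 or -1 rescales mu too, so this resolvent has no homogeneity. It is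
    therefore replaced by (Q z + m z)^-1 with m of the same degree as Q: a constant, -1/z or z. That
    such moving resolvents keep differentiable matrix elements, up to the negative axis, is the bulk
    of the operator part. The scalar theorems are applied to these matrix elements; uniqueness of
    resolvents and polarization then lead back to relations. In the strip the obstacle is the edge
    Im w = 0, the image of the positive axis, where nothing is known. The first scalar fact avoids
    it, since the edge Im w = pi determines all Fourier coefficients. It requires the values on the
    negative axis to be known. For degree -1 monotonicity does not provide them, as Q(cx) = Q(x)/c
    <= Q(x) holds anyway for c > 1; the second fact, driven by a sign condition, replaces it. *)

Section segment_integral.
Context {R : realType}.
Implicit Types (f g : R -> R) (a b c : R).

Definition continuous_on_segment f a b :=
  forall x, a <= x <= b -> forall e : R, 0 < e -> exists2 r : R, 0 < r &
    forall y, a <= y <= b -> `|y - x| < r -> `|f y - f x| <= e.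

Definition segment_integral f a b := \int[lebesgue_measure]_(x in `[a, b]) f x.

Lemma continuous_on_segment_integrable f a b : continuous_on_segment f a b ->
  lebesgue_measure.-integrable `[a, b] (EFin \o f).
Proof.
move=> cf; apply: continuous_compact_integrable; first exact: segment_compact.
apply/subspace_continuousP => x /=; rewrite in_itv/= => xab.
apply/cvgrPdist_le => e e0.
have [r r0 H] := cf _ xab _ e0.
apply/nbhs_ballP; exists r => //= y; rewrite /ball/= => xy; rewrite in_itv/= => yab.
by rewrite distrC; apply: H => //; rewrite distrC.
Qed.

Lemma segment_integral_split f a b c : a <= b -> b <= c ->
  continuous_on_segment f a c ->
  segment_integral f a c = segment_integral f a b + segment_integral f b c.
Proof.
move=> ab bc cf; have I := continuous_on_segment_integrable cf.
apply/eqP; rewrite addrC -subr_eq; apply/eqP.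
rewrite /segment_integral Rintegral_itvB ?bnd_simp //.
apply: Rintegral_itv_obnd_cbnd; apply: integrableS I => //.
by apply: subset_itv; rewrite bnd_simp.
Qed.

Lemma segment_integralD f g a b :
  continuous_on_segment f a b -> continuous_on_segment g a b ->
  segment_integral (fun x => f x + g x) a b =
  segment_integral f a b + segment_integral g a b.
Proof. by move=> cf cg; apply: RintegralD => //; exact: continuous_on_segment_integrable. Qed.

Lemma segment_integralB f g a b :
  continuous_on_segment f a b -> continuous_on_segment g a b ->
  segment_integral (fun x => f x - g x) a b =
  segment_integral f a b - segment_integral g a b.
Proof. by move=> cf cg; apply: RintegralB => //; exact: continuous_on_segment_integrable. Qed.

Lemma segment_integralZ k f a b : continuous_on_segment f a b ->
  segment_integral (fun x => k * f x) a b = k * segment_integral f a b.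
Proof. by move=> cf; apply: RintegralZl => //; exact: continuous_on_segment_integrable. Qed.

Lemma segment_integral_cst k a b : a <= b ->
  segment_integral (fun=> k) a b = k * (b - a).
Proof.
move=> ab; rewrite /segment_integral Rintegral_cst //= lebesgue_measure_itv /= lte_fin.
have [|ba] := ltP a b; first by [].
by have -> : b = a; [apply/eqP; rewrite eq_le ab ba|rewrite subrr].
Qed.

Lemma eq_segment_integral f g a b : (forall x, a <= x <= b -> f x = g x) ->
  segment_integral f a b = segment_integral g a b.
Proof. by move=> fg; apply: eq_Rintegral => x; rewrite inE /= in_itv /=; exact: fg. Qed.

Lemma le_segment_integral f g a b :
  continuous_on_segment f a b -> continuous_on_segment g a b ->
  (forall x, a <= x <= b -> f x <= g x) ->
  segment_integral f a b <= segment_integral g a b.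
Proof.
move=> cf cg fg; apply: le_Rintegral => //;
  exact: continuous_on_segment_integrable.
Qed.

Lemma continuous_on_segment_cst k a b : continuous_on_segment (fun=> k) a b.
Proof. by move=> x _ e e0; exists 1 => // y _ _; rewrite subrr normr0 ltW. Qed.

Lemma continuous_on_segmentD f g a b :
  continuous_on_segment f a b -> continuous_on_segment g a b ->
  continuous_on_segment (fun x => f x + g x) a b.
Proof.
move=> cf cg x xab e e0; have e2 : 0 < e / 2 by rewrite divr_gt0.
have [r r0 fr] := cf x xab _ e2; have [t t0 gt] := cg x xab _ e2.
exists (Num.min r t); first by rewrite lt_min r0.
move=> y yab; rewrite lt_min => /andP[/(fr _ yab) + /(gt _ yab)].
rewrite !ler_norml => /andP[? ?] /andP[? ?]; apply/andP; split; lra.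
Qed.

Lemma continuous_on_segmentZ k f a b :
  continuous_on_segment f a b -> continuous_on_segment (fun x => k * f x) a b.
Proof.
move=> cf x xab e e0; have k0 : 0 < `|k| + 1 by rewrite ltr_wpDl.
have [r r0 fr] := cf x xab (e / (`|k| + 1)) (divr_gt0 e0 k0).
exists r => // y yab /(fr _ yab) => H.
rewrite -mulrBr normrM (le_trans (ler_wpM2l (normr_ge0 _) H)) //.
by rewrite mulrCA ler_piMr ?(ltW e0) // ler_pdivrMr // mul1r lerDl.
Qed.

Lemma continuous_on_segmentB f g a b :
  continuous_on_segment f a b -> continuous_on_segment g a b ->
  continuous_on_segment (fun x => f x - g x) a b.
Proof.
move=> cf /(@continuous_on_segmentZ (-1)) cg.
rewrite (_ : (fun x => _) = (fun x => f x + -1 * g x)); last first.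
  by apply/funext => x; rewrite mulN1r.
exact: continuous_on_segmentD.
Qed.

Lemma segment_integral_bound f k a b : a <= b -> continuous_on_segment f a b ->
  (forall x, a <= x <= b -> `|f x| <= k) ->
  `|segment_integral f a b| <= k * (b - a).
Proof.
move=> ab cf fk; rewrite ler_norml -mulNr -!segment_integral_cst //.
apply/andP; split; apply: le_segment_integral => //;
    try exact: continuous_on_segment_cst.
  by move=> x /fk; rewrite ler_norml => /andP[].
by move=> x /fk; rewrite ler_norml => /andP[].
Qed.

(** Meant for two opposite sides of a small rectangle: [k] cancels the increment of the linear part
    between them, and [e] bounds what remains. *)
Lemma segment_integral_near f g (k e : R) a b : a <= b ->
  continuous_on_segment f a b -> continuous_on_segment g a b ->
  (forall x, a <= x <= b -> `|f x - g x + k| <= e) ->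
  `|segment_integral f a b - segment_integral g a b + k * (b - a)| <= e * (b - a).
Proof.
move=> ab cf cg fg; have cfg := continuous_on_segmentB cf cg.
have ck : continuous_on_segment (fun=> k) a b by exact: continuous_on_segment_cst.
rewrite -segment_integralB // -segment_integral_cst // -segment_integralD //.
by apply: segment_integral_bound => //; exact: continuous_on_segmentD.
Qed.

End segment_integral.

(** * Goursat's theorem on rectangles *)

Section bisection.
Context {R : realType}.

Lemma nested_segments (x l : nat -> R) :
  (forall n, 0 <= l n) -> (forall n, x n <= x n.+1) ->
  (forall n, x n.+1 + l n.+1 <= x n + l n) ->
  exists s, forall n, x n <= s <= x n + l n.
Proof.
move=> l0 xS xlS.
have xmono n m : (n <= m)%N -> x n <= x m.
  elim: m => [|m IH]; first by rewrite leqn0 => /eqP ->.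
  by rewrite leq_eqVlt => /orP[/eqP -> //|/IH]; move/le_trans; apply.
have xlmono n m : (n <= m)%N -> x m + l m <= x n + l n.
  elim: m => [|m IH]; first by rewrite leqn0 => /eqP ->.
  by rewrite leq_eqVlt => /orP[/eqP -> //|/IH]; apply: le_trans.
have ub n m : x m <= x n + l n.
  have [/xmono mn|/ltnW/xlmono nm] := leqP m n.
    by rewrite (le_trans mn) // lerDl.
  by apply: le_trans nm; rewrite lerDl.
exists (sup (range x)) => n; apply/andP; split.
  by apply: ub_le_sup; [exists (x n + l n) => _ [m _ <-]|exists n].
by apply: ge_sup; [exists (x 0%N); exists 0%N|move=> _ [m _ <-]].
Qed.

Lemma geometric_small (q e : R) : 0 <= q -> q < 1 -> 0 < e -> exists n, q ^+ n < e.
Proof.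
move=> q0 q1 e0.
have /cvgrPdist_lt /(_ _ e0) [n _ /(_ n (leqnn n))] : q ^+ n @[n --> \oo] --> (0 : R).
  by apply: cvg_expr; rewrite ger0_norm.
by rewrite /= sub0r normrN ger0_norm ?exprn_ge0 //; exists n.
Qed.

(** An induction principle. A property inherited from the four quarters that fails on the whole
    rectangle fails on a nested sequence of similar rectangles, which shrink to a point where the
    local hypothesis excludes it. The triple [x y t] stands for the rectangle with lower left corner
    (x, y) and sides [w * t] and [h * t]. A zero side is allowed, so the principle also bisects
    segments. *)
Lemma rectangle_bisection (w h : R) (P : R -> R -> R -> Prop) (x0 y0 : R) :
  0 <= w -> 0 <= h ->
  (forall x y t, 0 < t -> P x y (t / 2) -> P (x + w * (t / 2)) y (t / 2) ->
     P x (y + h * (t / 2)) (t / 2) ->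
     P (x + w * (t / 2)) (y + h * (t / 2)) (t / 2) -> P x y t) ->
  (forall s u, x0 <= s <= x0 + w -> y0 <= u <= y0 + h ->
     exists2 r, 0 < r & forall x y t, 0 < t < r ->
       x <= s <= x + w * t -> y <= u <= y + h * t -> P x y t) ->
  P x0 y0 1.
Proof.
move=> w0 h0 quarters local; apply: contrapT => nP.
(* Move to a quarter where [P] fails. The last branch needs no test: if [P] held on all four
   quarters it would hold on the whole. *)
pose step (p : R * R * R) :=
  let: (x, y, t) := p in let t' := t / 2 in
  if ~~ `[< P x y t' >] then (x, y, t') else
  if ~~ `[< P (x + w * t') y t' >] then (x + w * t', y, t') else
  if ~~ `[< P x (y + h * t') t' >] then (x, y + h * t', t') else
  (x + w * t', y + h * t', t').
pose p n := iter n step (x0, y0, 1).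
have tE n : (p n).2 = 2^-1 ^+ n.
  elim: n => [|n]; rewrite ?expr0 //= -/(p n); case: (p n) => [[x y] t] /= ->.
  by rewrite exprSr; do ! case: ifP.
have t_gt0 n : 0 < (p n).2 by rewrite tE exprn_gt0 // invr_gt0.
have nPp n : ~ P (p n).1.1 (p n).1.2 (p n).2.
  elim: n => [//|n]; have := t_gt0 n; rewrite /= -/(p n).
  case: (p n) => [[x y] t] /= t0 nPt.
  case: ifPn => [/asboolPn //|/negPn/asboolP P1].
  case: ifPn => [/asboolPn //|/negPn/asboolP P2].
  case: ifPn => [/asboolPn //|/negPn/asboolP P3].
  by move=> P4; apply: nPt; exact: quarters.
have nest n : [/\ (p n).1.1 <= (p n.+1).1.1, (p n).1.2 <= (p n.+1).1.2,
    (p n.+1).1.1 + w * (p n.+1).2 <= (p n).1.1 + w * (p n).2 &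
    (p n.+1).1.2 + h * (p n.+1).2 <= (p n).1.2 + h * (p n).2].
  have := t_gt0 n; rewrite /= -/(p n); case: (p n) => [[x y] t] /= t0.
  have wt : 0 <= w * t by rewrite mulr_ge0 // ltW.
  have ht : 0 <= h * t by rewrite mulr_ge0 // ltW.
  by do ! case: ifP => _ /=; split; lra.
have [s sP] : exists s, forall n, (p n).1.1 <= s <= (p n).1.1 + w * (p n).2.
  apply: (@nested_segments _ (fun n => w * (p n).2)) => n; try by have [] := nest n.
  by rewrite mulr_ge0 // ltW.
have [u uP] : exists s, forall n, (p n).1.2 <= s <= (p n).1.2 + h * (p n).2.
  apply: (@nested_segments _ (fun n => h * (p n).2)) => n; try by have [] := nest n.
  by rewrite mulr_ge0 // ltW.
have [||r r0 rP] := local s u.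
- by have := sP 0%N; rewrite /= mulr1.
- by have := uP 0%N; rewrite /= mulr1.
have [n nr] : exists n, (p n).2 < r.
  by under eq_exists do rewrite tE; apply: geometric_small; rewrite ?invr_ge0 ?invf_lt1 ?ltr1n.
by apply: (nPp n); apply: rP => //; rewrite t_gt0.
Qed.

End bisection.

Section modulus.
Context {R : realType}.
Implicit Types z w : R[i].

(** The norm of [R[i]] has its values in [R[i]]; a real-valued modulus, and [rnorm] for vectors, put
    the estimates within reach of [lra] and [nra]. *)
Definition modulus z : R := Normc.normc z.

Lemma modulusE z : `|z| = (modulus z)%:C.
Proof. by rewrite normc_def; case: z. Qed.

Lemma modulus_ge0 z : 0 <= modulus z.
Proof. by rewrite -lecR -modulusE normr_ge0. Qed.

Lemma modulusD z w : modulus (z + w) <= modulus z + modulus w.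
Proof. by rewrite -lecR rmorphD /= -!modulusE ler_normD. Qed.

Lemma modulusM z w : modulus (z * w) = modulus z * modulus w.
Proof. exact: Normc.normcM. Qed.

Lemma modulusN z : modulus (- z) = modulus z.
Proof. exact: normcN. Qed.

Lemma modulusB z w : modulus (z - w) = modulus (w - z).
Proof. by rewrite -modulusN opprB. Qed.

Lemma modulus0 : modulus 0 = 0.
Proof. exact: Normc.normc0. Qed.

Lemma modulus_real (x : R) : modulus x%:C = `|x|.
Proof. by rewrite /modulus /= expr0n addr0 sqrtr_sqr. Qed.

Lemma modulusV z : modulus z^-1 = (modulus z)^-1.
Proof. exact: Normc.normcV. Qed.

Lemma modulus_eq0 z : (modulus z == 0) = (z == 0).
Proof.
by apply/eqP/eqP => [/Normc.eq0_normc //|->]; exact: modulus0.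
Qed.

Lemma modulus_gt0 z : (0 < modulus z) = (z != 0).
Proof. by rewrite lt0r modulus_ge0 andbT modulus_eq0. Qed.

Lemma Re_le_modulus z : `|complex.Re z| <= modulus z.
Proof. by rewrite -lecR -modulusE normc_ge_Re. Qed.

Lemma Im_le_modulus z : `|complex.Im z| <= modulus z.
Proof.
case: z => x y /=; rewrite -sqrtr_sqr ler_wsqrtr // lerDr sqr_ge0 //.
Qed.

Lemma modulus_le z : modulus z <= `|complex.Re z| + `|complex.Im z|.
Proof.
rewrite {1}[z]complexE (le_trans (modulusD _ _)) // modulusM !modulus_real.
by rewrite /modulus /= expr0n expr1n add0r sqrtr1 mul1r.
Qed.

End modulus.

Section complex_derivative.
Context {R : realType}.
Implicit Types (D : set R[i]) (f g : R[i] -> R[i]) (z w d : R[i]).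

(* The derivative at z is taken along D, so that D may be closed: on the edge
   of a half-plane or of a rectangle it is a one-sided derivative. *)
Definition has_cderiv D f z d := forall e : R, 0 < e ->
  exists2 r : R, 0 < r & forall w, D w -> modulus (w - z) < r ->
    modulus (f w - f z - d * (w - z)) <= e * modulus (w - z).

Lemma has_cderivW D E f z d : E `<=` D -> has_cderiv D f z d -> has_cderiv E f z d.
Proof.
move=> ED fd e e0; have [r r0 H] := fd e e0; exists r => // w /ED; exact: H.
Qed.

Lemma has_cderiv_lipschitz D f z d : has_cderiv D f z d ->
  exists2 r : R, 0 < r & forall w, D w -> modulus (w - z) < r ->
    modulus (f w - f z) <= (modulus d + 1) * modulus (w - z).
Proof.
move=> /(_ _ ltr01) [r r0 H]; exists r => // w Dw wz.
have -> : f w - f z = d * (w - z) + (f w - f z - d * (w - z)) by ring.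
rewrite (le_trans (modulusD _ _)) // modulusM mulrDl lerD2l.
exact: H.
Qed.

Lemma has_cderiv_cvg D f z d : has_cderiv D f z d -> forall e : R, 0 < e ->
  exists2 r : R, 0 < r & forall w, D w -> modulus (w - z) < r ->
    modulus (f w - f z) <= e.
Proof.
move=> /has_cderiv_lipschitz [r r0 H] e e0.
have k0 : 0 < modulus d + 1 by rewrite ltr_wpDl // modulus_ge0.
exists (Num.min r (e / (modulus d + 1))).
  by rewrite lt_min r0 divr_gt0.
move=> w Dw; rewrite lt_min => /andP[wr we].
rewrite (le_trans (H _ Dw wr)) // mulrC -ler_pdivlMr //; exact: ltW.
Qed.

End complex_derivative.

Section rectangle.
Context {R : realType}.
Implicit Types (f : R[i] -> R[i]) (a b c d x y s t : R).

Definition rectangle a b c d : set R[i] :=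
  [set z | a <= complex.Re z <= b /\ c <= complex.Im z <= d].

Definition horizontal_integral f a b y :=
  segment_integral (fun s => complex.Re (f (s +i* y))) a b.

(** The imaginary part enters because dz = i dt on a vertical side. The other half of Cauchy's
    theorem is recovered by passing from f to ['i * f]. *)
Definition vertical_integral f x c d :=
  segment_integral (fun t => complex.Im (f (x +i* t))) c d.

(* The opposite of the real part of the contour integral of f along the
   boundary of the rectangle, that is, the flux of (Im f, Re f). *)
Definition boundary_flux f a b c d :=
  horizontal_integral f a b d - horizontal_integral f a b c +
  (vertical_integral f b c d - vertical_integral f a c d).

Variables (f : R[i] -> R[i]) (D : set R[i]).
Hypothesis f_diff : forall z, D z -> exists k : R[i], has_cderiv D f z k.

Lemma horizontal_continuous (g : R[i] -> R) a b y :
  (forall z w, `|g z - g w| <= modulus (z - w)) ->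
  (forall s, a <= s <= b -> D (s +i* y)) ->
  continuous_on_segment (fun s => g (f (s +i* y))) a b.
Proof.
move=> gl Dab s sab e e0; have [k fd] := f_diff (Dab _ sab).
have [r r0 H] := has_cderiv_cvg fd e0.
exists r => // s' s'ab ss'; apply: le_trans (gl _ _) _; apply: H; first exact: Dab.
have -> : (s' +i* y) - (s +i* y) = (s' - s)%:C
  by apply/eqP; rewrite eq_complex /= subrr !eqxx.
by rewrite modulus_real.
Qed.

Lemma vertical_continuous (g : R[i] -> R) x c d :
  (forall z w, `|g z - g w| <= modulus (z - w)) ->
  (forall t, c <= t <= d -> D (x +i* t)) ->
  continuous_on_segment (fun t => g (f (x +i* t))) c d.
Proof.
move=> gl Dcd t tcd e e0; have [k fd] := f_diff (Dcd _ tcd).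
have [r r0 H] := has_cderiv_cvg fd e0.
exists r => // t' t'cd tt'; apply: le_trans (gl _ _) _; apply: H; first exact: Dcd.
have -> : (x +i* t') - (x +i* t) = 'i * (t' - t)%:C
  by apply/eqP; rewrite eq_complex /=; apply/andP; split; apply/eqP; ring.
by rewrite modulusM modulus_real /modulus /= expr0n expr1n add0r sqrtr1 mul1r.
Qed.

Lemma Re_lipschitz (z w : R[i]) : `|complex.Re z - complex.Re w| <= modulus (z - w).
Proof. by case: z w => x y [x' y']; apply: (Re_le_modulus (_ +i* _)). Qed.

Lemma Im_lipschitz (z w : R[i]) : `|complex.Im z - complex.Im w| <= modulus (z - w).
Proof. by case: z w => x y [x' y']; apply: (Im_le_modulus (_ +i* _)). Qed.

Lemma boundary_flux_quarters a m b c n d :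
  a <= m -> m <= b -> c <= n -> n <= d -> rectangle a b c d `<=` D ->
  boundary_flux f a b c d = boundary_flux f a m c n + boundary_flux f m b c n +
    (boundary_flux f a m n d + boundary_flux f m b n d).
Proof.
move=> am mb cn nd rD.
have ab := le_trans am mb; have cd := le_trans cn nd.
have cH y : c <= y <= d -> continuous_on_segment (fun s => complex.Re (f (s +i* y))) a b.
  by move=> ycd; apply: horizontal_continuous => [|s sab]; [exact: Re_lipschitz|exact: rD].
have cV x : a <= x <= b -> continuous_on_segment (fun t => complex.Im (f (x +i* t))) c d.
  by move=> xab; apply: vertical_continuous => [|s sab]; [exact: Im_lipschitz|exact: rD].
have sH y : c <= y <= d -> horizontal_integral f a b y =
    horizontal_integral f a m y + horizontal_integral f m b y.
  by move=> /cH; exact: segment_integral_split.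
have sV x : a <= x <= b -> vertical_integral f x c d =
    vertical_integral f x c n + vertical_integral f x n d.
  by move=> /cV; exact: segment_integral_split.
rewrite /boundary_flux !sH ?lexx ?cd // !sV ?lexx ?ab //; ring.
Qed.

(** Affine functions have zero flux: when opposite sides are paired, the slope [k] contributes
    [Im k] times the area from one pair and its opposite from the other. On each side the remainder
    is at most [e] times the half-perimeter. *)
Lemma boundary_flux_local a b c d (z k : R[i]) (e : R) : a <= b -> c <= d ->
  rectangle a b c d `<=` D -> 0 <= e ->
  (forall w, rectangle a b c d w ->
    modulus (f w - f z - k * (w - z)) <= e * modulus (w - z)) ->
  rectangle a b c d z ->
  `|boundary_flux f a b c d| <= 2 * e * ((b - a) + (d - c)) ^+ 2.
Proof.
move=> ab cd rD e0 fk rz.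
pose err w := f w - f z - k * (w - z).
have err_le w : rectangle a b c d w -> modulus (err w) <= e * ((b - a) + (d - c)).
  move=> rw; apply: le_trans (fk _ rw) _; rewrite ler_wpM2l //.
  apply: le_trans (modulus_le _) _.
  case: w z rw rz {fk err} => x y [x' y'] [/= /andP[? ?] /andP[? ?]] [/= /andP[? ?] /andP[? ?]].
  by rewrite lerD // ler_norml; apply/andP; split; lra.
have fE w : f w = f z + k * (w - z) + err w by rewrite /err; ring.
have K0 : 0 <= e * (b - a + (d - c)) by rewrite mulr_ge0 //; lra.
set K := e * (b - a + (d - c)) in err_le K0.
have cH y : c <= y <= d -> continuous_on_segment (fun s => complex.Re (f (s +i* y))) a b.
  by move=> ycd; apply: horizontal_continuous => [|s sab]; [exact: Re_lipschitz|exact: rD].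
have cV x : a <= x <= b -> continuous_on_segment (fun t => complex.Im (f (x +i* t))) c d.
  by move=> xab; apply: vertical_continuous => [|s sab]; [exact: Im_lipschitz|exact: rD].
have rs s y : a <= s <= b -> c <= y <= d -> rectangle a b c d (s +i* y) by [].
have Hle : `|horizontal_integral f a b d - horizontal_integral f a b c
             + complex.Im k * (d - c) * (b - a)| <= 2 * K * (b - a).
  apply: segment_integral_near => // [||s sab];
    [by apply: cH; rewrite lexx cd|by apply: cH; rewrite lexx cd|].
  have /err_le Ed := rs s d sab ltac:(by rewrite lexx cd).
  have /err_le Ec := rs s c sab ltac:(by rewrite lexx cd).
  rewrite (_ : _ + _ = complex.Re (err (s +i* d) - err (s +i* c))); last first.
    have -> : err (s +i* d) - err (s +i* c) =
        f (s +i* d) - f (s +i* c) - k * (s +i* d - s +i* c) by rewrite /err; ring.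
    case: (f (s +i* d)) (f (s +i* c)) k {err fE fk err_le Ed Ec} => [p q] [p' q'] [k1 k2].
    by simpc => /=; ring.
  rewrite (le_trans (Re_le_modulus _)) // (le_trans (modulusD _ _)) // modulusN; lra.
have Vle : `|vertical_integral f b c d - vertical_integral f a c d
             + - complex.Im k * (b - a) * (d - c)| <= 2 * K * (d - c).
  apply: segment_integral_near => // [||s sab];
    [by apply: cV; rewrite lexx ab|by apply: cV; rewrite lexx ab|].
  have /err_le Eb := rs b s ltac:(by rewrite lexx ab) sab.
  have /err_le Ea := rs a s ltac:(by rewrite lexx ab) sab.
  rewrite (_ : _ + _ = complex.Im (err (b +i* s) - err (a +i* s))); last first.
    have -> : err (b +i* s) - err (a +i* s) =
        f (b +i* s) - f (a +i* s) - k * (b +i* s - a +i* s) by rewrite /err; ring.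
    case: (f (b +i* s)) (f (a +i* s)) k {err fE fk err_le Eb Ea Hle} => [p q] [p' q'] [k1 k2].
    by simpc => /=; ring.
  rewrite (le_trans (Im_le_modulus _)) // (le_trans (modulusD _ _)) // modulusN; lra.
rewrite /boundary_flux.
have -> : 2 * e * (b - a + (d - c)) ^+ 2 = 2 * K * (b - a) + 2 * K * (d - c).
  by rewrite /K; ring.
move: Hle Vle; rewrite !ler_norml => /andP[? ?] /andP[? ?]; apply/andP.
by split; lra.
Qed.

End rectangle.

Theorem goursat_rectangle {R : realType} (f : R[i] -> R[i]) (a b c d : R) :
  a <= b -> c <= d ->
  (forall z, rectangle a b c d z -> exists k, has_cderiv (rectangle a b c d) f z k) ->
  boundary_flux f a b c d = 0.
Proof.
move=> ab cd f_diff; apply/eqP; rewrite -normr_le0; apply/ler_addgt0Pl => e e0.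
rewrite addr0; pose w := b - a; pose h := d - c.
have w0 : 0 <= w by rewrite subr_ge0.
have h0 : 0 <= h by rewrite subr_ge0.
(* The bound scales like the area, so the bounds of the four quarters add up exactly to that of the
   whole. *)
pose P x y t := a <= x -> x + w * t <= b -> c <= y -> y + h * t <= d ->
  `|boundary_flux f x (x + w * t) y (y + h * t)| <= e * t ^+ 2.
have sub x y (t : R) : 0 <= t -> a <= x -> x + w * t <= b -> c <= y -> y + h * t <= d ->
    rectangle x (x + w * t) y (y + h * t) `<=` rectangle a b c d.
  move=> t0 ? ? ? ? [p q] [/= /andP[? ?] /andP[? ?]].
  by split; apply/andP; split => /=; lra.
suff : P a c 1.
  rewrite /P !mulr1 expr1n mulr1 /w /h ![_ + (_ - _)]addrC !subrK; exact.
apply: (rectangle_bisection w0 h0) => [x y t t0 P1 P2 P3 P4 ax xb cy yd|s u sab ucd].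
- have wt : 0 <= w * t by rewrite mulr_ge0 // ltW.
  have ht : 0 <= h * t by rewrite mulr_ge0 // ltW.
  rewrite (@boundary_flux_quarters _ _ _ f_diff _ (x + w * (t / 2)) _ _ (y + h * (t / 2)));
    [|lra..|apply: sub => //; lra].
  have E1 : x + w * (t / 2) + w * (t / 2) = x + w * t by field.
  have E2 : y + h * (t / 2) + h * (t / 2) = y + h * t by field.
  have x1 : a <= x + w * (t / 2) by lra.
  have x2 : x + w * (t / 2) <= b by lra.
  have y1 : c <= y + h * (t / 2) by lra.
  have y2 : y + h * (t / 2) <= d by lra.
  move: P1 P2 P3 P4; rewrite /P E1 E2.
  move=> /(_ ax x2 cy y2) P1 /(_ x1 xb cy y2) P2 /(_ ax x2 y1 yd) P3 /(_ x1 xb y1 yd) P4.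
  have -> : e * t ^+ 2 = e * (t / 2) ^+ 2 + e * (t / 2) ^+ 2 +
      (e * (t / 2) ^+ 2 + e * (t / 2) ^+ 2) by field.
  apply: le_trans (ler_normD _ _) _.
  by apply: lerD; apply: le_trans (ler_normD _ _) _; exact: lerD.
(* [boundary_flux_local] costs a factor 2 (w + h)^2; the added 1 keeps the divisor positive for a
   rectangle reduced to a point. *)
- have k0 : 0 < 2 * (w + h) ^+ 2 + 1 by rewrite ltr_wpDl // mulr_ge0 // sqr_ge0.
  have rsu : rectangle a b c d (s +i* u) by move: sab ucd; rewrite /w /h; split=> /=; lra.
  have [k fk] := f_diff _ rsu.
  have [r r0 H] := fk (e / (2 * (w + h) ^+ 2 + 1)) (divr_gt0 e0 k0).
  have wh0 : 0 <= w + h by rewrite addr_ge0.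
  exists (r / (w + h + 1)); first by rewrite divr_gt0 // ltr_wpDl.
  move=> x y t /andP[t0 tr] sx uy ax xb cy yd.
  have {}tr : (w + h) * t < r.
    move: tr; rewrite ltr_pdivlMr ?ltr_wpDl // => tr; apply: le_lt_trans tr.
    by rewrite mulrC ler_wpM2l ?(ltW t0) // lerDl.
  have wt : 0 <= w * t by rewrite mulr_ge0 // ltW.
  have ht : 0 <= h * t by rewrite mulr_ge0 // ltW.
  have rsub := sub x y t (ltW t0) ax xb cy yd.
  apply: le_trans (@boundary_flux_local _ _ _ f_diff _ _ _ _ (s +i* u) k
     (e / (2 * (w + h) ^+ 2 + 1)) _ _ rsub _ _ _) _; [lra|lra| | |by []|].
  + by rewrite divr_ge0 ?(ltW e0) // ltW.
  + move=> z rz; apply: H; first exact: rsub.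
    apply: le_lt_trans tr; apply: le_trans (modulus_le _) _.
    case: z rz => p q [/= /andP[p1 p2] /andP[q1 q2]].
    case/andP: sx uy => s1 s2 /andP[u1 u2]; clear -p1 p2 q1 q2 s1 s2 u1 u2.
    by rewrite mulrDl lerD // ler_norml; apply/andP; split; lra.
  + have -> : x + w * t - x + (y + h * t - y) = (w + h) * t by ring.
    rewrite (_ : _ * _ = (2 * (w + h) ^+ 2 / (2 * (w + h) ^+ 2 + 1)) * (e * t ^+ 2)).
      apply: ler_piMl; first by rewrite mulr_ge0 ?sqr_ge0 // ltW.
      by rewrite ler_pdivrMr // mul1r lerDl.
    by rewrite exprMn; ring.
Qed.

(** * Complex derivatives *)

Section complex_derivative_rules.
Context {R : realType}.
Implicit Types (D : set R[i]) (f g : R[i] -> R[i]) (z w k l : R[i]).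

Lemma has_cderiv_cst D z k : has_cderiv D (fun=> k) z 0.
Proof.
move=> e e0; exists 1 => // w _ _; rewrite subrr mul0r subrr modulus0.
by rewrite mulr_ge0 ?modulus_ge0 // ltW.
Qed.

Lemma has_cderiv_id D z : has_cderiv D id z 1.
Proof.
move=> e e0; exists 1 => // w _ _; rewrite mul1r subrr modulus0.
by rewrite mulr_ge0 ?modulus_ge0 // ltW.
Qed.

Lemma has_cderivD D f g z k l : has_cderiv D f z k -> has_cderiv D g z l ->
  has_cderiv D (fun w => f w + g w) z (k + l).
Proof.
move=> fk gl e e0; have e2 : 0 < e / 2 by rewrite divr_gt0.
have [r r0 fr] := fk _ e2; have [s s0 gs] := gl _ e2.
exists (Num.min r s); first by rewrite lt_min r0.
move=> w Dw; rewrite lt_min => /andP[/(fr _ Dw) F /(gs _ Dw) G].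
have -> : f w + g w - (f z + g z) - (k + l) * (w - z) =
  f w - f z - k * (w - z) + (g w - g z - l * (w - z)) by ring.
by rewrite (le_trans (modulusD _ _)) // [e]splitr mulrDl lerD.
Qed.

Lemma has_cderivM D f g z k l : has_cderiv D f z k -> has_cderiv D g z l ->
  has_cderiv D (fun w => f w * g w) z (k * g z + f z * l).
Proof.
move=> fk gl e e0.
pose K := modulus (f z) + modulus (g z) + (modulus k + 1).
have K0 : 0 < K.
  by rewrite /K ltr_wpDl ?addr_ge0 ?modulus_ge0 // ltr_wpDl ?modulus_ge0.
have e3 : 0 < e / (3 * K) by rewrite divr_gt0 // mulr_gt0.
have [r r0 fr] := fk _ e3; have [s s0 gs] := gl _ e3.
have [t t0 ft] := has_cderiv_lipschitz fk.
have [u u0 gu] := has_cderiv_cvg gl e3.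
exists (Num.min (Num.min r s) (Num.min t u)); first by rewrite !lt_min r0 s0 t0.
move=> w Dw; rewrite !lt_min => /andP[/andP[/(fr _ Dw) F /(gs _ Dw) G] /andP[/(ft _ Dw) F' /(gu _ Dw) G']].
have -> : f w * g w - f z * g z - (k * g z + f z * l) * (w - z) =
  (f w - f z - k * (w - z)) * g z + f z * (g w - g z - l * (w - z))
   + (f w - f z) * (g w - g z) by ring.
rewrite (le_trans (modulusD _ _)) //.
have -> : e * modulus (w - z) = (e / (3 * K) * modulus (w - z)) * K
    + (e / (3 * K) * modulus (w - z)) * K + (e / (3 * K) * modulus (w - z)) * K.
  field; exact: lt0r_neq0.
apply: lerD; first (apply: le_trans (modulusD _ _) _; apply: lerD).
- rewrite modulusM; apply: ler_pM; rewrite ?modulus_ge0 //.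
  by rewrite /K -addrA addrCA lerDl addr_ge0 ?modulus_ge0 // addr_ge0 ?modulus_ge0.
- rewrite modulusM mulrC; apply: ler_pM; rewrite ?modulus_ge0 //.
  by rewrite /K -addrA lerDl addr_ge0 ?modulus_ge0 // addr_ge0 ?modulus_ge0.
- rewrite modulusM; apply: le_trans (ler_pM _ _ F' G') _; rewrite ?modulus_ge0 //.
  rewrite [leRHS]mulrC [in leRHS]mulrA [leRHS]mulrAC ler_wpM2r ?(ltW e3) //.
  by rewrite ler_wpM2r ?modulus_ge0 // /K lerDr addr_ge0 ?modulus_ge0.
Qed.

Lemma has_cderivZ D f z k l : has_cderiv D f z k ->
  has_cderiv D (fun w => l * f w) z (l * k).
Proof.
move=> /(has_cderivM (has_cderiv_cst D z l)); by rewrite mul0r add0r.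
Qed.

Lemma has_cderiv_comp D E f g z k l : (forall w, D w -> E (g w)) -> D z ->
  has_cderiv E f (g z) k -> has_cderiv D g z l ->
  has_cderiv D (fun w => f (g w)) z (k * l).
Proof.
move=> gDE Dz fk gl e e0.
pose K := modulus k + (modulus l + 1).
have K0 : 0 < K by rewrite ltr_wpDl ?modulus_ge0 // ltr_wpDl ?modulus_ge0.
have e2 : 0 < e / (2 * K) by rewrite divr_gt0 // mulr_gt0.
have [r r0 fr] := fk _ e2; have [s s0 gs] := gl _ e2.
have [t t0 gt] := has_cderiv_lipschitz gl.
have L0 : 0 < modulus l + 1 by rewrite ltr_wpDl ?modulus_ge0.
exists (Num.min (r / (modulus l + 1)) (Num.min s t)).
  by rewrite !lt_min s0 t0 andbT divr_gt0.
move=> w Dw; rewrite !lt_min => /andP[wr /andP[/(gs _ Dw) G /(gt _ Dw) L]].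
have {}wr : modulus (g w - g z) < r.
  by apply: le_lt_trans L _; rewrite mulrC -ltr_pdivlMr.
have F := fr _ (gDE _ Dw) wr.
have -> : f (g w) - f (g z) - k * l * (w - z) =
  (f (g w) - f (g z) - k * (g w - g z)) + k * (g w - g z - l * (w - z)) by ring.
rewrite (le_trans (modulusD _ _)) //.
have -> : e * modulus (w - z) = e / (2 * K) * (K * modulus (w - z))
   + K * (e / (2 * K) * modulus (w - z)) by field; exact: lt0r_neq0.
apply: lerD.
  apply: le_trans F _; rewrite ler_wpM2l ?(ltW e2) //; apply: le_trans L _.
  by rewrite ler_wpM2r ?modulus_ge0 // lerDr modulus_ge0.
rewrite modulusM; apply: ler_pM; rewrite ?modulus_ge0 //.
by rewrite lerDl ltW.
Qed.

Lemma has_cderivV D z : z != 0 -> has_cderiv D (fun w => w^-1) z (- z^-1 ^+ 2).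
Proof.
move=> z0 e e0; have mz : 0 < modulus z by rewrite modulus_gt0.
exists (Num.min (modulus z / 2) (e * modulus z ^+ 3 / 2)).
  by rewrite lt_min !divr_gt0 // mulr_gt0 // exprn_gt0.
move=> w _; rewrite lt_min => /andP[wz we].
have mw : modulus z / 2 < modulus w.
  have := modulusD (z - w) w; rewrite subrK modulusB; lra.
have w0 : w != 0 by rewrite -modulus_gt0; apply: lt_trans mw; rewrite divr_gt0.
have -> : w^-1 - z^-1 - (- z^-1 ^+ 2) * (w - z) =
    (w - z) * ((w - z) * (w^-1 * z^-1 ^+ 2)) by field; rewrite z0 w0.
rewrite modulusM mulrC ler_wpM2r ?modulus_ge0 // !modulusM !modulusV.
have -> : e = e * modulus z ^+ 3 / 2 * ((modulus z / 2)^-1 * ((modulus z)^-1 * (modulus z)^-1)).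
  by field; rewrite modulus_eq0 z0.
apply: ler_pM; rewrite ?modulus_ge0 ?mulr_ge0 ?invr_ge0 ?modulus_ge0 //; first exact: ltW.
rewrite ler_wpM2r ?mulr_ge0 ?invr_ge0 ?modulus_ge0 // lef_pV2 ?posrE ?(ltW mw) //.
  by rewrite modulus_gt0.
by rewrite divr_gt0.
Qed.

End complex_derivative_rules.

(** * The complex exponential *)

Section complex_exponential.
Context {R : realType}.
Implicit Types (z w : R[i]).

Definition cexp z : R[i] :=
  (expR (complex.Re z) * cos (complex.Im z)) +i* (expR (complex.Re z) * sin (complex.Im z)).

Lemma cexpD z w : cexp (z + w) = cexp z * cexp w.
Proof.
case: z w => [a b] [c d]; rewrite /cexp /= expRD cosD sinD.
by apply/eqP; rewrite eq_complex /=; apply/andP; split; apply/eqP; ring.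
Qed.

Lemma cexp0 : cexp 0 = 1.
Proof. by rewrite /cexp /= expR0 cos0 sin0 mulr0 mulr1. Qed.

Lemma cexp_neq0 z : cexp z != 0.
Proof.
apply: contra_neq (oner_neq0 R[i]) => z0.
by have := cexpD z (- z); rewrite subrr z0 mul0r cexp0.
Qed.

Lemma real_derivative_bound (g : R -> R) (x d : R) : is_derive x 1 g d ->
  forall e : R, 0 < e -> exists2 r : R, 0 < r & forall h, `|h| < r ->
    `|g (x + h) - g x - d * h| <= e * `|h|.
Proof.
move=> [dg dE] e e0; move: dg; rewrite /derivable; move/cvg_ex => [l gl].
have {dE}ld : l = d by rewrite -dE; symmetry; exact: cvg_lim gl.
move: gl => /cvgrPdist_le /(_ e e0); rewrite ld.
move/nbhs_ballP => [r /= r0 H]; exists r => // h hr.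
have [->|h0] := eqVneq h 0; first by rewrite addr0 subrr mulr0 subrr normr0 mulr0.
have := H h; rewrite /ball /= sub0r normrN => /(_ hr h0).
rewrite distrC => gh.
have -> : g (x + h) - g x - d * h = (h^-1 *: (g (h *: 1 + x) - g x) - d) * h.
  rewrite /GRing.scale /= mulr1 [h + x]addrC; field; exact: h0.
by rewrite normrM ler_wpM2r.
Qed.

Lemma has_cderiv_cexp D z : has_cderiv D cexp z (cexp z).
Proof.
move=> e e0.
have mz : 0 < modulus (cexp z) by rewrite modulus_gt0 cexp_neq0.
pose e' := Num.min 1 (e / (9 * modulus (cexp z))).
have e'0 : 0 < e' by rewrite lt_min ltr01 divr_gt0 // mulr_gt0.
have e'1 : e' <= 1 by rewrite ge_min lexx.
have e'e : e' <= e / (9 * modulus (cexp z)) by rewrite ge_min lexx orbT.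
clearbody e'.
have [r r0 Hexp] := real_derivative_bound (is_derive_expR 0) e'0.
have [s s0 Hcos] := real_derivative_bound (is_derive_cos 0) e'0.
have [t t0 Hsin] := real_derivative_bound (is_derive_sin 0) e'0.
exists (Num.min (Num.min r s) (Num.min t e')); first by rewrite !lt_min r0 s0 t0 e'0.
move=> w _; rewrite !lt_min; set h := w - z.
have -> : w = z + h by rewrite /h; ring.
rewrite cexpD => /andP[/andP[hr hs] /andP[ht he]].
have -> : cexp z * cexp h - cexp z - cexp z * h = cexp z * (cexp h - 1 - h) by ring.
rewrite modulusM.
(* The addition formula has reduced the claim to the derivative at 0. The constant is 9 = 4 + (1 +
   4), from the bounds [N1] and [N2] on the real and imaginary parts together with m * m <= e' *
   m. *)
suff H : modulus (cexp h - 1 - h) <= 9 * e' * modulus h.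
  apply: le_trans (ler_wpM2l (modulus_ge0 _) H) _.
  rewrite mulrA ler_wpM2r ?modulus_ge0 //; move: e'e; rewrite ler_pdivlMr ?mulr_gt0 //; lra.
case: h hr hs ht he => a b; set m := modulus _ => hr hs ht he.
have am : `|a| <= m by exact: (Re_le_modulus (a +i* b)).
have bm : `|b| <= m by exact: (Im_le_modulus (a +i* b)).
have m0 : 0 <= m := modulus_ge0 _.
have {Hexp} := Hexp a (le_lt_trans am hr).
have {Hcos} := Hcos b (le_lt_trans bm hs).
have {Hsin} := Hsin b (le_lt_trans bm ht).
rewrite !add0r expR0 cos0 sin0 oppr0 mul0r !subr0 addr0 !mul1r.
set A := expR a - 1 - a; set C := cos b - 1; set S := sin b - b => S' C' A'.
have Am : `|A| <= e' * m by apply: le_trans A' _; rewrite ler_wpM2l // ltW.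
have Cm : `|C| <= e' * m by apply: le_trans C' _; rewrite ler_wpM2l // ltW.
have Sm : `|S| <= e' * m by apply: le_trans S' _; rewrite ler_wpM2l // ltW.
have e'm : e' * m <= e' by rewrite ler_piMr ?(ltW e'0) // (le_trans (ltW he)).
have e'm' : e' * m <= m by rewrite ler_piMl.
have m1 : m <= 1 by rewrite (le_trans (ltW he)).
apply: le_trans (modulus_le _) _; rewrite /cexp /=.
have -> : expR a * cos b - 1 - a = A + (1 + a + A) * C by rewrite /A /C; ring.
have -> : expR a * sin b - 0 - b = S + (a + A) * (b + S) by rewrite /A /S; ring.
have N1 : `|A + (1 + a + A) * C| <= e' * m + 3 * (e' * m).
  apply: le_trans (ler_normD _ _) _; rewrite lerD // normrM ler_pM //.
  apply: le_trans (ler_normD _ _) _; have := ler_normD 1 a; rewrite normr1; lra.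
have N2 : `|S + (a + A) * (b + S)| <= e' * m + (2 * m) * (2 * m).
  apply: le_trans (ler_normD _ _) _; rewrite lerD // normrM ler_pM //.
    by apply: le_trans (ler_normD _ _) _; lra.
  by apply: le_trans (ler_normD _ _) _; lra.
have mm : m * m <= e' * m by rewrite ler_wpM2r // ltW.
apply: le_trans (lerD N1 N2) _.
nra.
Qed.

End complex_exponential.

(** * Completeness of cosines *)

Section cosine_completeness.
Context {R : realType}.
Implicit Types (f g : R -> R) (a b : R).

Lemma continuous_on_segmentM f g a b :
  continuous_on_segment f a b -> continuous_on_segment g a b ->
  continuous_on_segment (fun x => f x * g x) a b.
Proof.
move=> cf cg x xab e e0.
pose K := `|f x| + (`|g x| + 1).
have K0 : 0 < K by rewrite ltr_wpDl // ltr_wpDl.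
have e2 : 0 < e / (2 * K) by rewrite divr_gt0 // mulr_gt0.
have [r r0 fr] := cf x xab _ e2; have [t t0 gt] := cg x xab _ e2.
have [u u0 gu] := cg x xab _ ltr01.
exists (Num.min r (Num.min t u)); first by rewrite !lt_min r0 t0.
move=> y yab; rewrite !lt_min => /andP[/(fr _ yab) F /andP[/(gt _ yab) G /(gu _ yab) G1]].
have -> : f y * g y - f x * g x = (f y - f x) * g y + f x * (g y - g x) by ring.
apply: le_trans (ler_normD _ _) _; rewrite !normrM.
have -> : e = e / (2 * K) * K + K * (e / (2 * K)) by field; exact: lt0r_neq0.
apply: lerD; apply: ler_pM => //; last by rewrite lerDl.
have -> : g y = g x + (g y - g x) by ring.
by apply: le_trans (ler_normD _ _) _; rewrite /K ler_wpDl // lerD2l.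
Qed.

Lemma continuousW_segment f a b : continuous f -> continuous_on_segment f a b.
Proof.
move=> cf x _ e e0; have /cvgrPdist_le /(_ e e0) := cf x.
by move/nbhs_ballP => [r r0 H]; exists r => // y _ xy; rewrite distrC; apply: H; rewrite /ball /= distrC.
Qed.

Lemma continuous_on_segment_bounded f a b : a <= b -> continuous_on_segment f a b ->
  exists2 k : R, 0 <= k & forall x, a <= x <= b -> `|f x| <= k.
Proof.
move=> ab cf.
have cf' : {within `[a, b], continuous (fun x => `|f x|)}.
  apply/subspace_continuousP => x /=; rewrite in_itv/= => xab.
  apply/cvgrPdist_le => e e0; have [r r0 H] := cf _ xab _ e0.
  apply/nbhs_ballP; exists r => //= y; rewrite /ball/= => xy; rewrite in_itv/= => yab.
  by apply: le_trans (ler_dist_dist _ _) _; rewrite distrC; apply: H => //; rewrite distrC.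
have [c _ H] := EVT_max ab cf'.
by exists `|f c| => // x xab; apply: H; rewrite in_itv.
Qed.

Lemma cos_wave_continuous (k t : R) a b :
  continuous_on_segment (fun s => cos (k * (s - t))) a b.
Proof.
apply: continuousW_segment => s.
apply: (@continuous_comp _ _ _ (fun s => k * (s - t)) cos); last exact: continuous_cos.
by apply: cvgM; [exact: cvg_cst|apply: cvgB; [exact: cvg_id|exact: cvg_cst]].
Qed.

Lemma sin_wave_continuous (k t : R) a b :
  continuous_on_segment (fun s => sin (k * (s - t))) a b.
Proof.
apply: continuousW_segment => s.
apply: (@continuous_comp _ _ _ (fun s => k * (s - t)) sin); last exact: continuous_sin.
by apply: cvgM; [exact: cvg_cst|apply: cvgB; [exact: cvg_id|exact: cvg_cst]].
Qed.

Variables l k : R.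
Hypotheses (l_gt0 : 0 < l) (kl : k * l = 2 * pi).

Let k_gt0 : 0 < k.
Proof. by rewrite -(pmulr_lgt0 _ l_gt0) kl mulr_gt0 // pi_gt0. Qed.

Section nonpositive.
Variables (g : R -> R) (s0 : R).
Hypothesis g_cont : forall a b, continuous_on_segment g a b.
Hypothesis g_periodic : forall s, g (s + l) = g s.
Hypothesis g_orth : forall n : nat,
  segment_integral (fun s => g s * cos (k *+ n * (s - s0))) 0 l = 0.
Hypothesis s0_range : 0 <= s0 < l.

(** A trigonometric polynomial with values in [0, 1] that reaches 1 only at s0 modulo l, so its
    powers concentrate there. *)
Let K (s : R) := (1 + cos (k * (s - s0))) / 2.

Let K_cont a b : continuous_on_segment K a b.
Proof.
rewrite (_ : K = fun s => 2^-1 * (1 + cos (k * (s - s0)))).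
  apply: continuous_on_segmentZ; apply: continuous_on_segmentD.
    exact: continuous_on_segment_cst.
  exact: cos_wave_continuous.
by apply/funext => s; rewrite /K mulrC.
Qed.

Let KX_cont N a b : continuous_on_segment (fun s => K s ^+ N) a b.
Proof.
elim: N => [|N IH]; first exact: continuous_on_segment_cst.
rewrite (_ : (fun s => _) = fun s => K s * K s ^+ N).
  exact: continuous_on_segmentM.
by apply/funext => s; rewrite exprS.
Qed.

(** One more factor [K] turns the wave n into 1/2 of itself plus 1/4 of each of its neighbours n + 1
    and n - 1, by the addition formulas. *)
Lemma cos_power_orthogonal N n :
  segment_integral (fun s => g s * cos (k *+ n * (s - s0)) * K s ^+ N) 0 l = 0.
Proof.
elim: N n => [|N IH] n.
  rewrite -[RHS](g_orth n); apply: eq_segment_integral => s _.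
  by rewrite expr0 mulr1.
have cI m : continuous_on_segment (fun s => g s * cos (k *+ m * (s - s0)) * K s ^+ N) 0 l.
  apply: continuous_on_segmentM => //; apply: continuous_on_segmentM => //.
  exact: cos_wave_continuous.
(* The neighbour n - 1 of n = 0 is the wave 1, because cosine is even. *)
have pm : exists m, forall s, cos (k *+ m * (s - s0)) = cos (k *+ n * (s - s0) - k * (s - s0)).
  case: n => [|n]; [exists 1%N => s|exists n => s].
    by rewrite mulr0n mul0r sub0r cosN mulr1n.
  by congr cos; rewrite mulrS; ring.
case: pm => m mE.
transitivity (segment_integral (fun s => 2^-1 * (g s * cos (k *+ n * (s - s0)) * K s ^+ N)
  + (4^-1 * (g s * cos (k *+ n.+1 * (s - s0)) * K s ^+ N)
  + 4^-1 * (g s * cos (k *+ m * (s - s0)) * K s ^+ N))) 0 l).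
  apply: eq_segment_integral => s _.
  have nE : cos (k *+ n.+1 * (s - s0)) = cos (k *+ n * (s - s0) + k * (s - s0)).
    by congr cos; rewrite mulrSr mulrDl.
  by rewrite mE nE cosB cosD exprS /K; field.
rewrite !segment_integralD; last first.
- by apply: continuous_on_segmentD; apply: continuous_on_segmentZ.
- exact: continuous_on_segmentZ.
- exact: continuous_on_segmentZ.
- exact: continuous_on_segmentZ.
by rewrite !segment_integralZ // !IH !mulr0 !addr0.
Qed.

(** Suppose g s0 > 0. Just to the right of s0 the integrand g K^N is at least (g s0 / 2) r2^N;
    elsewhere on the period either g is positive or K <= r1 < r2. A zero integral would then bound a
    positive multiple of r2^N by a multiple of r1^N for every N. *)
Lemma cos_orthogonal_le0 : g s0 <= 0.
Proof.
rewrite leNgt; apply/negP => gs0.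
have e0 : 0 < g s0 / 2 by rewrite divr_gt0.
have [|r r0 gr] := @g_cont (s0 - 1) (s0 + 1) s0 _ _ e0; first by apply/andP; split; lra.
pose d := Num.min (Num.min r 1) (pi / (2 * k)).
have pi0 := pi_gt0 R.
have d0 : 0 < d by rewrite !lt_min r0 ltr01 divr_gt0 // mulr_gt0.
have [dr d1 dpi] : [/\ d <= r, d <= 1 & k * d <= pi / 2].
  split; try by rewrite !ge_min lexx ?orbT.
  have : d <= pi / (2 * k) by rewrite ge_min lexx orbT.
  by rewrite !ler_pdivlMr ?mulr_gt0 //; lra.
clearbody d.
have kd0 : 0 < k * d by rewrite mulr_gt0.
have near s : `|s - s0| < d -> g s0 / 2 <= g s.
  move=> sd; have := sd; rewrite ltr_norml => /andP[? ?].
  have := gr s ltac:(apply/andP; split; lra) (lt_le_trans sd dr).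
  by rewrite ler_norml => /andP[? ?]; lra.
have cos_anti x y : 0 <= x -> x <= y -> y <= pi -> cos y <= cos x.
  move=> x_ge0 xy ypi; rewrite leNgt; apply/negP.
  rewrite ltr_cos ?in_itv /= ?x_ge0 ?(le_trans xy) ?(le_trans x_ge0) //.
  by rewrite ltNge xy.
(* The points where K exceeds r1 lie within d of s0 modulo l. When they are close to s0 - l or s0 +
   l, periodicity of g brings them back. *)
have far s : 0 <= s <= l -> cos (k * d) < cos (k * (s - s0)) -> g s0 / 2 <= g s.
  move=> /andP[s_ge0 sl] Hc; case/andP: s0_range => s00 s0l.
  have [|sd] := ltP `|s - s0| d; first exact: near.
  pose y := k * `|s - s0|.
  have cosy : cos (k * (s - s0)) = cos y.
    by rewrite /y -(cos_norm (k * _)) normrM gtr0_norm.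
  have [ypi|ypi] := leP y pi.
    suff : cos y <= cos (k * d) by rewrite -cosy leNgt Hc.
    by apply: cos_anti ypi; [exact: ltW|rewrite ler_pM2l].
  have y2 : cos y = cos (2 * pi - y).
    have -> : 2 * pi - y = - (y - pi *+ 2) by rewrite -[pi *+ 2]mulr_natl; ring.
    by rewrite cosN -[RHS](cosD2pi _) subrK.
  have ly : 2 * pi - y < k * d.
    rewrite ltNge; apply/negP => kdy.
    suff : cos (2 * pi - y) <= cos (k * d) by rewrite -y2 -cosy leNgt Hc.
    apply: cos_anti => //; [exact: ltW|lra].
  have {ly} : l - `|s - s0| < d.
    by rewrite -(ltr_pM2l k_gt0) mulrBr kl.
  have [ss|ss] := ger0P (s - s0).
    move=> H; rewrite -[s](subrK l) g_periodic; apply: near.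
    by rewrite ltr_norml; apply/andP; split; lra.
  by move=> H; rewrite -(g_periodic s); apply: near; rewrite ltr_norml; apply/andP; split; lra.
have [B B0 gB] := continuous_on_segment_bounded (ltW l_gt0) (@g_cont 0 l).
pose r1 := (1 + cos (k * d)) / 2; pose r2 := (1 + cos (k * (d / 2))) / 2.
have r1_ge0 : 0 <= r1 by have := cos_geN1 (k * d); rewrite /r1; lra.
have r12 : r1 < r2.
  rewrite /r1 /r2 ltr_pM2r // ltrD2l ltr_cos ?in_itv /=.
  - by rewrite ltr_pM2l //; lra.
  - by apply/andP; split; lra.
  - by apply/andP; split; lra.
have r2_gt0 := le_lt_trans r1_ge0 r12.
have K_ge0 s : 0 <= K s by have := cos_geN1 (k * (s - s0)); rewrite /K; lra.
case/andP: s0_range => s00 s0l.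
(* The cap at l keeps the segment [s0, b] inside the period of integration. *)
pose b := Num.min (s0 + d / 2) l.
have [s0b bl bd] : [/\ s0 < b, b <= l & b <= s0 + d / 2].
  split; try by rewrite ge_min lexx ?orbT.
  by rewrite lt_min s0l andbT; lra.
clearbody b.
have low1 N s : 0 <= s <= l -> - (B * r1 ^+ N) <= g s * K s ^+ N.
  move=> sl; have [Kr|rK] := leP (K s) r1.
    have : `|g s * K s ^+ N| <= B * r1 ^+ N.
      by rewrite normrM ler_pM ?gB // normrX ger0_norm // lerXn2r ?nnegrE.
    by rewrite ler_norml => /andP[].
  have gs : g s0 / 2 <= g s.
    by apply: far => //; move: rK; rewrite /K /r1; lra.
  rewrite (@le_trans _ _ 0) ?mulr_ge0 ?exprn_ge0 //; last by rewrite (le_trans _ gs) // ltW.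
  by rewrite oppr_le0 mulr_ge0 ?exprn_ge0.
have low2 N s : s0 <= s <= b -> g s0 / 2 * r2 ^+ N <= g s * K s ^+ N.
  move=> /andP[s0s sb]; have sd : `|s - s0| <= d / 2 by rewrite ger0_norm; lra.
  have kd2 : k * (s - s0) <= k * (d / 2) by rewrite ler_pM2l //; lra.
  have K2 : r2 <= K s.
    rewrite /r2 /K ler_pM2r // lerD2l; apply: cos_anti => //; last lra.
    by rewrite mulr_ge0 ?(ltW k_gt0) // subr_ge0.
  apply: ler_pM; rewrite ?(ltW e0) ?exprn_ge0 ?(ltW r2_gt0) //.
    by apply: near; lra.
  by rewrite lerXn2r ?nnegrE ?(ltW r2_gt0).
have bound N : g s0 / 2 * (b - s0) * r2 ^+ N <= B * l * r1 ^+ N.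
  pose f s := g s * K s ^+ N.
  have fc a c : continuous_on_segment f a c by exact: continuous_on_segmentM.
  have f0 : segment_integral f 0 l = 0.
    rewrite -[RHS](cos_power_orthogonal N 0); apply: eq_segment_integral => s _.
    by rewrite mulr0n mul0r cos0 mulr1.
  have low a c m : a <= c -> (forall s, a <= s <= c -> m <= f s) ->
      m * (c - a) <= segment_integral f a c.
    move=> ac mf; rewrite -segment_integral_cst //.
    by apply: le_segment_integral => //; exact: continuous_on_segment_cst.
  have I1 := low 0 s0 (- (B * r1 ^+ N)) s00
    ltac:(by move=> s /andP[? ?]; apply: low1; lra).
  have I2 := low s0 b (g s0 / 2 * r2 ^+ N) (ltW s0b) (low2 N).
  have I3 := low b l (- (B * r1 ^+ N)) bl
    ltac:(by move=> s /andP[? ?]; apply: low1; lra).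
  have : 0 <= B * r1 ^+ N * (b - s0) by rewrite !mulr_ge0 ?exprn_ge0 // subr_ge0 ltW.
  move: f0; rewrite (segment_integral_split s00 (ltW s0l)) //.
  rewrite (segment_integral_split (ltW s0b) bl) //.
  move: I1 I2 I3; rewrite subr0; lra.
have e1 : 0 < g s0 / 2 * (b - s0) / (B * l + 1).
  rewrite divr_gt0 //; first by rewrite mulr_gt0 // subr_gt0.
  by rewrite ltr_wpDl // mulr_ge0 // ltW.
have [||N] := @geometric_small R (r1 / r2) _ _ _ e1.
- by rewrite divr_ge0 // ltW.
- by rewrite ltr_pdivrMr // mul1r.
apply/negP; rewrite -leNgt ler_pdivrMr; last by rewrite ltr_wpDl // mulr_ge0 // ltW.
rewrite expr_div_n [leRHS]mulrAC ler_pdivlMr ?exprn_gt0 //.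
apply: le_trans (bound N) _; rewrite [leLHS]mulrC ler_wpM2l ?exprn_ge0 //.
by rewrite lerDl.
Qed.

End nonpositive.

Theorem cos_complete (g : R -> R) :
  (forall a b, continuous_on_segment g a b) -> (forall s, g (s + l) = g s) ->
  (forall (n : nat) t,
     segment_integral (fun s => g s * cos (k *+ n * (s - t))) 0 l = 0) ->
  forall s, 0 <= s < l -> g s = 0.
Proof.
move=> g_cont g_periodic g_orth s sl; apply/eqP; rewrite eq_le.
rewrite (@cos_orthogonal_le0 g s) //= -oppr_le0.
apply: (@cos_orthogonal_le0 (fun x => - g x) s) => //.
- move=> a b x xab e e0; have [r r0 H] := g_cont a b x xab e e0.
  by exists r => // y yab xy; rewrite -opprD normrN; exact: H.
- by move=> x; rewrite g_periodic.
- move=> n; transitivity (-1 * segment_integral (fun x => g x * cos (k *+ n * (x - s))) 0 l).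
    2: by rewrite g_orth mulr0.
  rewrite -segment_integralZ.
    by apply: eq_segment_integral => x _; ring.
  by apply: continuous_on_segmentM => //; exact: cos_wave_continuous.
Qed.

End cosine_completeness.

(** * Periodic functions on a strip *)

Section strip.
Context {R : realType}.
Implicit Types (P : R[i] -> R[i]) (s t x h v : R).

(** Under the exponential the included edge Im w = pi becomes the negative axis and the excluded
    edge Im w = 0 the positive axis. *)
Definition strip : set R[i] := [set w | 0 < complex.Im w <= pi].

Definition holomorphic_on_strip P :=
  forall w, strip w -> exists k : R[i], has_cderiv strip P w k.

Lemma has_cderiv_holomorphic_cexp (k z : R[i]) :
  holomorphic_on_strip (fun w => cexp (k * (w - z))).
Proof.
move=> w Sw; exists (cexp (k * (w - z)) * (k * (1 + 0))).
apply: (@has_cderiv_comp _ strip setT cexp (fun w => k * (w - z))) => //.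
  exact: has_cderiv_cexp.
apply: has_cderivZ; apply: has_cderivD; first exact: has_cderiv_id.
exact: has_cderiv_cst.
Qed.

Lemma holomorphic_on_stripM P Q : holomorphic_on_strip P -> holomorphic_on_strip Q ->
  holomorphic_on_strip (fun w => P w * Q w).
Proof.
move=> hP hQ w Sw; have [k Pk] := hP w Sw; have [m Qm] := hQ w Sw.
by eexists; exact: has_cderivM Pk Qm.
Qed.

Lemma holomorphic_on_strip_cst (k : R[i]) : holomorphic_on_strip (fun=> k).
Proof. by move=> w _; exists 0; exact: has_cderiv_cst. Qed.

Lemma pi_itv : 0 < (pi : R) <= pi.
Proof. by rewrite pi_gt0 lexx. Qed.

Lemma strip_continuous P (g : R[i] -> R) t a b : holomorphic_on_strip P ->
  (forall z w, `|g z - g w| <= modulus (z - w)) -> 0 < t <= pi ->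
  continuous_on_segment (fun s => g (P (s +i* t))) a b.
Proof. by move=> hP gl tpi; exact: (horizontal_continuous hP). Qed.

Variables l k : R.
Hypotheses (l_gt0 : 0 < l) (kl : k * l = 2 * pi).

Definition periodic_on_strip P := forall w, strip w -> P (w + l%:C) = P w.

(** Over one period the vertical sides of the contour cancel. *)
Lemma strip_mean P t : holomorphic_on_strip P -> periodic_on_strip P -> 0 < t <= pi ->
  horizontal_integral P 0 l t = horizontal_integral P 0 l pi.
Proof.
move=> hP perP /andP[t0 tpi].
have rS : rectangle 0 l t pi `<=` strip.
  by move=> w [_ /andP[tw wpi]]; rewrite /strip /= (lt_le_trans t0 tw).
have hr w : rectangle 0 l t pi w -> exists d, has_cderiv (rectangle 0 l t pi) P w d.
  by move=> rw; have [d Pd] := hP w (rS _ rw); exists d; apply: has_cderivW Pd.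
have := goursat_rectangle (ltW l_gt0) tpi hr; rewrite /boundary_flux.
have -> : vertical_integral P l t pi = vertical_integral P 0 t pi.
  apply: eq_segment_integral => x /andP[tx xpi].
  rewrite -(perP (0 +i* x)); last by rewrite /strip /= (lt_le_trans t0 tx).
  by congr (complex.Im (P _)); apply/eqP; rewrite eq_complex /= add0r addr0 !eqxx.
by rewrite subrr addr0 => /eqP; rewrite subr_eq0 => /eqP.
Qed.

(** The boolean is the sign of the frequency. Both signs matter, since one exponential grows and the
    other decays across the strip. *)
Lemma wave_periodic (n : nat) (b : bool) (z : R[i]) :
  periodic_on_strip (fun w => cexp ('i * ((-1) ^+ b * k *+ n)%:C * (w - z))).
Proof.
move=> w _ /=; set v := (-1) ^+ b * k *+ n.
have vl : v * l = (-1) ^+ b * (pi *+ 2) *+ n by rewrite mulrnAl -mulrA kl mulr_natl.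
have -> : 'i * v%:C * (w + l%:C - z) = 'i * v%:C * (w - z) + 'i * (v * l)%:C.
  by rewrite rmorphM /=; ring.
rewrite vl.
rewrite cexpD -[RHS]mulr1; congr (_ * _).
have -> (y : R) : 'i * y%:C = 0 +i* y.
  by apply/eqP; rewrite eq_complex /=; apply/andP; split; apply/eqP; ring.
rewrite /cexp /= expR0 !mul1r; apply/eqP; rewrite eq_complex /=.
have cn m : cos ((pi *+ 2 *+ m) : R) = 1 /\ sin ((pi *+ 2 *+ m) : R) = 0.
  elim: m => [|m [cE sE]]; first by rewrite mulr0n cos0 sin0.
  by rewrite mulrSr cosD2pi sinD2pi.
have [cE sE] := cn n.
case: b {v vl}; rewrite ?expr1 ?expr0 ?mul1r ?mulN1r ?mulNrn ?cosN ?sinN cE sE ?oppr0 !eqxx //.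
Qed.

Lemma cexp_i v h s : cexp ('i * v%:C * (s +i* h)) =
  (expR (- (v * h)))%:C * (cos (v * s) +i* sin (v * s)).
Proof.
have -> : 'i * v%:C * (s +i* h) = (- (v * h)) +i* (v * s).
  by apply/eqP; rewrite eq_complex /=; apply/andP; split; apply/eqP; ring.
rewrite /cexp /=; apply/eqP; rewrite eq_complex /=.
by apply/andP; split; apply/eqP; ring.
Qed.

(** This is [strip_mean] for P(w) exp(i v (w - x - i pi)). The exponential is normalised on Im w =
    pi, so its modulus on Im w = t is exp(v (pi - t)). *)
Lemma wave_line P (n : nat) (b : bool) x t :
  holomorphic_on_strip P -> periodic_on_strip P -> 0 < t <= pi ->
  let v := (-1) ^+ b * k *+ n in
  expR (v * (pi - t)) * segment_integral (fun s =>
     complex.Re (P (s +i* t)) * cos (v * (s - x)) - complex.Im (P (s +i* t)) * sin (v * (s - x))) 0 l =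
  segment_integral (fun s =>
     complex.Re (P (s +i* pi)) * cos (v * (s - x)) - complex.Im (P (s +i* pi)) * sin (v * (s - x))) 0 l.
Proof.
move=> hP perP tpi v.
pose G w := P w * cexp ('i * v%:C * (w - (x +i* pi))).
have hG : holomorphic_on_strip G.
  by apply: holomorphic_on_stripM => //; exact: has_cderiv_holomorphic_cexp.
have perG : periodic_on_strip G.
  by move=> w Sw; rewrite /G perP // wave_periodic.
have GE u s : 0 < u <= pi -> complex.Re (G (s +i* u)) = expR (v * (pi - u)) *
   (complex.Re (P (s +i* u)) * cos (v * (s - x)) - complex.Im (P (s +i* u)) * sin (v * (s - x))).
  move=> upi; rewrite /G.
  have -> : (s +i* u) - (x +i* pi) = (s - x) +i* (u - pi).
    by apply/eqP; rewrite eq_complex /= !eqxx.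
  rewrite cexp_i -mulrN opprB; case: (P _) => p q /=; ring.
have cont u a b' : 0 < u <= pi -> continuous_on_segment (fun s =>
   complex.Re (P (s +i* u)) * cos (v * (s - x)) - complex.Im (P (s +i* u)) * sin (v * (s - x))) a b'.
  move=> upi; apply: continuous_on_segmentB; apply: continuous_on_segmentM.
  - by apply: strip_continuous => //; exact: Re_lipschitz.
  - exact: cos_wave_continuous.
  - by apply: strip_continuous => //; exact: Im_lipschitz.
  - exact: sin_wave_continuous.
have := strip_mean hG perG tpi; rewrite /horizontal_integral.
have pipi := pi_itv.
under eq_segment_integral => s _ do rewrite GE //.
rewrite segment_integralZ; last exact: cont.
move=> ->; apply: eq_segment_integral => s _.
by rewrite GE // subrr mulr0 expR0 mul1r.
Qed.

Lemma periodic_representative s : exists2 x, 0 <= x < l &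
  forall (T : Type) (f : R -> T), (forall y, f (y + l) = f y) -> f s = f x.
Proof.
pose n := Num.floor (s / l); exists (s - n%:~R * l).
  have /andP[n1 n2] := Num.Theory.floor_itv (s / l); rewrite -/n in n1 n2.
  rewrite subr_ge0 -ler_pdivlMr // n1 /= ltrBlDl.
  by move: n2; rewrite ltr_pdivrMr // intrD mulrDl mul1r.
move=> T f fper.
have natper m y : f (y + m%:R * l) = f y.
  elim: m y => [|m IH] y; first by rewrite mul0r addr0.
  by rewrite -natr1 mulrDl mul1r addrA fper.
have [[m nm]|[m nm]] : (exists m : nat, n = m%:Z) \/ (exists m : nat, n = - m%:Z).
  by case: (intP n) => [|m|m]; [left; exists 0%N|left; exists m.+1|right; exists m.+1].
- rewrite -(natper m (s - _)) nm; congr f; rewrite -pmulrn; ring.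
- rewrite -(natper m s) nm; congr f; rewrite mulrNz -pmulrn; ring.
Qed.

Definition cos_integral (f : R -> R) (n : nat) x :=
  segment_integral (fun s => f s * cos (k *+ n * (s - x))) 0 l.
Definition sin_integral (f : R -> R) (n : nat) x :=
  segment_integral (fun s => f s * sin (k *+ n * (s - x))) 0 l.

(** The two signs of the frequency give two equations, enough to solve for the cosine integral of Re
    P and the sine integral of Im P at height t in terms of boundary values. The same equations for
    ['i * P] yield the two remaining integrals. *)
Lemma wave_integrals P n x t :
  holomorphic_on_strip P -> periodic_on_strip P -> 0 < t <= pi ->
  let h := k *+ n * (pi - t) in
  let C f := cos_integral f n x in let S f := sin_integral f n x in
  let u s := complex.Re (P (s +i* t)) in let v s := complex.Im (P (s +i* t)) in
  let U s := complex.Re (P (s +i* pi)) in let V s := complex.Im (P (s +i* pi)) in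
  expR h * (C u - S v) = C U - S V /\ expR (- h) * (C u + S v) = C U + S V.
Proof.
move=> hP perP tpi h C S u v U V.
have pipi := pi_itv.
have cu y : 0 < y <= pi -> continuous_on_segment
    (fun s => complex.Re (P (s +i* y)) * cos (k *+ n * (s - x))) 0 l.
  move=> ypi; apply: continuous_on_segmentM; last exact: cos_wave_continuous.
  by apply: strip_continuous => //; exact: Re_lipschitz.
have cv y : 0 < y <= pi -> continuous_on_segment
    (fun s => complex.Im (P (s +i* y)) * sin (k *+ n * (s - x))) 0 l.
  move=> ypi; apply: continuous_on_segmentM; last exact: sin_wave_continuous.
  by apply: strip_continuous => //; exact: Im_lipschitz.
split.
  have := wave_line n false x hP perP tpi; rewrite /= expr0 mul1r.
  by rewrite !segment_integralB //; [exact: cu|exact: cv..|exact: cu|exact: cv].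
have := wave_line n true x hP perP tpi; rewrite /= expr1 mulN1r mulNrn mulNr.
have E y : segment_integral (fun s => complex.Re (P (s +i* y)) * cos (- (k *+ n) * (s - x)) -
      complex.Im (P (s +i* y)) * sin (- (k *+ n) * (s - x))) 0 l =
   segment_integral (fun s => complex.Re (P (s +i* y)) * cos (k *+ n * (s - x)) +
      complex.Im (P (s +i* y)) * sin (k *+ n * (s - x))) 0 l.
  by apply: eq_segment_integral => s _; rewrite mulNr cosN sinN mulrN opprK.
by rewrite !E !segment_integralD //; [exact: cu|exact: cv..|exact: cu|exact: cv].
Qed.

Lemma strip_periodic_line P t : periodic_on_strip P -> 0 < t <= pi ->
  forall s, P ((s + l) +i* t) = P (s +i* t).
Proof.
move=> perP tpi s; rewrite -(perP (s +i* t) tpi); congr P.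
by apply/eqP; rewrite eq_complex /= addr0 !eqxx.
Qed.

Lemma strip_unique_Re P : holomorphic_on_strip P -> periodic_on_strip P ->
  (forall s, P (s +i* pi) = 0) -> forall w, strip w -> complex.Re (P w) = 0.
Proof.
move=> hP perP P0 [s t] Sw; have tpi : 0 < t <= pi by [].
have per := strip_periodic_line perP tpi.
have [x xl /(_ _ (fun s => complex.Re (P (s +i* t)))) ->] := periodic_representative s; last first.
  by move=> y; rewrite per.
apply: (cos_complete l_gt0 kl (g := fun s => complex.Re (P (s +i* t)))) => //.
- by move=> a b; apply: strip_continuous => //; exact: Re_lipschitz.
- by move=> y; rewrite per.
move=> n y; have [] := wave_integrals n y hP perP tpi.
have U0 : cos_integral (fun s => complex.Re (P (s +i* pi))) n y = 0.
  rewrite /cos_integral (eq_segment_integral (g := fun=> 0)) => [|z _].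
    by rewrite segment_integral_cst ?mul0r // ltW.
  by rewrite P0 mul0r.
have V0 : sin_integral (fun s => complex.Im (P (s +i* pi))) n y = 0.
  rewrite /sin_integral (eq_segment_integral (g := fun=> 0)) => [|z _].
    by rewrite segment_integral_cst ?mul0r // ltW.
  by rewrite P0 mul0r.
rewrite U0 V0 subr0 addr0 => /eqP + /eqP; rewrite !mulf_eq0 !expR_eq0 /=.
rewrite subr_eq0 addr_eq0 => /eqP E1 /eqP E2.
by change (cos_integral (fun s => complex.Re (P (s +i* t))) n y = 0); lra.
Qed.

Lemma holomorphic_on_stripZ (a : R[i]) P : holomorphic_on_strip P ->
  holomorphic_on_strip (fun w => a * P w).
Proof. by move=> hP; apply: holomorphic_on_stripM => //; exact: holomorphic_on_strip_cst. Qed.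

Lemma strip_unique P : holomorphic_on_strip P -> periodic_on_strip P ->
  (forall s, P (s +i* pi) = 0) -> forall w, strip w -> P w = 0.
Proof.
move=> hP perP P0 w Sw; apply/eqP; rewrite eq_complex /=; apply/andP; split; apply/eqP.
  exact: strip_unique_Re.
have := @strip_unique_Re (fun w => 'i * P w) _ _ _ w Sw.
rewrite mulrC ReiNIm => H; apply/eqP; rewrite -oppr_eq0 H //.
- exact: holomorphic_on_stripZ.
- by move=> z Sz; rewrite perP.
- by move=> s; rewrite P0 mulr0.
Qed.

(** The constant 1 is itself holomorphic and periodic, with the same integral C on every line, so
    [wave_integrals] reads expR h * C = C with h > 0. *)
Lemma cos_integral_cst (n : nat) x : cos_integral (fun=> 1) n.+1 x = 0.
Proof.
have hp : 0 < (pi : R) / 2 <= pi by have := pi_gt0 R; move=> ?; apply/andP; split; lra.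
have [] := wave_integrals n.+1 x (@holomorphic_on_strip_cst 1) (fun _ _ => erefl) hp.
rewrite /=; set h := k *+ n.+1 * (pi - pi / 2); set C := cos_integral _ _ _; set S := sin_integral _ _ _.
have h0 : 0 < h.
  have k0 : 0 < k by rewrite -(pmulr_lgt0 _ l_gt0) kl mulr_gt0 // pi_gt0.
  by rewrite /h mulr_gt0 ?pmulrn_lgt0 // subr_gt0 ltr_pdivrMr // ltr_pMr ?pi_gt0 // ltr1n //.
have S0 : S = 0.
  rewrite /S /sin_integral (eq_segment_integral (g := fun=> 0)) => [|z _].
    by rewrite segment_integral_cst ?mul0r // ltW.
  by rewrite mul0r.
rewrite S0 !subr0 => E _.
have : (expR h - 1) * C = 0 by rewrite mulrBl mul1r E subrr.
move/eqP; rewrite mulf_eq0 => /orP[|/eqP //].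
by rewrite subr_eq0 gt_eqF // expR_gt1.
Qed.

Lemma le0_near_zero (f : R -> R) : continuous f -> (forall t, 0 < t < pi -> f t <= 0) -> f 0 <= 0.
Proof.
move=> cf f_le0; rewrite leNgt; apply/negP => f0.
have [||r r0 H] := @continuousW_segment _ f 0 pi cf 0 _ (f 0 / 2) => //.
- by rewrite lexx pi_ge0.
- by rewrite divr_gt0.
have pi0 := pi_gt0 R.
pose t := Num.min (r / 2) (pi / 2).
have t0 : 0 < t by rewrite lt_min !divr_gt0.
have tr : t <= r / 2 by rewrite ge_min lexx.
have tpi : t <= pi / 2 by rewrite ge_min lexx orbT.
have := H t ltac:(apply/andP; split; lra) ltac:(rewrite subr0 ger0_norm; lra).
have := f_le0 t ltac:(apply/andP; split; lra).
rewrite ler_norml => ? /andP[? ?]; lra.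
Qed.

(** The sign hypothesis says that exp(-w) P(w) has nonnegative imaginary part below the edge Im w =
    pi. *)
Lemma strip_constant P : holomorphic_on_strip P -> periodic_on_strip P ->
  (forall s, complex.Im (P (s +i* pi)) = 0) ->
  (forall s t, 0 < t < pi ->
    0 <= cos t * complex.Im (P (s +i* t)) - sin t * complex.Re (P (s +i* t))) ->
  forall w, strip w -> P w = P (0 +i* pi).
Proof.
move=> hP perP P_real P_ge0.
pose U s := complex.Re (P (s +i* pi)).
have hip := @holomorphic_on_stripZ 'i P hP.
have perip : periodic_on_strip (fun w => 'i * P w) by move=> z Sz; rewrite perP.
have V0 n x : sin_integral (fun s => complex.Im (P (s +i* pi))) n x = 0.
  rewrite /sin_integral (eq_segment_integral (g := fun=> 0)) => [|z _].
    by rewrite segment_integral_cst ?mul0r // ltW.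
  by rewrite P_real mul0r.
have V0' n x : cos_integral (fun s => complex.Im (P (s +i* pi))) n x = 0.
  rewrite /cos_integral (eq_segment_integral (g := fun=> 0)) => [|z _].
    by rewrite segment_integral_cst ?mul0r // ltW.
  by rewrite P_real mul0r.
have k0 : 0 < k by rewrite -(pmulr_lgt0 _ l_gt0) kl mulr_gt0 // pi_gt0.
pose m := segment_integral U 0 l.
(* The function [rho] below is nonnegative with integral - sin t * m, which therefore bounds its
   integral against any sine wave. Since P is real on Im w = pi, the sine integrals of Re P and Im P
   are expressed by those of U, and the inequality no longer mentions P at height t. *)
have key (n : nat) x t h : 0 < t < pi -> k *+ n * (pi - t) = h ->
  `|cos t * (cos_integral U n x * (expR h - expR (- h)) / 2) -
   sin t * (sin_integral U n x * (expR h + expR (- h)) / 2)| <= - (sin t * m).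
  move=> tpi' hE; have tpi : 0 < t <= pi by case/andP: tpi' => -> /ltW ->.
  pose u s := complex.Re (P (s +i* t)); pose v s := complex.Im (P (s +i* t)).
  have cu : continuous_on_segment u 0 l by apply: strip_continuous => //; exact: Re_lipschitz.
  have cv : continuous_on_segment v 0 l by apply: strip_continuous => //; exact: Im_lipschitz.
  have cs : continuous_on_segment (fun s => sin (k *+ n * (s - x))) 0 l.
    exact: sin_wave_continuous.
  have [E1 E2] := wave_integrals n x hP perP tpi.
  have [E3 E4] := wave_integrals n x hip perip tpi.
  rewrite hE V0 subr0 addr0 -/u -/v -/U in E1 E2.
  have ReE y : (fun s => complex.Re ('i * P (s +i* y))) = fun s => -1 * complex.Im (P (s +i* y)).
    by apply/funext => s; rewrite mulrC ReiNIm mulN1r.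
  have ImE y : (fun s => complex.Im ('i * P (s +i* y))) = fun s => complex.Re (P (s +i* y)).
    by apply/funext => s; rewrite mulrC ImiRe.
  have cosN1 f : continuous_on_segment f 0 l ->
      cos_integral (fun s => -1 * f s) n x = - cos_integral f n x.
    move=> cf; rewrite /cos_integral -[RHS]mulN1r -segment_integralZ.
      by apply: eq_segment_integral => s _; rewrite mulrA.
    by apply: continuous_on_segmentM => //; exact: cos_wave_continuous.
  have cV : continuous_on_segment (fun s => complex.Im (P (s +i* pi))) 0 l.
    by apply: (strip_continuous _ _ pi_itv) => //; exact: Im_lipschitz.
  rewrite hE !ReE !ImE (cosN1 _ cv) (cosN1 _ cV) in E3 E4.
  rewrite V0' oppr0 sub0r add0r -/u -/v -/U in E3 E4.
  have eh : expR h != 0 by rewrite expR_eq0.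
  have ee : expR h * expR (- h) = 1 by rewrite expRxMexpNx_1.
  have Sv : sin_integral v n x = cos_integral U n x * (expR h - expR (- h)) / 2.
    have F1 : cos_integral u n x - sin_integral v n x = expR (- h) * cos_integral U n x.
      by rewrite -E1 mulrA [expR (- h) * _]mulrC ee mul1r.
    have F2 : cos_integral u n x + sin_integral v n x = expR h * cos_integral U n x.
      by rewrite -E2 mulrA ee mul1r.
    lra.
  have Su : sin_integral u n x = sin_integral U n x * (expR h + expR (- h)) / 2.
    have F1 : - cos_integral v n x - sin_integral u n x = expR (- h) * - sin_integral U n x.
      by rewrite -E3 mulrA [expR (- h) * _]mulrC ee mul1r.
    have F2 : - cos_integral v n x + sin_integral u n x = expR h * sin_integral U n x.
      by rewrite -E4 mulrA ee mul1r.
    lra.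
  pose rho s := cos t * v s - sin t * u s.
  have crho : continuous_on_segment rho 0 l.
    by apply: continuous_on_segmentB; apply: continuous_on_segmentZ.
  have int_u : segment_integral u 0 l = m by exact: strip_mean.
  have int_v : segment_integral v 0 l = 0.
    have := strip_mean hip perip tpi; rewrite /horizontal_integral !ReE.
    rewrite segment_integralZ // mulN1r [RHS](_ : _ = 0) => [/eqP|].
      by rewrite oppr_eq0 => /eqP.
    rewrite (eq_segment_integral (g := fun=> 0)) => [|z _].
      by rewrite segment_integral_cst ?mul0r // ltW.
    by rewrite P_real mulr0.
  have int_rho : segment_integral rho 0 l = - (sin t * m).
    rewrite segment_integralB; try exact: continuous_on_segmentZ.
    by rewrite !segment_integralZ // int_u int_v mulr0 sub0r.
  have rho_sin : segment_integral (fun s => rho s * sin (k *+ n * (s - x))) 0 l =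
      cos t * sin_integral v n x - sin t * sin_integral u n x.
    rewrite -!segment_integralZ; try exact: continuous_on_segmentM.
    rewrite -segment_integralB; try by apply: continuous_on_segmentZ; exact: continuous_on_segmentM.
    by apply: eq_segment_integral => s _; rewrite /rho; ring.
  rewrite -Sv -Su -rho_sin -int_rho ler_norml; apply/andP; split.
    rewrite -[leLHS]mulN1r -segment_integralZ //.
    apply: le_segment_integral; [exact: continuous_on_segmentZ|exact: continuous_on_segmentM|].
    move=> s _; rewrite mulrC ler_wpM2l ?sin_geN1 //; exact: P_ge0.
  apply: le_segment_integral => //; first exact: continuous_on_segmentM.
  by move=> s _; rewrite ler_piMr ?sin_le1 //; exact: P_ge0.
(* The two sides of [key] are F 1 t <= 0 and F (-1) t <= 0. They are explicit in t, so t can tend to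
   0 although P is not controlled there; the sines disappear and only A * d = 0 with d > 0 is
   left. *)
have U_orth (n : nat) x : cos_integral U n.+1 x = 0.
  pose A := cos_integral U n.+1 x; pose B := sin_integral U n.+1 x.
  pose h t := k *+ n.+1 * (pi - t).
  have ch : continuous h.
    move=> t; apply: cvgM; first exact: cvg_cst.
    by apply: cvgB; [exact: cvg_cst|exact: cvg_id].
  have ce : continuous (fun t => expR (h t)).
    by move=> t; apply: (@continuous_comp _ _ _ h expR); [exact: ch|exact: continuous_expR].
  have ceN : continuous (fun t => expR (- h t)).
    move=> t; apply: (@continuous_comp _ _ _ (fun t => - h t) expR); last exact: continuous_expR.
    by apply: cvgN; exact: ch.
  pose F (a : R) t := a * (cos t * (A * (expR (h t) - expR (- h t)) / 2) -
     sin t * (B * (expR (h t) + expR (- h t)) / 2)) + sin t * m.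
  have cF a : continuous (F a).
    move=> t; apply: cvgD; last by apply: cvgM; [exact: continuous_sin|exact: cvg_cst].
    apply: cvgM; first exact: cvg_cst.
    apply: cvgB; apply: cvgM; [exact: continuous_cos| |exact: continuous_sin|].
      apply: cvgM; last exact: cvg_cst.
      by apply: cvgM; [exact: cvg_cst|apply: cvgB; [exact: ce|exact: ceN]].
    apply: cvgM; last exact: cvg_cst.
    by apply: cvgM; [exact: cvg_cst|apply: cvgD; [exact: ce|exact: ceN]].
  have F1 : F 1 0 <= 0.
    apply: le0_near_zero (cF 1) _ => t /(key n.+1 x) /(_ erefl); rewrite ler_norml => /andP[_].
    by rewrite /F -/A -/B -/(h t); lra.
  have F2 : F (-1) 0 <= 0.
    apply: le0_near_zero (cF (-1)) _ => t /(key n.+1 x) /(_ erefl); rewrite ler_norml => /andP[+ _].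
    by rewrite /F -/A -/B -/(h t); lra.
  move: F1 F2; rewrite /F cos0 sin0 !mul0r !subr0 !addr0 !mul1r mulN1r.
  set d := expR _ - _.
  have d0 : 0 < d.
    rewrite subr_gt0 ltr_expR gtrN //; rewrite /h mulr_gt0 ?pmulrn_lgt0 //.
    by rewrite subr0 pi_gt0.
  move=> F1 F2; have : A * d = 0 by lra.
  by move/eqP; rewrite mulf_eq0 (gt_eqF d0) orbF => /eqP.
have Uconst s : U s = m / l.
  have perU y : U (y + l) = U y by rewrite /U (strip_periodic_line perP pi_itv).
  have [x xl /(_ _ U perU) ->] := periodic_representative s.
  have cU a b : continuous_on_segment U a b.
    by apply: (strip_continuous _ _ pi_itv) => //; exact: Re_lipschitz.
  have ccst a b : continuous_on_segment (fun=> m / l) a b by exact: continuous_on_segment_cst.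
  apply/eqP; rewrite -subr_eq0; apply/eqP.
  apply: (cos_complete l_gt0 kl (g := fun s => U s - m / l)) => //.
  - by move=> a b; exact: continuous_on_segmentB.
  - by move=> y; rewrite perU.
  move=> [|n] y.
    transitivity (segment_integral (fun s => U s - m / l) 0 l).
      by apply: eq_segment_integral => z _; rewrite mulr0n mul0r cos0 mulr1.
    rewrite segment_integralB // segment_integral_cst ?(ltW l_gt0) // subr0.
    by rewrite mulfVK ?subrr // gt_eqF.
  transitivity (cos_integral U n.+1 y - m / l * cos_integral (fun=> 1) n.+1 y).
    have c1 : continuous_on_segment (fun s => 1 * cos (k *+ n.+1 * (s - y))) 0 l.
      apply: continuous_on_segmentM; last exact: cos_wave_continuous.
      exact: continuous_on_segment_cst.
    rewrite -segment_integralZ // -segment_integralB.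
    - by apply: eq_segment_integral => z _; ring.
    - by apply: continuous_on_segmentM => //; exact: cos_wave_continuous.
    - exact: continuous_on_segmentZ.
  by rewrite U_orth cos_integral_cst mulr0 subr0.
have P_cst w : strip w -> P w - (m / l)%:C = 0.
  apply: (strip_unique (P := fun w => P w - (m / l)%:C)).
  - move=> z Sz; have [d Pd] := hP z Sz; exists (d + 0).
    by apply: has_cderivD Pd _; exact: has_cderiv_cst.
  - by move=> z Sz; rewrite perP.
  - by move=> s; move: (P_real s) (Uconst s); rewrite /U; case: (P _) => a b /= -> ->; rewrite subrr.
move=> w Sw; have := P_cst _ Sw; rewrite -(P_cst (0 +i* pi) pi_itv).
exact: addIr.
Qed.

End strip.

(** * Dilation-invariant functions on the upper half-plane with the negative axis *)

Section dilation_invariance.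
Context {R : realType}.
Implicit Types (f : R[i] -> R[i]) (z w : R[i]).

Definition cut_upper_plane : set R[i] := @upper_half_plane R `|` @negative_axis R.

Definition holomorphic_on_cut f :=
  forall z, cut_upper_plane z -> exists k : R[i], has_cderiv cut_upper_plane f z k.

Lemma cut_upper_planeN (x : R) : x < 0 -> cut_upper_plane x%:C.
Proof. by move=> x0; right; exists x. Qed.

Lemma cexp_strip w : strip w -> cut_upper_plane (cexp w).
Proof.
case: w => s t /andP[/= t0]; rewrite le_eqVlt => /orP[/eqP ->|tpi].
  right; exists (- expR s); first by rewrite /= oppr_lt0 expR_gt0.
  by rewrite /cexp /= cospi sinpi mulrN1 mulr0.
left; rewrite /upper_half_plane /cexp /= mulr_gt0 ?expR_gt0 // sin_gt0_pi //.
by rewrite t0.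
Qed.

Lemma cexp_axis s : cexp (s +i* pi) = (- expR s)%:C :> R[i].
Proof. by rewrite /cexp /= cospi sinpi mulrN1 mulr0. Qed.

Lemma cexp_strip_surj z : cut_upper_plane z -> exists2 w, strip w & z = cexp w.
Proof.
case=> [|[x /= x0 <-]]; last first.
  exists (ln (- x) +i* pi); first exact: pi_itv.
  by rewrite cexp_axis lnK ?posrE ?oppr_gt0 // opprK.
case: z => x y; rewrite /upper_half_plane /= => y0.
pose r := Num.sqrt (x ^+ 2 + y ^+ 2).
have y20 : 0 < y ^+ 2 by rewrite exprn_gt0.
have r20 : 0 < x ^+ 2 + y ^+ 2 by rewrite ltr_wpDl // sqr_ge0.
have r0 : 0 < r by rewrite sqrtr_gt0.
have rE : r ^+ 2 = x ^+ 2 + y ^+ 2 by rewrite sqr_sqrtr // ltW.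
have xr : (x / r) ^+ 2 + (y / r) ^+ 2 = 1.
  by rewrite !expr_div_n -mulrDl -rE mulfV // expf_neq0 // gt_eqF.
have xr1 : -1 <= x / r <= 1.
  rewrite -ler_norml -(@expr_le1 _ 2) // -normrX ger0_norm ?sqr_ge0 //.
  by rewrite -xr lerDl sqr_ge0.
have xr1' : -1 < x / r.
  rewrite lt_neqAle; case/andP: xr1 => -> _; rewrite andbT.
  apply/eqP => E; move: xr; rewrite -E sqrrN expr1n => /eqP.
  by rewrite -subr_eq0 addrAC subrr add0r expf_eq0 /= gt_eqF // divr_gt0.
have sinE : sin (acos (x / r)) = y / r.
  rewrite sin_acos // -xr addrAC subrr add0r sqrtr_sqr ger0_norm // divr_ge0 // ltW //.
exists (ln r +i* acos (x / r)).
  rewrite /strip /= acos_lepi // andbT lt0r acos_ge0 // andbT.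
  apply/eqP => E; move: sinE; rewrite E sin0 => /esym /eqP.
  by rewrite gt_eqF // divr_gt0.
rewrite /cexp /= lnK ?posrE // acosK ?in_itv //= sinE.
by rewrite ![r * (_ / _)]mulrC !mulfVK // gt_eqF.
Qed.

Lemma holomorphic_cexp_strip f : holomorphic_on_cut f ->
  holomorphic_on_strip (fun w => f (cexp w)).
Proof.
move=> hf w Sw; have [k fk] := hf _ (cexp_strip Sw); exists (k * cexp w).
apply: (@has_cderiv_comp _ strip cut_upper_plane) => //; first exact: cexp_strip.
exact: has_cderiv_cexp.
Qed.

Variable c : R.
Hypothesis c_gt1 : 1 < c.

Let l_gt0 : 0 < ln c. Proof. exact: ln_gt0. Qed.

Let kl : 2 * pi / ln c * ln c = 2 * pi.
Proof. by rewrite mulfVK // gt_eqF. Qed.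

Definition dilation_invariant (T : Type) (f : R[i] -> T) :=
  forall z, cut_upper_plane z -> f (c%:C * z) = f z.

Lemma cexp_periodic f : dilation_invariant f ->
  periodic_on_strip (ln c) (fun w => f (cexp w)).
Proof.
move=> fc w Sw; rewrite cexpD mulrC -(fc _ (cexp_strip Sw)); congr (f (_ * _)).
by rewrite /cexp /= lnK ?posrE ?(lt_trans ltr01) // cos0 sin0 mulr1 mulr0.
Qed.

Theorem dilation_invariant_unique f : holomorphic_on_cut f -> dilation_invariant f ->
  (forall x : R, x < 0 -> f x%:C = 0) -> forall z, cut_upper_plane z -> f z = 0.
Proof.
move=> hf fc f0 z /cexp_strip_surj[w Sw ->].
apply: (strip_unique l_gt0 kl (P := fun w => f (cexp w))) => //.
- exact: holomorphic_cexp_strip.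
- exact: cexp_periodic.
- by move=> s; rewrite cexp_axis f0 // oppr_lt0 expR_gt0.
Qed.

(** As [z^* * f z] is |z|^2 times f z / z, the sign condition says that f z / z has nonnegative
    imaginary part. *)
Theorem dilation_invariant_constant f : holomorphic_on_cut f -> dilation_invariant f ->
  (forall x : R, x < 0 -> complex.Im (f x%:C) = 0) ->
  (forall z, upper_half_plane z -> 0 <= complex.Im (z^* * f z)) ->
  forall z, cut_upper_plane z -> f z = f (-1)%:C.
Proof.
move=> hf fc f_real f_ge0 z /cexp_strip_surj[w Sw ->].
rewrite (strip_constant l_gt0 kl (P := fun w => f (cexp w)) _ _ _ _ Sw).
- by rewrite cexp_axis expR0.
- exact: holomorphic_cexp_strip.
- exact: cexp_periodic.
- by move=> s; rewrite cexp_axis f_real // oppr_lt0 expR_gt0.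
- move=> s t t0pi.
  have /f_ge0 : upper_half_plane (cexp (s +i* t)).
    by rewrite /upper_half_plane /cexp /= mulr_gt0 ?expR_gt0 // sin_gt0_pi.
  case: (f _) => p q; rewrite /cexp /= => H.
  rewrite -(pmulr_rge0 _ (expR_gt0 s)); by apply: le_trans H _; rewrite le_eqVlt; apply/orP; left; apply/eqP; ring.
Qed.

End dilation_invariance.

(** * Hilbert spaces *)

Section hilbert.
Context {R : realType} {M : completeNormedModType R[i]}.
Implicit Types (f g u v : M) (a b : R[i]).

Lemma conjE a : Num.conj a = a^*.
Proof. by []. Qed.

Lemma ReC_conj a : complex.Re (Num.conj a) = complex.Re a.
Proof. by case: a. Qed.

Definition rnorm f : R := complex.Re `|f|.

Lemma rnormE f : `|f| = (rnorm f)%:C.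
Proof. by rewrite /rnorm RRe_real // normr_real. Qed.

Lemma rnorm_ge0 f : 0 <= rnorm f.
Proof. by rewrite -lecR -rnormE normr_ge0. Qed.

Lemma rnormD f g : rnorm (f + g) <= rnorm f + rnorm g.
Proof. by rewrite -lecR rmorphD /= -!rnormE ler_normD. Qed.

Lemma rnormN f : rnorm (- f) = rnorm f.
Proof. by rewrite /rnorm normrN. Qed.

Lemma rnormB f g : rnorm (f - g) = rnorm (g - f).
Proof. by rewrite -rnormN opprB. Qed.

Lemma rnorm0 : rnorm 0 = 0.
Proof. by rewrite /rnorm normr0. Qed.

Lemma rnormZ a f : rnorm (a *: f) = modulus a * rnorm f.
Proof. by apply: (@complexI R); rewrite rmorphM /= -!rnormE -modulusE normrZ. Qed.

Lemma rnorm_le0 f : rnorm f <= 0 -> f = 0.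
Proof.
move=> f0; apply/eqP; rewrite -normr_eq0 rnormE.
by have -> : rnorm f = 0 by apply/eqP; rewrite eq_le f0 rnorm_ge0.
Qed.

Variable dot : {dot M for Num.conj}.
Hypothesis Mhilbert : hilbert_norm dot.

Lemma dotDl u v f : dot (u + v) f = dot u f + dot v f.
Proof. exact: linearDl. Qed.
Lemma dotBl u v f : dot (u - v) f = dot u f - dot v f.
Proof. exact: linearBl. Qed.
Lemma dotNl u f : dot (- u) f = - dot u f.
Proof. exact: linearNl. Qed.
Lemma dotZl a u f : dot (a *: u) f = a * dot u f.
Proof. exact: linearZl_LR. Qed.
Lemma dotDr u v f : dot f (u + v) = dot f u + dot f v.
Proof. exact: linearDr. Qed.
Lemma dotBr u v f : dot f (u - v) = dot f u - dot f v.
Proof. exact: linearBr. Qed.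
Lemma dotNr u f : dot f (- u) = - dot f u.
Proof. exact: linearNr. Qed.
Lemma dotZr a u f : dot f (a *: u) = Num.conj a * dot f u.
Proof. exact: linearZr_LR. Qed.
Lemma dot0l f : dot 0 f = 0.
Proof. exact: linear0l. Qed.
Lemma dot0r f : dot f 0 = 0.
Proof. exact: linear0r. Qed.
Lemma dotC u v : dot v u = Num.conj (dot u v).
Proof. by rewrite [LHS]hermC expr0 mul1r. Qed.

Lemma dot_self f : dot f f = (rnorm f ^+ 2)%:C.
Proof. by rewrite -Mhilbert rnormE rmorphXn. Qed.

Lemma rnorm_sqrD u v : rnorm (u + v) ^+ 2 =
  rnorm u ^+ 2 + rnorm v ^+ 2 + 2 * complex.Re (dot u v).
Proof.
apply: (@complexI R); rewrite -dot_self dotDl !dotDr !dot_self [dot v u]dotC.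
rewrite !rmorphD rmorphM /=; case: (dot u v) => p q.
by apply/eqP; rewrite eq_complex /=; apply/andP; split; apply/eqP; ring.
Qed.

Lemma dot_bound u v : modulus (dot u v) <= rnorm u * rnorm v.
Proof.
have [v0|v0] := eqVneq (rnorm v) 0.
  have -> : v = 0 by apply: rnorm_le0; rewrite v0.
  by rewrite dot0r modulus0 rnorm0 mulr0.
rewrite -(@ler_pXn2r _ 2) ?nnegrE ?modulus_ge0 ?mulr_ge0 ?rnorm_ge0 //.
pose r := - (rnorm v ^+ 2)^-1; pose a := r%:C * dot u v.
have aE : complex.Re (Num.conj a * dot u v) = r * modulus (dot u v) ^+ 2.
  rewrite /a /modulus; case: (dot u v) => p q /=.
  by rewrite sqr_sqrtr ?addr_ge0 ?sqr_ge0 //; ring.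
have := sqr_ge0 (rnorm (u + a *: v)).
rewrite rnorm_sqrD dotZr aE rnormZ modulusM modulus_real normrN ger0_norm; last first.
  by rewrite invr_ge0 sqr_ge0.
have n0 : 0 < rnorm v ^+ 2 by rewrite exprn_gt0 // lt0r v0 rnorm_ge0.
set m := modulus _; rewrite (_ : _ + _ = rnorm u ^+ 2 - m ^+ 2 / rnorm v ^+ 2).
  by rewrite subr_ge0 ler_pdivrMr // exprMn.
by rewrite /r; field; rewrite v0.
Qed.

Lemma dot_nondegenerate u : (forall v, dot u v = 0) -> u = 0.
Proof.
move=> /(_ u); rewrite dot_self => -[/eqP]; rewrite expf_eq0 /= => /eqP u0.
by apply: rnorm_le0; rewrite u0.
Qed.

Lemma Re_dot_bound u v : `|complex.Re (dot u v)| <= rnorm u * rnorm v.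
Proof. exact: le_trans (Re_le_modulus _) (dot_bound u v). Qed.

Lemma polarization (T : M -> M) : linear T -> (forall f, dot (T f) f = 0) ->
  forall f, T f = 0.
Proof.
move=> linT T0 f; apply: dot_nondegenerate => g.
have TD u v : T (u + v) = T u + T v by have := linT 1 u v; rewrite !scale1r.
have T00 : T 0 = 0 by have := linT (-1) 0 0; rewrite scaler0 addr0 scaleN1r addNr.
have TZ a u : T (a *: u) = a *: T u by have := linT a u 0; rewrite !addr0 T00 addr0.
have E1 : dot (T f) g + dot (T g) f = 0.
  by have := T0 (f + g); rewrite TD dotDl !dotDr !T0 add0r addr0.
have E2 : - 'i * dot (T f) g + 'i * dot (T g) f = 0.
  have := T0 (f + 'i *: g); rewrite TD dotDl !dotDr TZ !dotZl !dotZr !T0 !mulr0 add0r addr0.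
  by rewrite [Num.conj _](_ : _ = - 'i) //; apply/eqP; rewrite eq_complex /= oppr0 !eqxx.
have E3 : 'i * 'i = -1 :> R[i] by rewrite -expr2 sqr_i.
have : 2 * dot (T f) g = 0.
  transitivity (dot (T f) g + dot (T g) f + 'i * (- 'i * dot (T f) g + 'i * dot (T g) f)).
    rewrite (_ : 'i * _ = 'i * 'i * (dot (T g) f - dot (T f) g)); last by ring.
    by rewrite E3; ring.
  by rewrite E1 E2 mulr0 addr0.
by move/eqP; rewrite mulf_eq0 pnatr_eq0 /= => /eqP.
Qed.

End hilbert.

Section contraction.
Context {R : realType} {M : completeNormedModType R[i]}.

Lemma contraction_fixed_point (L : M -> M) (q : R) : 0 <= q -> q < 1 ->
  (forall f g, rnorm (L f - L g) <= q * rnorm (f - g)) -> exists f, L f = f.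
Proof.
move=> q0 q1 Lq; pose x n := iter n L 0.
pose K := rnorm (L 0) / (1 - q).
have q1' : 0 < 1 - q by rewrite subr_gt0.
have K0 : 0 <= K by rewrite divr_ge0 ?rnorm_ge0 // ltW.
have step n : rnorm (x n.+1 - x n) <= q ^+ n * rnorm (L 0).
  elim: n => [|n IH]; first by rewrite /= subr0 expr0 mul1r.
  by apply: le_trans (Lq _ _) _; rewrite exprS -mulrA ler_wpM2l.
(* The factor 1 - q ^+ m records the exact partial geometric sum, so that the induction closes with
   an equality. *)
have dist n m : rnorm (x (n + m)%N - x n) <= K * q ^+ n * (1 - q ^+ m).
  elim: m => [|m IH]; first by rewrite addn0 subrr rnorm0 expr0 subrr mulr0.
  rewrite addnS -[x (n + m).+1](subrK (x (n + m)%N)) -addrA.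
  apply: le_trans (rnormD _ _) _; apply: le_trans (lerD (step _) IH) _.
  rewrite (_ : rnorm (L 0) = K * (1 - q)); last by rewrite mulfVK // gt_eqF.
  by rewrite exprS exprD le_eqVlt; apply/orP; left; apply/eqP; ring.
have dist' n m : (n <= m)%N -> rnorm (x m - x n) <= K * q ^+ n.
  move=> nm; rewrite -(subnKC nm); apply: le_trans (dist _ _) _.
  by apply: ler_piMr; [rewrite mulr_ge0 ?exprn_ge0|rewrite gerBl exprn_ge0].
have small e : 0 < e -> exists n, K * q ^+ n < e.
  move=> e0; have [|n qn] := @geometric_small R q (e / (K + 1)) q0 q1.
    by rewrite divr_gt0 // ltr_wpDl.
  exists n; apply: le_lt_trans (_ : (K + 1) * q ^+ n < e).
    by rewrite ler_wpM2r ?exprn_ge0 // lerDl.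
  by rewrite mulrC -ltr_pdivlMr // ltr_wpDl.
have /cvg_ex[/= f xf] : cvg (x @ \oo).
  apply/cauchy_cvgP; apply/cauchy_ballP => e e0.
  have e0' : 0 < complex.Re e by move: e0; rewrite ltcE => /andP[].
  have eE : e = (complex.Re e)%:C by rewrite RRe_real // gtr0_real.
  have [N KN] := small _ (divr_gt0 e0' (ltr0n R 2)).
  exists (x @` [set n | N <= n]%N, x @` [set n | N <= n]%N).
    by split; exists N => // n Nn; exists n.
  move=> _ /= [[n Nn <-] [m Nm <-]]; rewrite -ball_normE /ball_ /= rnormE eE ltcR.
  have -> : x n - x m = (x n - x N) + - (x m - x N) by rewrite opprB addrA subrK.
  apply: le_lt_trans (rnormD _ _) _; rewrite rnormN.
  have := dist' _ _ Nn; have := dist' _ _ Nm; lra.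
exists f; apply/eqP; rewrite -subr_eq0; apply/eqP; apply: rnorm_le0.
apply/ler_addgt0Pl => e e0; rewrite addr0.
have e2 : 0 < (e / 2)%:C by rewrite ltcR divr_gt0.
move/cvgrPdist_lt: xf => /(_ _ e2) [N _ xN].
have fN : rnorm (f - x N) < e / 2 by have := xN N (leqnn N); rewrite rnormE ltcR.
have fS : rnorm (f - x N.+1) < e / 2 by have := xN N.+1 (leqnSn N); rewrite rnormE ltcR.
have -> : L f - f = (L f - L (x N)) + - (f - x N.+1) by rewrite opprB addrA subrK.
apply: le_trans (rnormD _ _) _; rewrite rnormN.
have : q * rnorm (f - x N) <= rnorm (f - x N) by apply: ler_piMl; [exact: rnorm_ge0|exact: ltW].
have := Lq f (x N); lra.
Qed.

End contraction.

(** * Resolvents of linear relations *)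

Section resolvents.
Context {R : realType} {M : completeNormedModType R[i]}.
Variable dot : {dot M for Num.conj}.
Hypothesis Mhilbert : hilbert_norm dot.
Implicit Types (f g u v : M) (a b mu nu : R[i]) (H : set (M * M)) (T : M -> M).

Definition dotE := (@dotDl _ _ dot, @dotNl _ _ dot, @dotZl _ _ dot, @dot0l _ _ dot).

(** Used throughout to prove vector identities: pairing with an arbitrary vector and rewriting with
    [dotE] leaves an identity in [R[i]] for [ring] or [field]. *)
Lemma dot_inj u v : (forall g, dot u g = dot v g) -> u = v.
Proof.
move=> uv; apply/eqP; rewrite -subr_eq0; apply/eqP.
by apply: (dot_nondegenerate Mhilbert) => g; rewrite dotBl uv subrr.
Qed.

Lemma linear_relation_comb H a b (u v : M * M) : linear_relation H -> H u -> H v ->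
  H (a *: u + b *: v).
Proof.
move=> [H0 Hlin] Hu Hv; apply: (Hlin a) => //.
by rewrite -[b *: v]addr0; apply: (Hlin b).
Qed.

Lemma linear_relationD H (u v : M * M) : linear_relation H -> H u -> H v -> H (u + v).
Proof. by move=> lH Hu Hv; have := linear_relation_comb 1 1 lH Hu Hv; rewrite !scale1r. Qed.

Lemma linear_relationB H (u v : M * M) : linear_relation H -> H u -> H v -> H (u - v).
Proof.
by move=> lH Hu Hv; have := linear_relation_comb 1 (-1) lH Hu Hv; rewrite scale1r scaleN1r.
Qed.

Lemma linear_relationZ H a (u : M * M) : linear_relation H -> H u -> H (a *: u).
Proof.
by move=> lH Hu; have := linear_relation_comb a 0 lH Hu Hu; rewrite scale0r addr0.
Qed.

Lemma is_resolventP H mu T : is_resolvent H mu T <->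
  (forall f, H (T f, f - mu *: T f)) /\
  (forall h, H h -> T (h.2 + mu *: h.1) = h.1).
Proof.
split=> [HT|[T1 T2]].
  split=> [f|h Hh].
    have : graph T (f, T f) by exists f.
    rewrite -HT => -[_ [[u v] Huv <-]] /= [<- <-].
    by rewrite addrK.
  have : rel_inv (rel_shift H mu) (h.2 + mu *: h.1, h.1).
    by exists (h.1, h.2 + mu *: h.1) => //; exists h.
  by rewrite HT => -[f _ [<- <-]].
apply/seteqP; split=> [_ [_ [h Hh <-] <-]|_ [f _ <-]] /=.
  by exists (h.2 + mu *: h.1) => //; rewrite T2.
exists (T f, f) => //; exists (T f, f - mu *: T f); first exact: T1.
by rewrite /= subrK.
Qed.

Lemma resolvent_unique H mu T T' : is_resolvent H mu T -> is_resolvent H mu T' -> T = T'.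
Proof.
move=> /is_resolventP[T1 T2] /is_resolventP[T1' T2']; apply/funext => f.
by have := T2' _ (T1 f); rewrite /= subrK.
Qed.

Lemma resolvent_relation_unique H K mu T :
  is_resolvent H mu T -> is_resolvent K mu T -> H = K.
Proof.
move=> /is_resolventP[T1 T2] /is_resolventP[T1' T2'].
apply/seteqP; split=> -[u v] Huv.
  have := T1' (v + mu *: u); rewrite (T2 _ Huv) /= addrK //.
have := T1 (v + mu *: u); rewrite (T2' _ Huv) /= addrK //.
Qed.

Lemma resolvent_linear H mu T : linear_relation H -> is_resolvent H mu T -> linear T.
Proof.
move=> [_ lH] /is_resolventP[T1 T2] a f g.
have := T2 _ (lH a _ _ (T1 f) (T1 g)) => /= <-; congr T.
apply: dot_inj => w; rewrite /= !dotE; ring.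
Qed.

(** The rotation [a] treats dissipative relations (a = -i) and nonnegative ones (any a with Re a >=
    0) by the same resolvent estimates. The admissible shifts are the nu with Re (a nu) > 0. *)
Definition accretive a H := forall h, H h -> 0 <= complex.Re (a * dot h.2 h.1).

Lemma dissipative_accretive H : dissipative dot H -> accretive (- 'i) H.
Proof. by move=> dH h /dH; case: (dot _ _) => p q /=; rewrite oppr0 mul0r sub0r mulN1r opprK. Qed.

Lemma nonnegative_accretive a H : 0 <= complex.Re a -> nonnegative dot H -> accretive a H.
Proof.
move=> a0 nH h /nH; case: (dot _ _) => p q; rewrite lecE /= => /andP[/eqP -> p0].
by case: a a0 => x y /= x0; rewrite mulr0 subr0 mulr_ge0.
Qed.

Lemma accretive_bound H a nu u f : accretive a H -> H (u, f - nu *: u) ->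
  complex.Re (a * nu) * rnorm u <= modulus a * rnorm f.
Proof.
move=> aH /aH /=; rewrite dotBl dotZl (dot_self Mhilbert) => E.
have [u0|u0] := eqVneq (rnorm u) 0.
  by rewrite u0 mulr0 mulr_ge0 ?modulus_ge0 ?rnorm_ge0.
have up : 0 < rnorm u by rewrite lt0r u0 rnorm_ge0.
rewrite -(ler_pM2r up); apply: (@le_trans _ _ (complex.Re (a * dot f u))).
  rewrite -subr_ge0; apply: le_trans E _; rewrite le_eqVlt; apply/orP; left; apply/eqP.
  by case: a nu (dot f u) {aH} => [a1 a2] [n1 n2] [p q] /=; ring.
apply: le_trans (ler_norm _) _; apply: le_trans (Re_le_modulus _) _.
by rewrite modulusM -mulrA ler_wpM2l ?modulus_ge0 ?dot_bound.
Qed.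

Lemma resolvent_bound H a nu T : accretive a H -> is_resolvent H nu T ->
  0 < complex.Re (a * nu) ->
  forall f, rnorm (T f) <= modulus a / complex.Re (a * nu) * rnorm f.
Proof.
move=> aH /is_resolventP[T1 _] nu0 f.
by rewrite mulrAC ler_pdivlMr // [leLHS]mulrC; exact: accretive_bound aH (T1 f).
Qed.

(* The Cayley transform (H + nus)(H + nu0)^-1, with nus the mirror image of
   nu0 in the line Re (a z) = 0, is a contraction, and H + nu0 can be replaced
   by H + nu through a Neumann series of ratio |nu - nu0| / |nu - nus| < 1. *)
Lemma resolvent_exists H a nu0 nu T0 : linear_relation H -> accretive a H ->
  is_resolvent H nu0 T0 -> 0 < complex.Re (a * nu0) -> 0 < complex.Re (a * nu) ->
  exists T, is_resolvent H nu T.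
Proof.
move=> lH aH rT0 nu0_gt0 nu_gt0.
have linT0 := resolvent_linear lH rT0.
have /is_resolventP[T1 T2] := rT0.
have a0 : a != 0 by apply: contraTneq nu0_gt0 => ->; rewrite mul0r ltxx.
pose b := a * nu0; pose nus := - (Num.conj b) / a.
have bs : a * nus = - Num.conj b by rewrite /nus mulrC mulfVK.
have dE : a * (nu0 - nus) = (2 * complex.Re b)%:C.
  by rewrite mulrBr bs -/b opprK; case: (b) => p q; apply/eqP; rewrite eq_complex /=; apply/andP; split; apply/eqP; ring.
have d0 : nu0 - nus != 0.
  apply: contraTneq nu0_gt0 => E; move: dE; rewrite E mulr0 => -[] /esym /eqP.
  by rewrite mulf_eq0 pnatr_eq0 /= -/b => /eqP ->; rewrite ltxx.
have mods : modulus (nu0 - nu) < modulus (nu - nus).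
  have ma : 0 < modulus a by rewrite modulus_gt0.
  rewrite -(ltr_pM2l ma) -!modulusM !mulrBr bs -/b opprK.
  rewrite -(@ltr_pXn2r _ 2) ?nnegrE ?modulus_ge0 //.
  move: nu0_gt0 nu_gt0; rewrite -/b; case: (b) (a * nu) => [p q] [x y] /= p0 x0.
  rewrite /modulus /= !sqr_sqrtr ?addr_ge0 ?sqr_ge0 //; nra.
have e0 : nu - nus != 0 by rewrite -modulus_gt0; apply: le_lt_trans mods; exact: modulus_ge0.
pose C f := f - (nu0 - nus) *: T0 f.
have Cle f : rnorm (C f) <= rnorm f.
  rewrite -(@ler_pXn2r _ 2) ?nnegrE ?rnorm_ge0 //.
  have ma : 0 < modulus a ^+ 2 by rewrite exprn_gt0 // modulus_gt0.
  rewrite -(ler_pM2l ma) -!exprMn -!rnormZ.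
  (* In terms of the pair (k, h) of H, a f = a h + b k while a C f = a h - conj b k. The squared
     norms differ by 4 Re b Re (a (h, k)), which accretivity makes nonnegative. *)
  pose k := T0 f; pose h := f - nu0 *: k.
  have aCf : a *: C f = a *: h + (- Num.conj b) *: k.
    rewrite -bs /C /h -/k; apply: dot_inj => w; rewrite !dotE; ring.
  have af : a *: f = a *: h + b *: k.
    rewrite /b /h -/k; apply: dot_inj => w; rewrite !dotE; ring.
  rewrite aCf af !(rnorm_sqrD Mhilbert) !rnormZ modulusN.
  have -> : modulus (Num.conj b) = modulus b by case: (b) => p q; rewrite /modulus /= sqrrN.
  rewrite lerD2l !dotZr !dotZl.
  have := aH _ (T1 f); rewrite /= -/k -/h; move: nu0_gt0; rewrite -/b.
  case: (b) (a * dot h k) => [p q] [x y] /= p0 x0; nra.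
have CB f g : C f - C g = C (f - g).
  rewrite /C; have := linT0 (-1) g f; rewrite !scaleN1r ![- _ + _]addrC => ->.
  by apply: dot_inj => w; rewrite !dotE; ring.
pose kappa := (nu0 - nu) / (nu - nus).
have k1 : modulus kappa < 1.
  by rewrite /kappa modulusM modulusV ltr_pdivrMr ?mul1r // modulus_gt0.
(* Look for u = T0 psi. The pair (u, psi - nu0 u) is in H, and it is the required one if f = psi +
   (nu - nu0) T0 psi; substituting T0 psi = (psi - C psi) / (nu0 - nus) gives the fixed point
   equation below. *)
have solve f : exists u, H (u, f - nu *: u).
  have [||psi psiE] := @contraction_fixed_point _ M
     (fun g => ((nu0 - nus) / (nu - nus)) *: f - kappa *: C g) (modulus kappa) _ k1.
  - exact: modulus_ge0.
  - move=> g g'; rewrite (_ : _ - _ = - kappa *: (C g - C g')).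
      by rewrite CB rnormZ modulusN ler_wpM2l ?modulus_ge0.
    by apply: dot_inj => w; rewrite !dotE; ring.
  exists (T0 psi); have -> : f - nu *: T0 psi = psi - nu0 *: T0 psi; last exact: T1.
  apply: dot_inj => w; move/(congr1 (fun v => dot v w)): psiE.
  rewrite /C /kappa !dotE.
  move: (dot f w) (dot psi w) (dot (T0 psi) w) => F P K E.
  have : F - P + (nu0 - nu) * K = 0.
    transitivity ((nu - nus) / (nu0 - nus) * ((nu0 - nus) / (nu - nus) * F -
      (nu0 - nu) / (nu - nus) * (P - (nu0 - nus) * K) - P)).
      by field; rewrite d0 e0.
    by rewrite E subrr mulr0.
  by move=> E'; apply/eqP; rewrite -subr_eq0 -E'; apply/eqP; ring.
have uniq f u v : H (u, f - nu *: u) -> H (v, f - nu *: v) -> u = v.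
  move=> Hu Hv; have := linear_relationB lH Hu Hv => /= Huv.
  have {}Huv : H (u - v, 0 - nu *: (u - v)).
    rewrite (_ : 0 - _ = f - nu *: u - (f - nu *: v)) //.
    by apply: dot_inj => w; rewrite !dotE; ring.
  have := accretive_bound aH Huv; rewrite rnorm0 mulr0 pmulr_rle0 // => /rnorm_le0.
  by move/eqP; rewrite subr_eq0 => /eqP.
have [T TP] := choice solve.
exists T; apply/is_resolventP; split => // -[u v] /= Huv.
apply: (uniq (v + nu *: u)) => //.
by rewrite addrK.
Qed.

End resolvents.

(** * Resolvents at a shift depending on the parameter *)

Section moving_resolvent.
Context {R : realType} {M : completeNormedModType R[i]}.
Variable dot : {dot M for Num.conj}.
Hypothesis Mhilbert : hilbert_norm dot.
Implicit Types (f g u v : M) (z w mu : R[i]).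

Definition near_in (D : set R[i]) z (P : R[i] -> Prop) :=
  exists2 r : R, 0 < r & forall w, D w -> modulus (w - z) < r -> P w.

Lemma near_in_and D z P P' : near_in D z P -> near_in D z P' ->
  near_in D z (fun w => P w /\ P' w).
Proof.
move=> [r r0 HP] [s s0 HP']; exists (Num.min r s); first by rewrite lt_min r0.
by move=> w Dw; rewrite lt_min => /andP[/(HP _ Dw) ? /(HP' _ Dw) ?].
Qed.

Lemma near_inW D z (P P' : R[i] -> Prop) : near_in D z P -> (forall w, D w -> P w -> P' w) ->
  near_in D z P'.
Proof. by move=> [r r0 HP] PP'; exists r => // w Dw /(HP _ Dw) /(PP' _ Dw). Qed.

Lemma near_in_modulus D z (e : R) : 0 < e -> near_in D z (fun w => modulus (w - z) <= e).
Proof. by move=> e0; exists e => // w _ /ltW. Qed.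

Lemma bounded_operator_rnorm (T : M -> M) : bounded_operator T ->
  exists2 K : R, 0 <= K & forall f, rnorm (T f) <= K * rnorm f.
Proof.
move=> [_ [k Tk]]; exists (modulus k); first exact: modulus_ge0.
move=> f; have := Tk f; rewrite !rnormE; case: k {Tk} => p q.
rewrite lecE /= => /andP[_ H]; apply: le_trans H _.
rewrite mulr0 subr0 ler_wpM2r ?rnorm_ge0 //.
exact: le_trans (ler_norm _) (Re_le_modulus (p +i* q)).
Qed.

Lemma op_differentiable_near (F : R[i] -> M -> M) z : op_differentiable_at F z ->
  exists2 F' : M -> M, bounded_operator F' & forall D (e : R), 0 < e ->
    near_in D z (fun w => forall f,
      rnorm (F w f - F z f - (w - z) *: F' f) <= e * modulus (w - z) * rnorm f).
Proof.
move=> [F' bF' HF]; exists F' => // D e e0.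
have eC : 0 < e%:C by rewrite ltcR.
have /nbhs_ballP[/= r r0 H] := HF _ eC.
have r0' : 0 < complex.Re r by move: r0; rewrite ltcE => /andP[].
have rE : r = (complex.Re r)%:C by rewrite RRe_real // gtr0_real.
exists (complex.Re r) => // w _ wr f.
have := H w; rewrite /ball /= => /(_ _ f).
rewrite !rnormE modulusE -!rmorphM /= lecR; apply.
by rewrite modulusB rE ltcR.
Qed.

Variables (D : set R[i]) (Q : R[i] -> set (M * M)) (mu : R[i]).
Variables (F T : R[i] -> M -> M) (m : R[i] -> R[i]) (z0 dm : R[i]).
Hypothesis Q_linear : forall z, D z -> linear_relation (Q z).
Hypothesis F_resolvent : forall z, D z -> is_resolvent (Q z) mu (F z).
Hypothesis F_diff : op_differentiable_at F z0.
Hypothesis T_resolvent : forall z, D z -> is_resolvent (Q z) (m z) (T z).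
Hypothesis m_diff : has_cderiv D m z0 dm.
Hypothesis Dz0 : D z0.
Hypothesis T_bound : exists2 K : R, 0 <= K & forall f, rnorm (T z0 f) <= K * rnorm f.

Lemma resolvent_eq z u f : D z -> Q z (u, f - m z *: u) -> T z f = u.
Proof.
move=> Dz Hu; have /is_resolventP[_ /(_ _ Hu) /=] := T_resolvent Dz.
by rewrite subrK.
Qed.

Lemma F_continuous (e : R) : 0 < e ->
  near_in D z0 (fun w => forall f, rnorm (F w f - F z0 f) <= e * rnorm f).
Proof.
move=> e0; have [F' /bounded_operator_rnorm[K K0 F'K] HF] := op_differentiable_near F_diff.
have K1 : 0 < 1 + K by rewrite ltr_pwDl.
apply: near_inW (near_in_and (HF D _ ltr01) (near_in_modulus D z0 (divr_gt0 e0 K1))) _.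
move=> w Dw [H we] f; rewrite -[F w f - F z0 f](subrK ((w - z0) *: F' f)).
apply: le_trans (rnormD _ _) _.
have {}H := H f; rewrite mul1r in H.
have A : rnorm ((w - z0) *: F' f) <= modulus (w - z0) * (K * rnorm f).
  by rewrite rnormZ ler_wpM2l ?modulus_ge0.
have B : modulus (w - z0) * (1 + K) <= e by rewrite -ler_pdivlMr.
have := ler_wpM2r (rnorm_ge0 f) B; lra.
Qed.

Lemma m_continuous (e : R) : 0 < e -> near_in D z0 (fun w => modulus (m w - m z0) <= e).
Proof. exact: (has_cderiv_cvg m_diff). Qed.

(** A bound at z0 alone propagates. The vector k = T w f equals F w y with y = f + (mu - m w) k; it
    is compared with k0 = F z0 y, which is a value of T z0. The terms in k created by the increments
    of F and m have total coefficient at most 1/2 by the choice of [om] and [eta], and are absorbed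
    on the left; hence the factor 2 (K + 1). *)
Lemma T_locally_bounded : exists2 K : R, 0 <= K &
  near_in D z0 (fun w => forall f, rnorm (T w f) <= K * rnorm f).
Proof.
have [K K0 TK] := T_bound.
pose L := modulus (m z0 - mu) + 1.
have L1 : 1 <= L by rewrite lerDr modulus_ge0.
have KL : 0 < 4 * (K * L + 1) * L by nra.
have K4 : 0 < 4 * (K + 1) by nra.
exists (2 * (K + 1)); first by nra.
apply: near_inW (near_in_and (F_continuous (divr_gt0 ltr01 KL))
  (near_in_and (m_continuous (divr_gt0 ltr01 K4)) (m_continuous ltr01))) _.
move=> w Dw [HF [Hm Hm1]] f.
set om := 1 / _ in HF; set eta := 1 / _ in Hm.
pose k := T w f; pose y := f + (mu - m w) *: k; pose k0 := F z0 y.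
have /is_resolventP[T1 _] := T_resolvent Dw.
have Fy : F w y = k.
  have /is_resolventP[_ /(_ _ (T1 f)) /=] := F_resolvent Dw.
  rewrite -/k => <-; congr (F w).
  by apply: (dot_inj Mhilbert) => x; rewrite !dotE; ring.
have k0E : T z0 (f + ((m z0 - m w) *: k + (m z0 - mu) *: (k0 - k))) = k0.
  have /is_resolventP[F1 _] := F_resolvent Dz0.
  apply: resolvent_eq => //; have := F1 y; rewrite -/k0.
  congr (Q z0 (_, _)).
  by apply: (dot_inj Mhilbert) => x; rewrite /y !dotE; ring.
have kk0 : rnorm (k0 - k) <= om * rnorm y by rewrite rnormB -Fy; exact: HF.
have Lw : modulus (mu - m w) <= L.
  have -> : mu - m w = - (m z0 - mu) + - (m w - m z0) by ring.
  by apply: le_trans (modulusD _ _) _; rewrite !modulusN lerD2l.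
have yle : rnorm y <= rnorm f + L * rnorm k.
  apply: le_trans (rnormD _ _) _; rewrite lerD2l rnormZ.
  by rewrite ler_wpM2r ?rnorm_ge0.
have mm : modulus (m z0 - m w) <= eta by rewrite modulusB.
have Lz : modulus (m z0 - mu) <= L by rewrite lerDl.
have k0le : rnorm k0 <= K * (rnorm f + (eta * rnorm k + L * rnorm (k0 - k))).
  rewrite -{1}k0E; apply: le_trans (TK _) _; rewrite ler_wpM2l //.
  apply: le_trans (rnormD _ _) _; rewrite lerD2l.
  apply: le_trans (rnormD _ _) _; rewrite !rnormZ.
  by apply: lerD; rewrite ler_wpM2r ?rnorm_ge0.
have kle : rnorm k <= rnorm k0 + rnorm (k0 - k).
  by rewrite -{1}(subrK k0 k) addrC (rnormB k0); apply: le_trans (rnormD _ _) _.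
have omE : om * (4 * (K * L + 1) * L) = 1 by rewrite /om mul1r mulVf // gt_eqF.
have etaE : eta * (4 * (K + 1)) = 1 by rewrite /eta mul1r mulVf // gt_eqF.
have om0 : 0 < om by rewrite divr_gt0.
have eta0 : 0 < eta by rewrite divr_gt0.
have f0 := rnorm_ge0 f; have kk := rnorm_ge0 k.
have A1 : K * (eta * rnorm k) <= rnorm k / 4.
  have : (K * eta) * rnorm k <= (1 / 4) * rnorm k by rewrite ler_wpM2r //; nra.
  by rewrite -mulrA; lra.
have A2 : (K * L + 1) * rnorm (k0 - k) <= rnorm f + rnorm k / 4.
  have KL1 : 0 <= K * L + 1 by nra.
  apply: le_trans (ler_wpM2l KL1 kk0) _.
  apply: le_trans (ler_wpM2l KL1 (ler_wpM2l (ltW om0) yle)) _.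
  have B1 : (K * L + 1) * om <= 1 by nra.
  have B2 : (K * L + 1) * om * L = 1 / 4 by lra.
  rewrite mulrA mulrDr lerD //; first by rewrite ler_piMl.
  by rewrite mulrA B2; lra.
have -> : rnorm (T w f) = rnorm k by [].
move: A1 A2 k0le kle; rewrite !mulrDr !mulrDl !mul1r !mulrA; lra.
Qed.

(** A resolvent identity: the increment of T comes from the increment k - h0 of F at a fixed vector
    and from that of m. On the right T w acts only on the small vector k - h0 and on the fixed
    vector h0, so local bounds and strong continuity suffice. *)
Lemma resolvent_difference f w : D w ->
  let h0 := T z0 f in let k := F w (f + (mu - m z0) *: h0) in
  T w f - h0 = (k - h0) - (m w - mu) *: T w (k - h0) - (m w - m z0) *: T w h0.
Proof.
move=> Dw h0 k; pose g := f + (mu - m z0) *: h0.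
have linT := resolvent_linear Mhilbert (Q_linear Dw) (T_resolvent Dw).
have TE : T w (f + (m w - mu) *: (k - h0) + (m w - m z0) *: h0) = k.
  have /is_resolventP[F1 _] := F_resolvent Dw.
  apply: resolvent_eq => //; have := F1 g; rewrite -/k; congr (Q w (_, _)).
  by apply: (dot_inj Mhilbert) => x; rewrite /g !dotE; ring.
have TD u v a : T w (u + a *: v) = T w u + a *: T w v.
  by rewrite addrC linT addrC.
apply: (dot_inj Mhilbert) => x; have := congr1 (fun v => dot v x) TE.
by rewrite !TD !dotE => <-; ring.
Qed.

Lemma F_at_base f : F z0 (f + (mu - m z0) *: T z0 f) = T z0 f.
Proof.
have /is_resolventP[T1 _] := T_resolvent Dz0.
have /is_resolventP[_ /(_ _ (T1 f)) /=] := F_resolvent Dz0.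
move=> {2}<-; congr (F z0).
by apply: (dot_inj Mhilbert) => x; rewrite !dotE; ring.
Qed.

Lemma F_strongly_continuous g (e : R) : 0 < e ->
  near_in D z0 (fun w => rnorm (F w g - F z0 g) <= e).
Proof.
move=> e0; have g1 : 0 < rnorm g + 1 by rewrite ltr_wpDl ?rnorm_ge0.
apply: near_inW (F_continuous (divr_gt0 e0 g1)) _ => w Dw /(_ g) H.
apply: le_trans H _; rewrite mulrAC ler_pdivrMr // ler_wpM2l ?(ltW e0) //.
by rewrite lerDl.
Qed.

Lemma T_strongly_continuous f (e : R) : 0 < e ->
  near_in D z0 (fun w => rnorm (T w f - T z0 f) <= e).
Proof.
move=> e0; have [K K0 TK] := T_locally_bounded.
pose h0 := T z0 f; pose g := f + (mu - m z0) *: h0.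
pose L := modulus (m z0 - mu) + 1.
have L0 : 0 <= L by rewrite addr_ge0 ?modulus_ge0.
pose S := 1 + L * K + K * rnorm h0.
have S0 : 0 < S by rewrite /S -addrA ltr_pwDl // addr_ge0 ?mulr_ge0 ?rnorm_ge0.
have e'0 : 0 < e / S by rewrite divr_gt0.
apply: near_inW (near_in_and TK (near_in_and (F_strongly_continuous g e'0)
  (near_in_and (m_continuous e'0) (m_continuous ltr01)))) _.
move=> w Dw [{}TK [Fg [Hm Hm1]]].
rewrite resolvent_difference // -/h0 -/g; set k := F w g.
have kh : rnorm (k - h0) <= e / S by rewrite -[h0]F_at_base.
have mw : modulus (m w - mu) <= L.
  have -> : m w - mu = (m z0 - mu) + (m w - m z0) by ring.
  by apply: le_trans (modulusD _ _) _; rewrite lerD2l.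
apply: le_trans (rnormD _ _) _; rewrite rnormN rnormZ.
have H1 : rnorm (k - h0 - (m w - mu) *: T w (k - h0)) <= e / S + L * (K * (e / S)).
  apply: le_trans (rnormD _ _) _; rewrite rnormN rnormZ lerD //.
  apply: ler_pM; rewrite ?modulus_ge0 ?rnorm_ge0 //.
  by apply: le_trans (TK _) _; rewrite ler_wpM2l.
have H2 : modulus (m w - m z0) * rnorm (T w h0) <= e / S * (K * rnorm h0).
  by apply: ler_pM; rewrite ?modulus_ge0 ?rnorm_ge0.
have -> : e = e / S + L * (K * (e / S)) + e / S * (K * rnorm h0).
  rewrite -{1}(mulfVK (lt0r_neq0 S0) e) {2}/S; ring.
exact: lerD.
Qed.

Lemma T_differentiable f : exists X : M, forall e : R, 0 < e ->
  near_in D z0 (fun w => rnorm (T w f - T z0 f - (w - z0) *: X) <= e * modulus (w - z0)).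
Proof.
have [K K0 TK] := T_locally_bounded.
have [F' bF' HF] := op_differentiable_near F_diff.
pose h0 := T z0 f; pose g := f + (mu - m z0) *: h0; pose d := F' g.
(* The formal derivative of [resolvent_difference] at z0, where k - h0 has derivative d. The
   constant [S] adds up the coefficients of the six error terms, each being allowed e / S. *)
exists (d - (m z0 - mu) *: T z0 d - dm *: T z0 h0) => e e0.
pose L := modulus (m z0 - mu) + 1.
have L0 : 0 <= L by rewrite addr_ge0 ?modulus_ge0.
pose S := 1 + L * K + K * rnorm d + modulus (m z0 - mu) + K * rnorm h0 + modulus dm.
have S0 : 0 < S.
  by rewrite /S -!addrA ltr_pwDl // !addr_ge0 ?mulr_ge0 ?rnorm_ge0 ?modulus_ge0.
have e'0 : 0 < e / S by rewrite divr_gt0.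
have g1 : 0 < rnorm g + 1 by rewrite ltr_wpDl ?rnorm_ge0.
apply: near_inW (near_in_and TK (near_in_and (HF D _ (divr_gt0 e'0 g1))
  (near_in_and (near_in_and (m_continuous e'0) (m_continuous ltr01))
   (near_in_and (m_diff e'0)
  (near_in_and (T_strongly_continuous d e'0) (T_strongly_continuous h0 e'0)))))) _.
move=> w Dw [{}TK [/(_ g) Fg [[Hm Hm1] [Dm [Td Th]]]]].
have linT := resolvent_linear Mhilbert (Q_linear Dw) (T_resolvent Dw).
rewrite resolvent_difference // -/h0 -/g; set k := F w g.
set r := modulus (w - z0) in Fg Dm *.
have r0 : 0 <= r by exact: modulus_ge0.
have kh : rnorm (k - h0 - (w - z0) *: d) <= e / S * r.
  move: Fg; rewrite F_at_base -/h0 -/k -/d => H; apply: le_trans H _.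
  rewrite -!mulrA ler_wpM2l ?(ltW e0) // ler_wpM2l ?invr_ge0 ?(ltW S0) //.
  by rewrite mulrCA ler_piMr // ler_pdivrMl // mulr1 lerDl.
have mw : modulus (m w - mu) <= L.
  have -> : m w - mu = (m z0 - mu) + (m w - m z0) by ring.
  by apply: le_trans (modulusD _ _) _; rewrite lerD2l.
set q := k - h0 - (w - z0) *: d in kh.
have kE : k - h0 = (w - z0) *: d + q by rewrite /q [RHS]addrC subrK.
have TkE : T w (k - h0) = (w - z0) *: T w d + T w q by rewrite kE linT.
have -> : k - h0 - (m w - mu) *: T w (k - h0) - (m w - m z0) *: T w h0 -
    (w - z0) *: (d - (m z0 - mu) *: T z0 d - dm *: T z0 h0) =
   q + (- (m w - mu)) *: T w q + ((w - z0) * - (m w - m z0)) *: T w d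
   + ((w - z0) * - (m z0 - mu)) *: (T w d - T z0 d)
   + (- (m w - m z0 - dm * (w - z0))) *: T w h0
   + ((w - z0) * - dm) *: (T w h0 - T z0 h0).
  rewrite TkE; apply: (dot_inj Mhilbert) => x; rewrite kE !dotE; ring.
have -> : e * r = e / S * r + L * (K * (e / S * r)) + r * (e / S) * (K * rnorm d)
   + r * modulus (m z0 - mu) * (e / S) + e / S * r * (K * rnorm h0)
   + r * modulus dm * (e / S).
  rewrite -{1}(mulfVK (lt0r_neq0 S0) e) {2}/S; ring.
have nn := (modulus_ge0, @rnorm_ge0 R M).
apply: le_trans (rnormD _ _) _; apply: lerD; last first.
  rewrite rnormZ modulusM modulusN -/r; apply: ler_pM; rewrite ?mulr_ge0 ?nn //.
apply: le_trans (rnormD _ _) _; apply: lerD; last first.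
  by rewrite rnormZ modulusN; apply: ler_pM; rewrite ?nn.
apply: le_trans (rnormD _ _) _; apply: lerD; last first.
  by rewrite rnormZ modulusM modulusN -/r; apply: ler_pM; rewrite ?mulr_ge0 ?nn.
apply: le_trans (rnormD _ _) _; apply: lerD; last first.
  rewrite rnormZ modulusM modulusN -/r; apply: ler_pM; rewrite ?mulr_ge0 ?nn //.
  by rewrite ler_wpM2l.
apply: le_trans (rnormD _ _) _; apply: lerD => //.
rewrite rnormZ modulusN; apply: ler_pM; rewrite ?nn //.
by apply: le_trans (TK _) _; rewrite ler_wpM2l.
Qed.

Lemma resolvent_matrix_element_diff f g :
  exists k : R[i], has_cderiv D (fun w => dot (T w f) g) z0 k.
Proof.
have [X HX] := T_differentiable f; exists (dot X g) => e e0.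
have g1 : 0 < rnorm g + 1 by rewrite ltr_wpDl ?rnorm_ge0.
have [r r0 H] := HX _ (divr_gt0 e0 g1); exists r => // w Dw wr.
have -> : dot (T w f) g - dot (T z0 f) g - dot X g * (w - z0) =
    dot (T w f - T z0 f - (w - z0) *: X) g by rewrite !dotE; ring.
apply: le_trans (dot_bound Mhilbert _ _) _.
apply: le_trans (ler_wpM2r (rnorm_ge0 _) (H w Dw wr)) _.
rewrite mulrAC ler_wpM2r ?modulus_ge0 // -mulrA ler_piMr ?(ltW e0) //.
by rewrite ler_pdivrMl // mulr1 lerDl.
Qed.

End moving_resolvent.

(** * Monotonicity on the negative axis *)

Section derivative_sign.
Context {R : realType}.

(** Bisection with height 0: the estimate that the increment is at most a small multiple of the
    length is additive over halves. *)
Lemma nonincreasing_of_derivative (t : R -> R) (a b : R) : a <= b ->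
  (forall s, a <= s <= b -> exists2 k : R, k <= 0 & forall e : R, 0 < e ->
     exists2 r : R, 0 < r & forall y, a <= y <= b -> `|y - s| < r ->
       `|t y - t s - k * (y - s)| <= e * `|y - s|) ->
  t b <= t a.
Proof.
move=> ab Ht; rewrite -subr_le0; apply/ler_addgt0Pl => e e0; rewrite addr0.
pose w := b - a; have w0 : 0 <= w by rewrite subr_ge0.
have w1 : 0 < w + 1 by rewrite ltr_wpDl.
pose P x (y t' : R) := a <= x -> x + w * t' <= b -> t (x + w * t') - t x <= e / (w + 1) * (w * t').
suff : P a 0 1.
  rewrite /P mulr1 /w [_ + (_ - _)]addrC subrK => /(_ (lexx _) (lexx _)) H.
  apply: le_trans H _; rewrite -/w mulrAC ler_pdivrMr // ler_wpM2l ?(ltW e0) //.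
  by rewrite lerDl.
apply: (@rectangle_bisection R w 0 P a 0 w0 (lexx _)) => [x y t' t0 P1 P2 _ _ ax xb|s u sab _].
  have wt : 0 <= w * t' by rewrite mulr_ge0 // ltW.
  have E : x + w * (t' / 2) + w * (t' / 2) = x + w * t' by field.
  move: P1 P2; rewrite /P E => /(_ ltac:(lra) ltac:(lra)) P1 /(_ ltac:(lra) ltac:(lra)) P2.
  lra.
have {}sab : a <= s <= b by move: sab; rewrite /w [_ + (_ - _)]addrC subrK.
have [k k0 Hk] := Ht s sab; have [r r0 Hr] := Hk _ (divr_gt0 e0 w1).
exists (r / (w + 1)); first by rewrite divr_gt0.
move=> x y t' /andP[t0 tr] /andP[xs sx] _ ax xb.
have wt : 0 <= w * t' by rewrite mulr_ge0 // ltW.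
have wtr : w * t' < r.
  move: tr; rewrite ltr_pdivlMr // => tr; apply: le_lt_trans tr.
  by rewrite mulrC ler_wpM2l ?(ltW t0) // lerDl.
have D1 : `|x - s| = s - x by rewrite ler0_norm ?opprB // subr_le0.
have D2 : `|x + w * t' - s| = x + w * t' - s by rewrite ger0_norm // subr_ge0.
have := Hr x ltac:(apply/andP; split; lra) ltac:(rewrite D1; lra).
have := Hr (x + w * t') ltac:(apply/andP; split; lra) ltac:(rewrite D2; lra).
rewrite D1 D2 !ler_norml => /andP[_ A] /andP[B _].
have : k * (w * t') <= 0 by rewrite mulr_le0_ge0.
move: A B; set q := e / _; lra.
Qed.

(** For large n the point c^n y lies to the left of x, and t takes the same value there as at y; so
    t x <= t y for all negative x and y. *)
Lemma constant_of_dilation (t : R -> R) (c : R) : 1 < c ->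
  (forall x y, x <= y -> y < 0 -> t y <= t x) ->
  (forall x, x < 0 -> t (c * x) = t x) -> forall x y, x < 0 -> y < 0 -> t x = t y.
Proof.
move=> c1 tmono tc.
have c0 : 0 < c by rewrite (lt_trans ltr01).
have tcn n x : x < 0 -> t (c ^+ n * x) = t x.
  elim: n => [|n IH] x0; first by rewrite expr0 mul1r.
  by rewrite exprS -mulrA tc ?IH // nmulr_llt0 // exprn_gt0.
have le x y : x < 0 -> y < 0 -> t x <= t y.
  move=> x0 y0; have [n Hn] : exists n, c^-1 ^+ n < y / x.
    apply: geometric_small; rewrite ?invr_ge0 ?(ltW c0) ?invf_lt1 //.
    by rewrite nmulr_lgt0 ?invr_lt0.
  rewrite -(tcn n y y0); apply: tmono => //.
  move: Hn; rewrite ltr_ndivlMr // exprVn mulrC ltr_pdivlMr ?exprn_gt0 // => /ltW.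
  by rewrite mulrC.
by move=> x y x0 y0; apply/eqP; rewrite eq_le !le.
Qed.

End derivative_sign.

(** * Stieltjes families on the upper half-plane and the negative axis *)

Section stieltjes_on_cut.
Context {R : realType} {M : completeNormedModType R[i]}.
Variable dot : {dot M for Num.conj}.
Hypothesis Mhilbert : hilbert_norm dot.
Implicit Types (f g u v : M) (z w mu : R[i]) (x y : R) (H : set (M * M)).
Implicit Types (Q : R[i] -> set (M * M)).

(** [F] is differentiable in full neighbourhoods, also across the axis, but it is tied to Q only on
    the cut half-plane; hence derivatives are taken along that set. *)
Definition stieltjes_on_cut Q := [/\
  forall z, cut_upper_plane z -> linear_relation (Q z),
  forall z, upper_half_plane z -> dissipative dot (Q z),
  forall x, x < 0 -> nonnegative dot (Q x%:C) &
  exists mu, exists2 F : R[i] -> M -> M, upper_half_plane mu &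
    (forall z, cut_upper_plane z -> is_resolvent (Q z) mu (F z)) /\
    (forall z, cut_upper_plane z -> op_differentiable_at F z)].

Lemma conj_real x : Num.conj (x%:C : R[i]) = x%:C.
Proof. exact: conjc_real. Qed.

Lemma Re_NiM_gt0 mu : upper_half_plane mu -> 0 < complex.Re (- 'i * mu).
Proof. by case: mu => p q; rewrite /upper_half_plane /= => q0; lra. Qed.

Lemma dissipative_resolvent H mu nu (T0 : M -> M) : linear_relation H ->
  dissipative dot H -> upper_half_plane mu -> is_resolvent H mu T0 ->
  upper_half_plane nu -> exists2 T, is_resolvent H nu T &
    exists2 K : R, 0 <= K & forall f, rnorm (T f) <= K * rnorm f.
Proof.
move=> lH dH mu0 T0H nu0; have aH := dissipative_accretive dH.
have mu0' := Re_NiM_gt0 mu0; have nu0' := Re_NiM_gt0 nu0.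
have [T TH] := resolvent_exists Mhilbert lH aH T0H mu0' nu0'.
exists T => //; eexists; last exact: (resolvent_bound Mhilbert aH TH nu0').
by rewrite divr_ge0 ?modulus_ge0 // ltW.
Qed.

Lemma nonnegative_resolvent H mu (r : R) (T0 : M -> M) : linear_relation H ->
  nonnegative dot H -> upper_half_plane mu -> is_resolvent H mu T0 ->
  0 < r -> exists2 T, is_resolvent H r%:C T &
    exists2 K : R, 0 <= K & forall f, rnorm (T f) <= K * rnorm f.
Proof.
move=> lH nH mu0 T0H r0.
(* This [a] bisects the angle between conj mu and the positive axis, so the half-plane Re (a z) > 0
   contains mu and all positive shifts. *)
pose a := Num.conj mu + (modulus mu)%:C.
have m0 : 0 < modulus mu.
  by rewrite modulus_gt0; apply: contraTneq mu0 => ->; rewrite /upper_half_plane /= ltxx.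
have ms : modulus mu ^+ 2 = complex.Re mu ^+ 2 + complex.Im mu ^+ 2.
  by case: (mu) => p q; rewrite /modulus /= sqr_sqrtr // addr_ge0 ?sqr_ge0.
have q0 : 0 < complex.Im mu by [].
have mp : 0 < complex.Re mu + modulus mu by nra.
have aE : complex.Re a = complex.Re mu + modulus mu by rewrite /a; case: (mu).
have aH : accretive dot a H by apply: nonnegative_accretive => //; rewrite aE ltW.
have a1 : 0 < complex.Re (a * mu).
  have -> : complex.Re (a * mu) = modulus mu * (complex.Re mu + modulus mu).
    rewrite mulrDr -expr2 ms /a; move: (modulus mu); case: (mu) => p q m /=; ring.
  by rewrite mulr_gt0.
have a2 : 0 < complex.Re (a * r%:C).
  have -> : complex.Re (a * r%:C) = complex.Re a * r by case: (a) => p q /=; ring.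
  by rewrite aE mulr_gt0.
have [T TH] := resolvent_exists Mhilbert lH aH T0H a1 a2.
exists T => //; eexists; last exact: (resolvent_bound Mhilbert aH TH a2).
by rewrite divr_ge0 ?modulus_ge0 // ltW.
Qed.

Definition bounded_resolvent_family Q (m : R[i] -> R[i]) (T : R[i] -> M -> M) :=
  forall z, cut_upper_plane z -> is_resolvent (Q z) (m z) (T z) /\
    exists2 K : R, 0 <= K & forall f, rnorm (T z f) <= K * rnorm f.

Lemma bounded_resolvent_family_exists Q (m : R[i] -> R[i]) :
  (forall z, cut_upper_plane z -> exists2 T, is_resolvent (Q z) (m z) T &
    exists2 K : R, 0 <= K & forall f, rnorm (T f) <= K * rnorm f) ->
  exists T, bounded_resolvent_family Q m T.
Proof.
move=> HT.
have /choice[T TP] : forall z, exists T, cut_upper_plane z -> is_resolvent (Q z) (m z) T /\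
    exists2 K : R, 0 <= K & forall f, rnorm (T f) <= K * rnorm f.
  move=> z; have [/HT[T T1 T2]|nz] := pselect (cut_upper_plane z); first by exists T.
  by exists id.
by exists T.
Qed.

Lemma moving_resolvent_exists Q (m : R[i] -> R[i]) : stieltjes_on_cut Q ->
  (forall z, upper_half_plane z -> upper_half_plane (m z)) ->
  (forall x, x < 0 -> exists2 r : R, 0 < r & m x%:C = r%:C) ->
  exists T, bounded_resolvent_family Q m T.
Proof.
move=> [Ql Qd Qn [mu [F mu0 [FQ _]]]] m_up m_neg.
apply: bounded_resolvent_family_exists => z Dz.
case: (Dz) => [uz|[x /= x0 xz]].
  exact: dissipative_resolvent (Ql _ Dz) (Qd _ uz) mu0 (FQ _ Dz) (m_up _ uz).
have [r r0 mr] := m_neg _ x0; rewrite -xz mr in Dz *.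
exact: nonnegative_resolvent (Ql _ Dz) (Qn _ x0) mu0 (FQ _ Dz) r0.
Qed.

Lemma resolvent_family_holomorphic Q m T f g : stieltjes_on_cut Q ->
  bounded_resolvent_family Q m T -> holomorphic_on_cut m ->
  holomorphic_on_cut (fun z => dot (T z f) g).
Proof.
move=> [Ql _ _ [mu [F mu0 [FQ Fd]]]] TQ hm z Dz; have [dm md] := hm z Dz.
apply: (@resolvent_matrix_element_diff _ _ dot Mhilbert _ Q mu F T m z dm) => //.
- exact: Fd.
- by move=> w /TQ[].
- by have [] := TQ z Dz.
Qed.

Lemma nonnegative_symmetric H h k : linear_relation H -> nonnegative dot H ->
  H h -> H k -> dot h.2 k.1 = dot h.1 k.2.
Proof.
case: h k => [u u'] [v v'] lH nH Hu Hv /=.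
have real (w w' : M) : H (w, w') -> complex.Im (dot w' w) = 0 by move=> /nH /ger0_Im.
have A := real _ _ (linear_relationD lH Hu Hv).
have B := real _ _ (linear_relationD lH Hu (linear_relationZ 'i lH Hv)).
move: A B; rewrite /= !(dotDl, dotDr, dotZl, dotZr).
have := real _ _ Hu; have := real _ _ Hv.
rewrite [dot u v']dotC; case: (dot u' u) (dot v' v) (dot u' v) (dot v' u) =>
  [p1 q1] [p2 q2] [p3 q3] [p4 q4] /= -> -> A B.
apply/eqP; rewrite eq_complex /=; apply/andP; split; apply/eqP; lra.
Qed.

(** A symmetric relation H with H + 1 onto is selfadjoint: for (k, k') in the adjoint, the element
    of H with the same k + k' must have first component k. *)
Lemma nonnegative_selfadjoint H mu T : linear_relation H -> nonnegative dot H ->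
  upper_half_plane mu -> is_resolvent H mu T -> nonneg_selfadjoint dot H.
Proof.
move=> lH nH mu0 TH; have [G GH _] := nonnegative_resolvent lH nH mu0 TH ltr01.
have /is_resolventP[G1 _] := GH.
split => //; split => //; apply/seteqP; split => [h Hh k Hk|[k k'] Hk].
  exact: (nonnegative_symmetric lH nH Hk Hh).
pose h := G (k + k'); have := G1 (k + k'); rewrite -/h scale1r => Hh.
have kh : k = h.
  apply/eqP; rewrite -subr_eq0; apply/eqP.
  apply: (dot_nondegenerate Mhilbert) => f.
  pose g := G f; have := G1 f; rewrite -/g scale1r => Hg.
  have E1 := Hk _ Hg; have E2 := nonnegative_symmetric lH nH Hg Hh.
  rewrite /= in E1 E2; rewrite dotC -[RHS]conjC0; congr (Num.conj _).
  move: E1 E2; rewrite !dotBl !dotBr !dotDr => E1 E2.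
  have -> : dot f k - dot f h = (dot f k - dot g k) - (dot f h - dot g h)
    + dot g k - dot g h by ring.
  by rewrite E1 E2; ring.
by move: Hh; rewrite -kh addrAC subrr add0r.
Qed.

Section monotonicity.
Variables (Q : R[i] -> set (M * M)).
Hypothesis QS : stieltjes_on_cut Q.

Lemma Qneg_linear x : x < 0 -> linear_relation (Q x%:C).
Proof. by case: QS => Ql _ _ _ x0; apply: Ql; exact: cut_upper_planeN. Qed.

Lemma Qneg_nonneg x : x < 0 -> nonnegative dot (Q x%:C).
Proof. by case: QS => _ _ Qn _; exact: Qn. Qed.

Lemma Qneg_resolvent x (r : R) : x < 0 -> 0 < r ->
  exists T, is_resolvent (Q x%:C) r%:C T.
Proof.
case: QS => Ql _ Qn [mu [F mu0 [FQ _]]] x0 r0.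
have Dx := cut_upper_planeN x0.
have [T TH _] := nonnegative_resolvent (Ql _ Dx) (Qn _ x0) mu0 (FQ _ Dx) r0.
by exists T.
Qed.

Lemma Qneg_selfadjoint x : x < 0 -> nonneg_selfadjoint dot (Q x%:C).
Proof.
case: QS => Ql _ Qn [mu [F mu0 [FQ _]]] x0.
have Dx := cut_upper_planeN x0.
exact: nonnegative_selfadjoint (Ql _ Dx) (Qn _ x0) mu0 (FQ _ Dx).
Qed.

Lemma nonneg_resolvent_form x (r : R) T f : x < 0 -> 0 <= r ->
  is_resolvent (Q x%:C) r%:C T -> 0 <= dot (T f) f.
Proof.
move=> x0 r0 /is_resolventP[T1 _]; have := Qneg_nonneg x0 (T1 f).
rewrite /= dotBl dotZl (dot_self Mhilbert) -rmorphM /= subr_ge0 => H.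
rewrite dotC conjE conj_ge0; apply: le_trans H.
by rewrite lecR mulr_ge0 // sqr_ge0.
Qed.

(** Both Q and m have nonnegative imaginary part above the axis, so the quadratic form of (Q + m)^-1
    has a nonpositive one there, and it is real on the axis. *)
Lemma moving_resolvent_monotone m T f x y : bounded_resolvent_family Q m T ->
  holomorphic_on_cut m ->
  (forall z, upper_half_plane z -> upper_half_plane (m z)) ->
  (forall x, x < 0 -> exists2 r : R, 0 < r & m x%:C = r%:C) ->
  x <= y -> y < 0 ->
  complex.Re (dot (T y%:C f) f) <= complex.Re (dot (T x%:C f) f).
Proof.
move=> TQ hm m_up m_neg xy y0.
pose phi z := dot (T z f) f.
have hphi : holomorphic_on_cut phi by exact: (resolvent_family_holomorphic f f QS TQ hm).
have phi_real s : s < 0 -> complex.Im (phi s%:C) = 0.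
  move=> s0; have [r r0 mr] := m_neg _ s0.
  have [TH _] := TQ _ (cut_upper_planeN s0); rewrite mr in TH.
  by apply: ger0_Im; exact: nonneg_resolvent_form (ltW r0) TH.
have phi_up z : upper_half_plane z -> complex.Im (phi z) <= 0.
  case: QS => _ Qd _ _ uz; have [/is_resolventP[T1 _] _] := TQ z (or_introl uz).
  have := Qd _ uz _ (T1 f); rewrite /= dotBl dotZl (dot_self Mhilbert) /phi.
  rewrite [dot f _]dotC; have := m_up _ uz; rewrite /upper_half_plane /=.
  case: (m z) (dot (T z f) f) => [m1 m2] [p q] /= m0.
  have : 0 <= m2 * rnorm (T z f) ^+ 2 by rewrite mulr_ge0 ?sqr_ge0 // ltW.
  by lra.
apply: (@nonincreasing_of_derivative R (fun s => complex.Re (phi s%:C)) x y xy) => s /andP[xs sy].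
have s0 : s < 0 := le_lt_trans sy y0.
have [k Hk] := hphi _ (cut_upper_planeN s0).
exists (complex.Re k) => [|e e0].
  apply/ler_addgt0Pl => e e0; rewrite addr0.
  (* Approach s vertically: Im phi(s + i t) equals t Re k up to e t, and it is nonpositive. *)
  have [r r0 Hr] := Hk _ e0; pose t := r / 2.
  have t0 : 0 < t by rewrite divr_gt0.
  have ut : upper_half_plane (s +i* t) by [].
  have E : (s +i* t) - s%:C = 'i * t%:C.
    by apply/eqP; rewrite eq_complex /=; apply/andP; split; apply/eqP; ring.
  have mE : modulus ((s +i* t) - s%:C) = t.
    by rewrite E modulusM modulus_real gtr0_norm // /modulus /= expr0n expr1n add0r sqrtr1 mul1r.
  have := Hr _ (or_introl ut); rewrite mE => /(_ ltac:(rewrite /t; lra)) H.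
  have {H} := le_trans (Im_le_modulus _) H.
  rewrite E; have := phi_up _ ut; have := phi_real _ s0.
  case: (phi (s +i* t)) (phi s%:C) k {Hk Hr} => [p q] [p' q'] [k1 k2] /= -> q0.
  rewrite ler_norml => /andP[H _]; rewrite -(ler_pM2r t0); lra.
have [r r0 Hr] := Hk _ e0; exists r => // z /andP[xz zy] zs.
have z0 : z < 0 := le_lt_trans zy y0.
have mE : modulus (z%:C - s%:C) = `|z - s| by rewrite -rmorphB modulus_real.
have := Hr _ (cut_upper_planeN z0); rewrite mE => /(_ zs) H.
apply: le_trans H; apply: le_trans (Re_le_modulus _); rewrite le_eqVlt; apply/orP; left; apply/eqP.
congr `|_|; case: (phi z%:C) (phi s%:C) k {Hk Hr} => [p q] [p' q'] [k1 k2] /=; ring.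
Qed.

End monotonicity.

End stieltjes_on_cut.

(** * Homogeneous Stieltjes families *)

Section homogeneous_on_cut.
Context {R : realType} {M : completeNormedModType R[i]}.
Variable dot : {dot M for Num.conj}.
Hypothesis Mhilbert : hilbert_norm dot.
Implicit Types (f g u v : M) (z w mu : R[i]) (x y : R) (H : set (M * M)).

Lemma linear_operatorZ (T : M -> M) (a : R[i]) f : linear T -> T (a *: f) = a *: T f.
Proof.
move=> lT; have T0 : T 0 = 0 by have := lT (-1) 0 0; rewrite scaler0 addr0 scaleN1r addNr.
by have := lT a f 0; rewrite !addr0 T0 addr0.
Qed.

Lemma modulus1 : modulus (1 : R[i]) = 1.
Proof. exact: Normc.normc1. Qed.

Lemma real_Ninv (d s : R) : d%:C * - (s%:C)^-1 = (d / - s)%:C :> R[i].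
Proof. by rewrite invrN !mulrN rmorphN rmorphM fmorphV. Qed.

Lemma rel_scaleK (a : R[i]) H : a != 0 -> rel_scale a^-1 (rel_scale a H) = H.
Proof.
move=> a0; apply/seteqP; split=> [_ [_ [h Hh <-] <-]|[u v] Huv] /=.
  by rewrite scalerA mulVf // scale1r; case: h Hh.
exists (u, a *: v); first by exists (u, v).
by rewrite /= scalerA mulVf // scale1r.
Qed.

Lemma resolvent_scale H (s nu : R[i]) T : s != 0 -> is_resolvent H nu T ->
  is_resolvent (rel_scale s H) (s * nu) (fun f => T (s^-1 *: f)).
Proof.
move=> s0 /is_resolventP[T1 T2]; apply/is_resolventP; split=> [f|_ [h Hh <-]] /=.
  exists (T (s^-1 *: f), s^-1 *: f - nu *: T (s^-1 *: f)); first exact: T1.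
  by congr (_, _); rewrite /= scalerBr !scalerA mulfV // scale1r.
by rewrite scalerDr !scalerA mulrA mulVf // mul1r scale1r; exact: T2.
Qed.

Lemma cut_upper_plane_neq0 z : cut_upper_plane z -> z != 0.
Proof.
case=> [uz|[x /= x0 <-]].
  by apply: contraTneq uz => ->; rewrite /upper_half_plane /= ltxx.
by apply: contraTneq x0 => -[->]; rewrite ltxx.
Qed.

Lemma cut_upper_plane_dilation (c : R) z : 0 < c -> cut_upper_plane z ->
  cut_upper_plane (c%:C * z).
Proof.
move=> c0 [|[x /= x0 <-]].
  case: z => p q; rewrite /upper_half_plane /= => q0; left.
  by rewrite /upper_half_plane /= mul0r addr0 mulr_gt0.
by right; exists (c * x); rewrite ?rmorphM //= pmulr_rlt0.
Qed.

Lemma upper_Ninv z : upper_half_plane z -> upper_half_plane (- z^-1).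
Proof.
case: z => p q; rewrite /upper_half_plane /= => q0.
by rewrite opprK divr_gt0 // ltr_wpDl ?sqr_ge0 // exprn_gt0.
Qed.

Lemma holomorphic_on_cut_Ninv (a d : R[i]) : holomorphic_on_cut (fun z => a + d * - z^-1).
Proof.
move=> z /cut_upper_plane_neq0 z0; eexists; apply: has_cderivD.
  exact: has_cderiv_cst.
apply: has_cderivZ; rewrite (_ : (fun w => - w^-1) = fun w => -1 * w^-1).
  by apply: has_cderivZ; exact: has_cderivV.
by apply/funext => w; rewrite mulN1r.
Qed.

Section one_family.
Variable Q : R[i] -> set (M * M).
Hypothesis QS : stieltjes_on_cut dot Q.

(** The constant shift 1 does not map the upper half-plane into itself, so
    [moving_resolvent_monotone] does not apply to it. It is applied to m z = 1 - d / z, which does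
    so for d > 0; on the axis this perturbs the shift by d / - s, and d is then made small. *)
Lemma real_resolvent_monotone x y G G' f : x <= y -> y < 0 ->
  is_resolvent (Q x%:C) 1 G -> is_resolvent (Q y%:C) 1 G' ->
  complex.Re (dot (G' f) f) <= complex.Re (dot (G f) f).
Proof.
move=> xy y0 GH G'H; have x0 := le_lt_trans xy y0.
have near s T T' (d : R) : s < 0 -> 0 < d -> is_resolvent (Q s%:C) 1 T ->
    is_resolvent (Q s%:C) (1 + d%:C * - (s%:C)^-1) T' ->
    `|complex.Re (dot (T f) f) - complex.Re (dot (T' f) f)| <= d / - s * rnorm f ^+ 2.
  move=> s0 d0 TH T'H; pose r := d / - s.
  have r0 : 0 < r by rewrite divr_gt0 // oppr_gt0.
  have rE : 1 + d%:C * - (s%:C)^-1 = (1 + r)%:C.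
    by rewrite real_Ninv -rmorphD.
  rewrite rE in T'H; have /is_resolventP[T1 T2] := TH.
  have /is_resolventP[T1' _] := T'H; pose u := T' f.
  have lT : linear T := resolvent_linear Mhilbert (Qneg_linear QS s0) TH.
  have TuE : T (f - r%:C *: u) = u.
    have := T2 _ (T1' f); rewrite /= -/u scale1r => {2}<-; congr T.
    by apply: (dot_inj Mhilbert) => w; rewrite !dotE rmorphD /=; ring.
  have diff : T f - u = r%:C *: T u.
    have := lT (- r%:C) u f; rewrite [_ + f]addrC scaleNr TuE scaleNr => E.
    by rewrite [X in _ - X]E opprD opprK addrCA subrr addr0.
  have a1 : accretive dot 1 (Q s%:C).
    by apply: nonnegative_accretive; [exact: ler01|exact: Qneg_nonneg].
  have uf : rnorm u <= rnorm f.
    have H : (1 + r) * rnorm u <= 1 * rnorm f.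
      by have := accretive_bound Mhilbert a1 (T1' f); rewrite [1 * _]mul1r modulus1.
    rewrite mul1r in H; apply: le_trans H; rewrite ler_peMl ?rnorm_ge0 //; lra.
  have Tu : rnorm (T u) <= rnorm f.
    apply: le_trans uf.
    have : 1 * rnorm (T u) <= 1 * rnorm u.
      by have := accretive_bound Mhilbert a1 (T1 u); rewrite [1 * 1]mul1r modulus1.
    by rewrite !mul1r.
  rewrite (_ : _ - _ = complex.Re (dot (T f - u) f)); last first.
    by rewrite dotBl; case: (dot _ _) (dot u f) => p q [].
  apply: le_trans (Re_dot_bound Mhilbert _ _) _.
  rewrite diff rnormZ modulus_real gtr0_norm // -mulrA ler_wpM2l ?(ltW r0) //.
  by rewrite expr2 ler_wpM2r ?rnorm_ge0.
rewrite -subr_le0; apply/ler_addgt0Pl => e e0; rewrite addr0.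
pose B := ((- x)^-1 + (- y)^-1) * rnorm f ^+ 2.
have B0 : 0 <= B by rewrite mulr_ge0 ?sqr_ge0 // addr_ge0 // invr_ge0 oppr_ge0 ltW.
have B1 : 0 < B + 1 by rewrite ltr_wpDl.
pose d := e / (B + 1); have d0 : 0 < d by rewrite divr_gt0.
pose m z : R[i] := 1 + d%:C * - z^-1.
have m_up z : upper_half_plane z -> upper_half_plane (m z).
  move=> /upper_Ninv; rewrite /m; case: (- z^-1) => p q; rewrite /upper_half_plane /= => q0.
  by rewrite mul0r addr0 add0r mulr_gt0.
have m_neg s : s < 0 -> exists2 r : R, 0 < r & m s%:C = r%:C.
  move=> s0; exists (1 + d / - s).
    by rewrite addr_gt0 // divr_gt0 // oppr_gt0.
  by rewrite /m real_Ninv -rmorphD.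
have hm : holomorphic_on_cut m by exact: holomorphic_on_cut_Ninv.
have [T TQ] := moving_resolvent_exists Mhilbert QS m_up m_neg.
have mono := moving_resolvent_monotone Mhilbert QS f TQ hm m_up m_neg xy y0.
have nx := near x G _ d x0 d0 GH (TQ _ (cut_upper_planeN x0)).1.
have ny := near y G' _ d y0 d0 G'H (TQ _ (cut_upper_planeN y0)).1.
have dB : d * B <= e.
  by rewrite /d mulrAC ler_pdivrMr // ler_wpM2l ?(ltW e0) // lerDl.
have : d / - x * rnorm f ^+ 2 + d / - y * rnorm f ^+ 2 = d * B by rewrite /B; ring.
by move: nx ny; rewrite !ler_norml => /andP[? ?] /andP[? ?]; lra.
Qed.

Lemma nonneg_resolvent_real x G f : x < 0 -> is_resolvent (Q x%:C) 1 G ->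
  complex.Im (dot (G f) f) = 0.
Proof. by move=> x0 GH; apply: ger0_Im; exact: (nonneg_resolvent_form Mhilbert QS f x0 ler01 GH). Qed.

Variable c : R.
Hypothesis c_gt1 : 1 < c.

Let c_gt0 : 0 < c. Proof. exact: lt_trans ltr01 c_gt1. Qed.

(** Monotonicity concerns quadratic forms only. Each form is constant on the axis, and polarization
    turns this into equality of the resolvents. *)
Lemma constant_on_axis : (forall x, x < 0 -> Q (c * x)%:C = Q x%:C) ->
  forall x, x < 0 -> Q x%:C = Q (-1)%:C.
Proof.
move=> Qc x x0.
have /choice[G GP] : forall s, exists G, s < 0 -> is_resolvent (Q s%:C) 1 G.
  move=> s; have [s0|_] := ltP s 0; last by exists id.
  by have [G GH] := Qneg_resolvent Mhilbert QS s0 ltr01; exists G.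
have GcE s : s < 0 -> G (c * s) = G s.
  move=> s0; have cs0 : c * s < 0 by rewrite pmulr_rlt0.
  by apply: (@resolvent_unique _ _ (Q s%:C) 1); [rewrite -Qc //; exact: GP|exact: GP].
have N1 : -1 < 0 :> R by rewrite oppr_lt0.
have GE : G x = G (-1).
  have l1 := resolvent_linear Mhilbert (Qneg_linear QS x0) (GP _ x0).
  have l2 := resolvent_linear Mhilbert (Qneg_linear QS N1) (GP _ N1).
  apply/funext => f; apply/eqP; rewrite -subr_eq0; apply/eqP.
  apply: (@polarization _ _ dot Mhilbert (fun f => G x f - G (-1) f)) => [a u v|g].
    by rewrite l1 l2 scalerBr opprD addrACA.
  rewrite dotBl; apply/eqP; rewrite subr_eq0 eq_complex.
  rewrite (nonneg_resolvent_real _ x0 (GP _ x0)) (nonneg_resolvent_real _ N1 (GP _ N1)) eqxx andbT.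
  apply/eqP; apply: (@constant_of_dilation R (fun s => complex.Re (dot (G s g) g)) c) => //.
    move=> s t st t0; apply: (real_resolvent_monotone _ st t0); apply: GP => //.
    exact: le_lt_trans st t0.
  by move=> s s0 /=; rewrite GcE.
by apply: (resolvent_relation_unique (GP _ x0)); rewrite GE; exact: GP.
Qed.

Theorem invariant_on_cut : (forall z, cut_upper_plane z -> Q (c%:C * z) = Q z) ->
  forall z, cut_upper_plane z -> Q z = Q (-1)%:C.
Proof.
move=> Qc z Dz.
have N1 : -1 < 0 :> R by rewrite oppr_lt0.
have axis : forall x, x < 0 -> Q x%:C = Q (-1)%:C.
  apply: constant_on_axis => x x0; rewrite rmorphM /=; apply: Qc.
  exact: cut_upper_planeN.
case: (QS) => Ql Qd Qn [mu [F mu0 [FQ Fd]]].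
have FB : bounded_resolvent_family Q (fun=> mu) F.
  move=> w Dw; split; first exact: FQ.
  have dQ : dissipative dot (Q w).
    case: Dw => [uw|[x /= x0 <-]]; first exact: Qd.
    by move=> h /(Qn _ x0) /ger0_Im ->.
  have [T TH] := dissipative_resolvent Mhilbert (Ql _ Dw) dQ mu0 (FQ _ Dw) mu0.
  by rewrite (resolvent_unique TH (FQ _ Dw)).
have FE : F z = F (-1)%:C.
  apply/funext => f; apply: (dot_inj Mhilbert) => g.
  apply/eqP; rewrite -subr_eq0; apply/eqP.
  apply: (dilation_invariant_unique c_gt1
    (f := fun w => dot (F w f) g - dot (F (-1)%:C f) g)) => //.
  - move=> w Dw; have hcst : holomorphic_on_cut (fun=> mu).
      by move=> ? _; exists 0; exact: has_cderiv_cst.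
    have [k Hk] := resolvent_family_holomorphic Mhilbert f g QS FB hcst Dw.
    by exists (k + 0); apply: has_cderivD Hk _; exact: has_cderiv_cst.
  - move=> w Dw; suff -> : F (c%:C * w) = F w by [].
    apply: (@resolvent_unique _ _ (Q w) mu); last exact: FQ.
    by rewrite -Qc //; apply: FQ; exact: cut_upper_plane_dilation.
  - move=> x x0; rewrite (_ : F x%:C = F (-1)%:C) ?subrr //.
    apply: (@resolvent_unique _ _ (Q (-1)%:C) mu); last by apply: FQ; exact: cut_upper_planeN.
    by rewrite -(axis _ x0); apply: FQ; exact: cut_upper_planeN.
by apply: (resolvent_relation_unique (FQ _ Dz)); rewrite FE; apply: FQ; exact: cut_upper_planeN.
Qed.

End one_family.
End homogeneous_on_cut.

Section homogeneous_families.
Context {R : realType} {M : completeNormedModType R[i]}.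
Variable dot : {dot M for Num.conj}.
Hypothesis Mhilbert : hilbert_norm dot.
Implicit Types (f g u v : M) (z w mu : R[i]) (x y : R) (H : set (M * M)).

(** * Degree -1 *)

Section degree_minus_one.
Variable Q : R[i] -> set (M * M).
Hypothesis QS : stieltjes_on_cut dot Q.
Variable c : R.
Hypothesis c_gt1 : 1 < c.

Let c_gt0 : 0 < c. Proof. exact: lt_trans ltr01 c_gt1. Qed.
Let cC_neq0 : c%:C != 0 :> R[i].
Proof. by apply/eqP => -[] /eqP; rewrite gt_eqF. Qed.

(* With T z := (Q z - 1/z)^-1, the operator - 1/z - T z / z^2 = (Q^-1 - z)^-1
   is a bounded Stieltjes function with the same homogeneity as Q; p below is z
   times its quadratic form. *)
Theorem homogeneous_degree_minus_one :
  (forall z, cut_upper_plane z -> Q (c%:C * z) = rel_scale (c%:C)^-1 (Q z)) ->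
  forall z, cut_upper_plane z -> Q z = rel_scale (- z^-1) (Q (-1)%:C).
Proof.
move=> Qc z Dz.
have N1 : -1 < 0 :> R by rewrite oppr_lt0.
have DN1 := cut_upper_planeN N1.
(* This shift has the degree of Q, whence T (c w) = c T w; it maps the upper half-plane into itself
   and the negative axis to positive numbers. *)
pose m w : R[i] := 0 + 1 * - w^-1.
have mE w : m w = - w^-1 by rewrite /m add0r mul1r.
have hm : holomorphic_on_cut m by exact: holomorphic_on_cut_Ninv.
have m_up w : upper_half_plane w -> upper_half_plane (m w).
  by rewrite mE; exact: upper_Ninv.
have m_neg s : s < 0 -> exists2 r : R, 0 < r & m s%:C = r%:C.
  move=> s0; exists (1 / - s); first by rewrite divr_gt0 // oppr_gt0.
  by rewrite -real_Ninv mE mul1r.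
have [T TQ] := moving_resolvent_exists Mhilbert QS m_up m_neg.
have lT w : cut_upper_plane w -> linear (T w).
  case: QS => Ql _ _ _ Dw; exact: (resolvent_linear Mhilbert (Ql _ Dw) (TQ _ Dw).1).
pose p f w := - dot f f + - w^-1 * dot (T w f) f.
have Tc w f : cut_upper_plane w -> T (c%:C * w) f = c%:C *: T w f.
  move=> Dw; have Dcw := cut_upper_plane_dilation c_gt0 Dw.
  have ci0 : (c%:C)^-1 != 0 :> R[i] by rewrite invr_neq0.
  have := resolvent_scale ci0 (TQ _ Dw).1; rewrite -Qc // invrK => H.
  have [] := TQ _ Dcw; rewrite mE.
  have -> : - (c%:C * w)^-1 = (c%:C)^-1 * m w by rewrite mE invfM mulrN.
  move=> H' _; rewrite (resolvent_unique H' H).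
  exact: linear_operatorZ (lT _ Dw).
(* Written with a pair (u, h) of Q w, the form conj w * p is - conj w |h|^2 + (h, u). Above the axis
   both terms have nonnegative imaginary part, and on the axis both are real. *)
have pE f w : cut_upper_plane w ->
    exists h : M * M, Q w h /\ w^* * p f w = - w^* * dot h.2 h.2 + dot h.2 h.1
     /\ w * p f w = - w * dot h.2 h.2 + w / w^* * dot h.2 h.1.
  move=> Dw; have [/is_resolventP[T1 _] _] := TQ _ Dw.
  have w0 := cut_upper_plane_neq0 Dw.
  have wc0 : w^* != 0 by rewrite conjc_eq0.
  exists (T w f, f - m w *: T w f); split; first exact: T1.
  set u := T w f; set h := f - m w *: u.
  have fE : f = h + m w *: u by rewrite /h subrK.
  have -> : p f w = - dot h h + - (w^*)^-1 * - dot h u.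
    rewrite /p -/u; clearbody h; clearbody u; rewrite fE.
    rewrite !(dotDl, dotDr, dotZl, dotZr) mE.
    have -> : Num.conj (- w^-1) = - (w^*)^-1 by rewrite rmorphN fmorphV.
    by field; rewrite w0 wc0.
  by split; field; rewrite ?w0 wc0.
have p_const f : forall w, cut_upper_plane w -> p f w = p f (-1)%:C.
  apply: (dilation_invariant_constant c_gt1 (f := p f)).
  - move=> w Dw; have [k Hk] := resolvent_family_holomorphic Mhilbert f f QS TQ hm Dw.
    have [k' Hk'] := hm w Dw; eexists; apply: has_cderivD; first exact: has_cderiv_cst.
    rewrite (_ : (fun w => - w^-1 * _) = fun w => m w * dot (T w f) f).
      exact: has_cderivM Hk' Hk.
    by apply/funext => v; rewrite mE.
  - move=> w Dw; have w0 := cut_upper_plane_neq0 Dw.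
    by rewrite /p Tc // dotZl; congr (_ + _); field; rewrite w0 cC_neq0.
  - move=> x x0; have Dx := cut_upper_planeN x0.
    have [[u v] [Huv [E _]]] := pE f _ Dx.
    have := Qneg_nonneg QS x0 Huv; move=> /ger0_Im /= v0.
    move: E; rewrite !conj_real /= (dot_self Mhilbert).
    move/(congr1 (@complex.Im R)); move: v0; case: (p f x%:C) (dot v u) => p1 p2 [q1 q2] /= ->.
    rewrite !(mul0r, mulr0, addr0, subr0, oppr0) => /eqP.
    by rewrite mulf_eq0 (lt_eqF x0) /= => /eqP.
  - move=> w uw; have [[u v] [Huv [-> _]]] := pE f w (or_introl uw).
    case: QS => _ Qd _ _; have := Qd _ uw _ Huv; rewrite /= (dot_self Mhilbert).
    move: uw; rewrite /upper_half_plane; case: w {Huv} => a b /= b0; case: (dot v u) => q1 q2 /= q0.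
    by rewrite opprK mulr0 add0r addr_ge0 // mulr_ge0 ?sqr_ge0 // ltW.
have z0 := cut_upper_plane_neq0 Dz.
have TE f : T z f = - z *: T (-1)%:C f.
  have : - z^-1 *: T z f - T (-1)%:C f = 0.
    apply: (@polarization _ _ dot Mhilbert (fun f => - z^-1 *: T z f - T (-1)%:C f)).
      move=> a u v; rewrite (lT _ Dz) (lT _ DN1).
      by apply: (dot_inj Mhilbert) => g; rewrite !dotE; ring.
    move=> g; have := p_const g z Dz; rewrite /p => /addrI.
    rewrite dotBl dotZl => ->; rewrite (_ : - ((-1)%:C)^-1 = 1); last first.
      by rewrite rmorphN1 invrN1 opprK.
    by rewrite mul1r subrr.
  move/eqP; rewrite subr_eq0 => /eqP <-; rewrite scalerA mulrNN mulfV // scale1r //.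
apply: (resolvent_relation_unique (TQ _ Dz).1); rewrite mE.
have zi0 : - z^-1 != 0 by rewrite oppr_eq0 invr_eq0.
have := resolvent_scale zi0 (TQ _ DN1).1.
have -> : m (-1)%:C = 1 by rewrite mE rmorphN1 invrN1 opprK.
rewrite mulr1; congr is_resolvent; apply/funext => f.
by rewrite TE invrN invrK (linear_operatorZ _ _ (lT _ DN1)).
Qed.

End degree_minus_one.

(** * Degree 1 *)

Section degree_one.
Variable Q : R[i] -> set (M * M).
Hypothesis QS : stieltjes_on_cut dot Q.
Variable c : R.
Hypothesis c_gt1 : 1 < c.

Let c_gt0 : 0 < c. Proof. exact: lt_trans ltr01 c_gt1. Qed.
Let cC_neq0 : c%:C != 0 :> R[i].
Proof. by apply/eqP => -[] /eqP; rewrite gt_eqF. Qed.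

(** The relation is the product of the range and the kernel of P, so scaling second components
    preserves it. *)
Lemma rel_scale_projection (P : M -> M) (s : R[i]) : linear P ->
  (forall f, P (P f) = P f) -> s != 0 ->
  rel_scale s (projection_relation P) = projection_relation P.
Proof.
move=> lP PP s0.
have step (t : R[i]) : rel_scale t (projection_relation P) `<=` projection_relation P.
  move=> _ [_ [f _ <-] <-] /=; exists (P f + t *: (f - P f)) => //.
  have -> : P (P f + t *: (f - P f)) = P f.
    rewrite [P f + _]addrC lP -[f - _]addrC -scaleN1r lP scaleN1r !PP addNr.
    by rewrite scaler0 add0r.
  by congr (_, _); rewrite addrAC subrr add0r.
apply/seteqP; split; first exact: step.
move=> h; rewrite -{1}(rel_scaleK (projection_relation P) (invr_neq0 s0)) invrK.
by move=> -[k /step Hk <-]; exists k.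
Qed.

(* c A <= A forces the spectrum of A into {0, oo}: with G = (A + 1)^-1 and
   phi = k + c k', (k, k') in A, the number (k', G phi) is a sum of nonnegative
   terms, one of them |G k'|^2. *)
Lemma projection_of_order H G K : linear_relation H -> nonnegative dot H ->
  is_resolvent H 1 G -> is_resolvent (rel_scale c%:C H) 1 K ->
  (forall f, complex.Re (dot (G f) f) <= complex.Re (dot (K f) f)) ->
  orthogonal_projection dot G /\ H = projection_relation G.
Proof.
move=> lH nH GH KH GK.
have lG := resolvent_linear Mhilbert lH GH.
have GD u v : G (u + v) = G u + G v by have := lG 1 u v; rewrite !scale1r.
have /is_resolventP[G1 G2] := GH; have /is_resolventP[K1 _] := KH.
have parts f : H (G f, 0) /\ H (0, f - G f).
  pose k := K f; pose k' := (c%:C)^-1 *: (f - k).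
  have ck' : c%:C *: k' = f - k by rewrite scalerA mulfV // scale1r.
  have Hk : H (k, k').
    have [[u v] Huv [uk vk]] := K1 f; rewrite -/k scale1r in uk vk.
    by rewrite /k' -vk -uk scalerA mulVf // scale1r.
  have fE : f = k + c%:C *: k' by rewrite ck' addrC subrK.
  pose h := G f; have Hh : H (h, f - h) by have := G1 f; rewrite -/h scale1r.
  pose u := G k; pose v := k - u.
  have Huv : H (u, v) by have := G1 k; rewrite -/u scale1r.
  have Hv : H (v, k' - v) := linear_relationB lH Hk Huv.
  have Gk' : G k' = v by have := G2 _ Hv; rewrite /= scale1r subrK.
  have hE : h = u + c%:C *: v by rewrite /h fE GD (linear_operatorZ _ _ lG) Gk'.
  have S1 := nonnegative_symmetric lH nH Hk Hh; rewrite /= in S1.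
  have S2 := nonnegative_symmetric lH nH Huv Hv; rewrite /= in S2.
  have P1 := nH _ Huv; have P2 := nH _ Hv; rewrite /= in P1 P2.
  (* By symmetry (f, h) - (k, f) = (c - 1) (k', h), so the assumed order of the forms of G and K is
     exactly this sign. *)
  have kh : complex.Re (dot k' h) <= 0.
    have c1 : 0 < c - 1 by rewrite subr_gt0.
    rewrite -(ler_pM2l c1) mulr0.
    have E : dot f h - dot k f = (c - 1)%:C * dot k' h.
      by rewrite rmorphB rmorph1 {1}fE dotDl dotZl S1 dotBr; ring.
    have := GK f; rewrite -/h -/k [dot h f]dotC ReC_conj.
    have -> : complex.Re (dot f h) = complex.Re (dot k f) + (c - 1) * complex.Re (dot k' h).
      have -> : dot f h = dot k f + (c - 1)%:C * dot k' h by rewrite -E addrC subrK.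
      by case: (dot k f) (dot k' h) => p q [p' q'] /=; ring.
    lra.
  have v0 : v = 0.
    apply: rnorm_le0; have n0 := rnorm_ge0 v.
    suff : rnorm v ^+ 2 <= 0 by nra.
    have {}S2 : dot (k' - v) u = (rnorm v ^+ 2)%:C.
      by rewrite dotC -S2 dot_self // conj_real.
    move: kh; have -> : dot k' h = dot v u + c%:C * dot v v + (dot (k' - v) u + c%:C * dot (k' - v) v).
      by rewrite hE !(dotBl, dotDr, dotZr) conj_real; ring.
    rewrite S2 dot_self //; move: P1 P2; rewrite !lecE /= => /andP[_ P1] /andP[_ P2].
    case: (dot v u) (dot (k' - v) v) P1 P2 => [p q] [p' q'] /= P1 P2.
    have : 0 <= c * p' by rewrite mulr_ge0 // ltW.
    have : 0 <= c * rnorm v ^+ 2 by rewrite mulr_ge0 ?sqr_ge0 // ltW.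
    rewrite !mul0r !subr0; lra.
  (* With v = 0 the pairs (u, v) and (v, k' - v) become (k, 0) and (0, k'): H splits into a zero
     part and a purely multivalued part. *)
  have ku : k = u by apply/eqP; rewrite -subr_eq0 -/v v0.
  have hk : h = k by rewrite hE v0 scaler0 addr0 ku.
  rewrite -/h hk; split; first by rewrite ku -v0.
  have -> : (0, f - k) = c%:C *: (v, k' - v).
    by apply: injective_projections; rewrite /= v0 ?scaler0 ?subr0.
  exact: linear_relationZ.
have GG f : G (G f) = G f.
  by have := G2 _ (parts f).1; rewrite /= add0r scale1r.
have Gsym f g : dot (G f) g = dot f (G g).
  have := nonnegative_symmetric lH nH (G1 f) (G1 g); rewrite /= !scale1r !dotBl !dotBr.
  by move/addIr.
split.
  split => //; split => //; exists 1 => f.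
  have a1 : accretive dot 1 H by apply: nonnegative_accretive => //; exact: ler01.
  have := accretive_bound Mhilbert a1 (G1 f); rewrite [1 * 1]mul1r modulus1 mul1r => H1.
  by rewrite !rnormE mul1r lecR; apply: le_trans H1; rewrite mul1r.
apply/seteqP; split=> [[u v] Huv|_ [f _ <-]].
  have := G2 _ Huv; rewrite /= scale1r => Guv; exists (v + u) => //.
  by rewrite Guv addrK.
by have := G1 f; rewrite scale1r.
Qed.

Lemma projection_resolvent (P : M -> M) (s : R[i]) : orthogonal_projection dot P -> s != 0 ->
  is_resolvent (projection_relation P) s (fun f => s^-1 *: P f).
Proof.
move=> [[lP _] PP _] s0.
have P1 : is_resolvent (projection_relation P) 1 P.
  apply/is_resolventP; split=> [f|_ [f _ <-]] /=; first by exists f; rewrite ?scale1r.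
  by rewrite scale1r subrK.
have := resolvent_scale s0 P1; rewrite rel_scale_projection // mulr1.
by congr is_resolvent; apply/funext => f; rewrite (linear_operatorZ _ _ lP).
Qed.

Theorem homogeneous_degree_one :
  (forall z, cut_upper_plane z -> Q (c%:C * z) = rel_scale c%:C (Q z)) ->
  exists2 P, orthogonal_projection dot P &
    forall z, cut_upper_plane z -> Q z = projection_relation P.
Proof.
move=> Qc.
have N1 : -1 < 0 :> R by rewrite oppr_lt0.
have proj x : x < 0 -> exists2 P, orthogonal_projection dot P & Q x%:C = projection_relation P.
  move=> x0; have cx0 : c * x < 0 by rewrite pmulr_rlt0.
  have [G GH] := Qneg_resolvent Mhilbert QS x0 ltr01.
  have [K KH] := Qneg_resolvent Mhilbert QS cx0 ltr01.
  have [] := @projection_of_order (Q x%:C) G K (Qneg_linear QS x0) (Qneg_nonneg QS x0) GH.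
  - by rewrite -Qc -?rmorphM //; exact: cut_upper_planeN.
  - move=> f; apply: (real_resolvent_monotone Mhilbert QS f _ x0 KH GH).
    by rewrite ger_nMl // ltW.
  by exists G.
have [P Pproj QP] := proj _ N1; exists P => //.
have axis x : x < 0 -> Q x%:C = projection_relation P.
  rewrite -QP; apply: (constant_on_axis Mhilbert QS c_gt1) => y y0.
  rewrite rmorphM Qc; last exact: cut_upper_planeN.
  have [P' [[lP' _] PP' _] ->] := proj _ y0.
  exact: rel_scale_projection.
(* The shift z has the degree of Q but is negative on the axis, where nonnegativity of Q gives no
   resolvent. There Q is already known to be a projection relation, whose resolvent is P / z. *)
have [T TQ] : exists T, bounded_resolvent_family Q id T.
  apply: bounded_resolvent_family_exists => z Dz.
  case: (QS) => Ql Qd _ [mu [F mu0 [FQ _]]].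
  case: (Dz) => [uz|[x /= x0 xz]].
    exact: (dissipative_resolvent Mhilbert (Ql _ Dz) (Qd _ uz) mu0 (FQ _ Dz) uz).
  have z0 := cut_upper_plane_neq0 Dz.
  have QzP : Q z = projection_relation P by rewrite -xz axis.
  exists (fun f => z^-1 *: P f); first by rewrite QzP; exact: projection_resolvent.
  case: Pproj => /bounded_operator_rnorm[K K0 PK] _ _.
  exists (modulus z^-1 * K); first by rewrite mulr_ge0 ?modulus_ge0.
  by move=> f; rewrite rnormZ -mulrA ler_wpM2l ?modulus_ge0.
have lT w : cut_upper_plane w -> linear (T w).
  by case: QS => Ql _ _ _ Dw; exact: (resolvent_linear Mhilbert (Ql _ Dw) (TQ _ Dw).1).
have hid : holomorphic_on_cut (id : R[i] -> R[i]).
  by move=> w _; exists 1; exact: has_cderiv_id.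
move=> z Dz; have z0 := cut_upper_plane_neq0 Dz.
suff TE : T z = fun f => z^-1 *: P f.
  apply: (resolvent_relation_unique (TQ _ Dz).1); rewrite TE.
  exact: projection_resolvent.
apply/funext => f; apply: (dot_inj Mhilbert) => g.
have : z * dot (T z f) g - dot (P f) g = 0.
  apply: (dilation_invariant_unique c_gt1
    (f := fun w => w * dot (T w f) g - dot (P f) g)) => //.
  - move=> w Dw; have [k Hk] := resolvent_family_holomorphic Mhilbert f g QS TQ hid Dw.
    eexists; apply: has_cderivD; last exact: has_cderiv_cst.
    exact: has_cderivM (has_cderiv_id _ _) Hk.
  - move=> w Dw; have Dcw := cut_upper_plane_dilation c_gt0 Dw.
    have := resolvent_scale cC_neq0 (TQ _ Dw).1; rewrite -Qc // => Hc.
    rewrite (resolvent_unique (TQ _ Dcw).1 Hc) (linear_operatorZ _ _ (lT _ Dw)) dotZl.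
    by congr (_ - _); field.
  - move=> x x0; have Dx := cut_upper_planeN x0; have x0' := cut_upper_plane_neq0 Dx.
    have [TH _] := TQ _ Dx; rewrite (axis _ x0) in TH.
    rewrite (resolvent_unique TH (projection_resolvent Pproj x0')) dotZl mulrA mulfV //.
    by rewrite mul1r subrr.
move/eqP; rewrite subr_eq0 => /eqP E.
by rewrite dotZl -E mulrA mulVf // mul1r.
Qed.

End degree_one.
End homogeneous_families.

(** * The slit plane and inverse families *)

Section families.
Context {R : realType} {M : completeNormedModType R[i]}.
Variable dot : {dot M for Num.conj}.
Hypothesis Mhilbert : hilbert_norm dot.
Implicit Types (f g u v : M) (z w mu : R[i]) (x y : R) (H A : set (M * M)).
Implicit Types (Q : R[i] -> set (M * M)).

Lemma rel_scale1 H : rel_scale 1 H = H.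
Proof.
apply/seteqP; split=> [_ [[u v] Huv <-]|[u v] Huv] /=; first by rewrite scale1r.
by exists (u, v) => //; rewrite /= scale1r.
Qed.

Lemma adjoint_rel_scale (s : R[i]) A : s != 0 -> selfadjoint dot A ->
  adjoint dot (rel_scale s A) = rel_scale (Num.conj s) A.
Proof.
move=> s0 [_ AE]; have cs0 : Num.conj s != 0 by rewrite conjC_eq0.
have csV : Num.conj (Num.conj s)^-1 = s^-1.
  by apply: (can_inj (@conjCK R[i])); rewrite conjCK conjE fmorphV.
apply/seteqP; split=> [k Hk|_ [k Ak <-] _ [h Ah <-]] /=.
  exists (k.1, (Num.conj s)^-1 *: k.2).
    rewrite AE => h Ah /=; have := Hk _ (imageP _ Ah); rewrite /= dotZl => E.
    by rewrite dotZr csV -E mulrA mulVf ?mul1r.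
  by rewrite /= scalerA mulfV // scale1r; case: (k).
rewrite AE in Ak; rewrite dotZl dotZr (Ak _ Ah); congr (_ * _).
by rewrite conjE conjcK.
Qed.

Lemma slit_plane_cut z : slit_plane z ->
  cut_upper_plane z \/ upper_half_plane (Num.conj z).
Proof.
case: z => a b sz; have [b0|b0|b0] := ltrgtP b 0.
- by right; rewrite /upper_half_plane /= oppr_gt0.
- by left; left.
left; right; exists a => /=; last by rewrite b0.
rewrite ltNge; apply/negP => a0; apply: sz; exists a => //=.
by rewrite b0.
Qed.

Lemma cut_slit_plane z : cut_upper_plane z -> slit_plane z.
Proof.
case=> [uz|[x /= x0 <-]] [y /= y0].
  by move=> zy; move: uz; rewrite -zy /upper_half_plane /= ltxx.
by move=> -[yx]; move: y0; rewrite yx leNgt x0.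
Qed.

Definition adjoint_symmetric Q :=
  forall z, upper_half_plane z -> Q (Num.conj z) = adjoint dot (Q z).

(** In the lower half-plane Q is the adjoint of s(z) A, which is conj s(z) times A since A is
    selfadjoint. *)
Lemma slit_plane_ext Q (A : set (M * M)) (s : R[i] -> R[i]) : adjoint_symmetric Q ->
  selfadjoint dot A -> (forall z, cut_upper_plane z -> s z != 0) ->
  (forall z, Num.conj (s z) = s (Num.conj z)) ->
  (forall z, cut_upper_plane z -> Q z = rel_scale (s z) A) ->
  forall z, slit_plane z -> Q z = rel_scale (s z) A.
Proof.
move=> Qadj Asa s0 sconj QA z /slit_plane_cut[|uz]; first exact: QA.
have Dz : cut_upper_plane (Num.conj z) by left.
have zz : Num.conj (Num.conj z) = z by exact: conjCK.
have := Qadj _ uz; rewrite zz => ->.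
by rewrite QA // adjoint_rel_scale ?s0 // sconj zz.
Qed.

(** The function [s] gives the scaling factor of each ratio (1, its inverse, or itself), so that the
    three degrees share the passage from c to 1/c. *)
Lemma dilation_gt1 Q (c : R) (s : R -> R[i]) : 0 < c -> c != 1 ->
  s c != 0 -> s c^-1 = (s c)^-1 ->
  (forall z, slit_plane z -> Q (c%:C * z) = rel_scale (s c) (Q z)) ->
  exists2 d, 1 < d &
    forall z, cut_upper_plane z -> Q (d%:C * z) = rel_scale (s d) (Q z).
Proof.
move=> c0 c1 sc0 sV Qc; have [c_gt1|c_lt1|/eqP] := ltrgtP 1 c.
- by exists c => // z /cut_slit_plane; exact: Qc.
- exists c^-1; first by rewrite invf_gt1.
  move=> z Dz; have ci0 : 0 < c^-1 by rewrite invr_gt0.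
  have := Qc _ (cut_slit_plane (cut_upper_plane_dilation ci0 Dz)).
  rewrite mulrA -rmorphM mulfV ?gt_eqF // mul1r => ->.
  by rewrite sV rel_scaleK.
- by rewrite eq_sym (negPf c1).
Qed.

Lemma signed_family_on_cut Q sign : signed_stieltjes_family dot sign Q ->
  [/\ forall z, cut_upper_plane z -> linear_relation (Q z),
      forall z, upper_half_plane z -> dissipative dot (Q z),
      forall x, x < 0 -> sign (Q x%:C),
      exists mu, exists2 F : R[i] -> M -> M, upper_half_plane mu &
        (forall z, cut_upper_plane z -> is_resolvent (Q z) mu (F z)) /\
        (forall z, cut_upper_plane z -> op_differentiable_at F z)
    & adjoint_symmetric Q].
Proof.
move=> [Ql [Qd _ Qadj _ _] Qs [mu mu0 [V [F [UV [_ Fd] FQ]]]] _]; split.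
- by move=> z /cut_slit_plane; exact: Ql.
- by move=> z /Qd[].
- by move=> x x0; apply: Qs; exists x.
- exists mu; exists F => //; split=> z Dz; first exact: FQ.
  by have [] := Fd z (UV _ Dz).
move=> z uz; rewrite Qadj // => -[x _ xz]; move: uz.
by rewrite -xz /upper_half_plane /= ltxx.
Qed.

Lemma stieltjes_family_on_cut Q : stieltjes_family dot Q ->
  stieltjes_on_cut dot Q /\ adjoint_symmetric Q.
Proof. by move=> /signed_family_on_cut[]. Qed.

Section theorems.
Variables (Q : R[i] -> set (M * M)) (c : R).
Hypotheses (QS : stieltjes_on_cut dot Q) (Qadj : adjoint_symmetric Q).
Hypotheses (c_gt0 : 0 < c) (c_neq1 : c != 1).

Let N1 : -1 < 0 :> R. Proof. by rewrite oppr_lt0. Qed.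

Let cC_neq0 : c%:C != 0 :> R[i].
Proof. by apply/eqP => -[] /eqP; rewrite gt_eqF. Qed.

Theorem invariant_family : (forall z, slit_plane z -> Q (c%:C * z) = Q z) ->
  exists2 A, nonneg_selfadjoint dot A & forall z, slit_plane z -> Q z = A.
Proof.
move=> Qc; have [|||d d1 Qd] := @dilation_gt1 Q c (fun=> 1) c_gt0 c_neq1.
- by rewrite oner_neq0.
- by rewrite invr1.
- by move=> z /Qc ->; rewrite rel_scale1.
have {}Qd z : cut_upper_plane z -> Q (d%:C * z) = Q z by move=> /Qd ->; rewrite rel_scale1.
have QA := invariant_on_cut Mhilbert QS d1 Qd.
exists (Q (-1)%:C); first exact: Qneg_selfadjoint.
move=> z Sz; rewrite -[RHS]rel_scale1.
apply: (@slit_plane_ext Q _ (fun=> 1)) Sz => //.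
- by have [] := Qneg_selfadjoint Mhilbert QS N1.
- by rewrite rmorph1.
- by move=> w Dw; rewrite rel_scale1; exact: QA.
Qed.

Theorem degree_minus_one_family :
  (forall z, slit_plane z -> Q (c%:C * z) = rel_scale (c%:C)^-1 (Q z)) ->
  exists2 B, nonneg_selfadjoint dot B &
    forall z, slit_plane z -> Q z = rel_scale (- z^-1) B.
Proof.
move=> Qc; have [|||d d1 Qd] := @dilation_gt1 Q c (fun d => (d%:C)^-1) c_gt0 c_neq1.
- by rewrite invr_neq0.
- by rewrite fmorphV.
- exact: Qc.
have QB := homogeneous_degree_minus_one Mhilbert QS d1 Qd.
exists (Q (-1)%:C); first exact: Qneg_selfadjoint.
apply: (@slit_plane_ext Q _ (fun z => - z^-1)) => //.
- by have [] := Qneg_selfadjoint Mhilbert QS N1.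
- by move=> z /cut_upper_plane_neq0 z0; rewrite oppr_eq0 invr_eq0.
- by move=> z; rewrite rmorphN fmorphV.
Qed.

Theorem degree_one_family :
  (forall z, slit_plane z -> Q (c%:C * z) = rel_scale c%:C (Q z)) ->
  exists2 P, orthogonal_projection dot P &
    forall z, slit_plane z -> Q z = projection_relation P.
Proof.
move=> Qc; have [|||d d1 Qd] := @dilation_gt1 Q c (fun d => d%:C) c_gt0 c_neq1.
- exact: cC_neq0.
- by rewrite fmorphV.
- exact: Qc.
have [P Pproj QP] := homogeneous_degree_one Mhilbert QS d1 Qd.
exists P => // z Sz; rewrite -[RHS]rel_scale1.
apply: (@slit_plane_ext Q _ (fun=> 1)) Sz => //.
- rewrite -(QP _ (cut_upper_planeN N1)).
  by have [] := Qneg_selfadjoint Mhilbert QS N1.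
- by rewrite rmorph1.
- by move=> w Dw; rewrite rel_scale1; exact: QP.
Qed.

End theorems.

(** * Minus the inverse relation *)

Definition neg_inv H : set (M * M) := rel_scale (-1) (rel_inv H).

Lemma neg_invE H u v : neg_inv H (u, v) <-> H (- v, u).
Proof.
split=> [[_ [[p q] Hpq <-]] /= [<- <-]|Huv]; first by rewrite scaleN1r opprK.
by exists (u, - v); [exists (- v, u)|rewrite /= scaleN1r opprK].
Qed.

Lemma set_pairP (A B : set (M * M)) : (forall u v, A (u, v) <-> B (u, v)) -> A = B.
Proof. by move=> AB; apply/seteqP; split=> -[u v] /AB. Qed.

Lemma rel_scaleE (s : R[i]) H u v : s != 0 -> rel_scale s H (u, v) <-> H (u, s^-1 *: v).
Proof.
move=> s0; split=> [[[p q] Hpq] /= [<- <-]|Huv].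
  by rewrite scalerA mulVf // scale1r.
by exists (u, s^-1 *: v) => //=; rewrite scalerA mulfV // scale1r.
Qed.

Lemma linear_relation_scaleE (s : R[i]) H u v : linear_relation H -> s != 0 ->
  H (s *: u, s *: v) <-> H (u, v).
Proof.
move=> lH s0; split=> Huv; last exact: (linear_relationZ s lH Huv).
have := linear_relationZ s^-1 lH Huv; congr H.
by apply: injective_projections; rewrite /= scalerA mulVf // scale1r.
Qed.

Lemma neg_invK H : linear_relation H -> neg_inv (neg_inv H) = H.
Proof.
move=> lH; apply: set_pairP => u v; rewrite !neg_invE -(scaleN1r u) -(scaleN1r v).
by apply: linear_relation_scaleE => //; rewrite oppr_eq0 oner_neq0.
Qed.

Lemma neg_inv_scale (s : R[i]) H : linear_relation H -> s != 0 ->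
  neg_inv (rel_scale s H) = rel_scale s^-1 (neg_inv H).
Proof.
move=> lH s0; have si0 : s^-1 != 0 by rewrite invr_neq0.
apply: set_pairP => u v; rewrite neg_invE rel_scaleE // rel_scaleE // neg_invE invrK.
rewrite -(linear_relation_scaleE (- v) (s^-1 *: u) lH s0) scalerN scalerA mulfV // scale1r.
by [].
Qed.

Lemma neg_inv_linear H : linear_relation H -> linear_relation (neg_inv H).
Proof.
move=> lH; split=> [|a [u v] [u' v'] /neg_invE Hu /neg_invE Hv].
  by apply/neg_invE; rewrite oppr0; exact: lH.1.
apply/neg_invE; have := lH.2 a _ _ Hu Hv; congr H.
by apply: injective_projections; rewrite //= opprD scalerN.
Qed.

Lemma adjoint_neg_inv H : adjoint dot (neg_inv H) = neg_inv (adjoint dot H).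
Proof.
apply: set_pairP => u v; rewrite neg_invE; split=> Hk [p q] Hh /=.
  have /Hk /= : neg_inv H (q, - p) by apply/neg_invE; rewrite opprK.
  by rewrite dotNl dotNr => <-; rewrite opprK.
move/neg_invE: Hh => /Hk /=; rewrite dotNl dotNr => E.
by rewrite -[LHS]opprK -E opprK.
Qed.

Lemma rel_inv_nonneg_selfadjoint A : nonneg_selfadjoint dot A ->
  nonneg_selfadjoint dot (rel_inv A).
Proof.
have invE (H : set (M * M)) u v : rel_inv H (u, v) <-> H (v, u).
  by split=> [[[p q] Hpq [<- <-]]|Huv] //; exists (v, u).
move=> [[lA AE] nA]; split; last first.
  move=> [u v] /invE Auv /=; rewrite dotC conjE conj_ge0; exact: nA Auv.
split.
  split=> [|a [u v] [u' v'] /invE Hu /invE Hv]; first by apply/invE; exact: lA.1.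
  by apply/invE; exact: (lA.2 a _ _ Hu Hv).
apply: set_pairP => u v; rewrite invE {1}AE; split=> Hk [p q] Hh /=.
  by move/invE: Hh => /Hk /= ->.
have /invE /Hk /= -> // : A (p, q) by [].
Qed.

Lemma op_differentiable_affine (F : R[i] -> M -> M) z (a b : R[i]) : a != 0 ->
  op_differentiable_at F z ->
  op_differentiable_at (fun w f => a *: F w f + b *: f) z.
Proof.
move=> a0 [D [lD [k Dk]] HD]; exists (fun f => a *: D f).
  split=> [s u v|]; first by rewrite lD scalerDr !scalerA mulrC.
  exists (`|a| * k) => f; rewrite normrZ -mulrA ler_wpM2l //.
move=> e e0; have ea : 0 < e / `|a| by rewrite divr_gt0 // normr_gt0.
have := HD _ ea; apply: filterS => w Hw f.
have -> : a *: F w f + b *: f - (a *: F z f + b *: f) - (w - z) *: (a *: D f) =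
    a *: (F w f - F z f - (w - z) *: D f).
  by apply: (dot_inj Mhilbert) => x; rewrite !dotE; ring.
rewrite normrZ; apply: le_trans (ler_wpM2l (normr_ge0 _) (Hw f)) _.
have na : `|a| != 0 by rewrite normr_eq0.
by rewrite -!mulrA [`|a| * _]mulrCA mulVKf.
Qed.

Lemma neg_inv_on_cut (Rf : R[i] -> set (M * M)) : inverse_stieltjes_family dot Rf ->
  [/\ stieltjes_on_cut dot (fun z => neg_inv (Rf z)),
      adjoint_symmetric (fun z => neg_inv (Rf z)) &
      forall z, slit_plane z -> linear_relation (Rf z)].
Proof.
move=> RS; have lR : forall z, slit_plane z -> linear_relation (Rf z) by case: RS.
have [Rl Rd Rn [nu [F nu0 [FR Fd]]] Radj] := signed_family_on_cut RS.
split => //; last by move=> z uz; rewrite adjoint_neg_inv Radj.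
have nu_neq0 : nu != 0 by apply: cut_upper_plane_neq0; left.
split.
- by move=> z Dz; apply: neg_inv_linear; exact: Rl.
- move=> z uz [u v] /neg_invE Huv; have := Rd _ uz _ Huv; rewrite /= dotNr dotC.
  by case: (dot v u) => p q /=; rewrite opprK.
- move=> x x0 [u v] /neg_invE Huv.
  have : rel_scale (-1) (Rf x%:C) (- v, -1 *: u) by exists (- v, u).
  move=> /(Rn _ x0) /=; rewrite scaleN1r dotNl dotNr opprK.
  by rewrite dotC conjE conj_ge0.
(* With shift -1/nu the resolvent of - R^-1 is nu^2 (R + nu)^-1 - nu, affine in the given one with
   constant coefficients, so the continuation carries over. *)
exists (- nu^-1); exists (fun z f => (nu ^+ 2) *: F z f + (- nu) *: f).
  exact: upper_Ninv.
split=> z Dz; last by apply: op_differentiable_affine (Fd _ Dz); rewrite expf_neq0.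
have /is_resolventP[F1 F2] := FR _ Dz; apply/is_resolventP; split=> [f|[u v] /neg_invE Huv] /=.
  apply/neg_invE; have := linear_relationZ (- nu) (Rl _ Dz) (F1 f); congr (Rf z).
  apply: injective_projections; apply: (dot_inj Mhilbert) => x /=; rewrite !dotE; field; by rewrite ?nu_neq0.
have := F2 _ (linear_relationZ (- nu^-1) (Rl _ Dz) Huv); rewrite /= => E.
have -> : v + - nu^-1 *: u = - nu^-1 *: u + nu *: (- nu^-1 *: - v).
  by apply: (dot_inj Mhilbert) => x; rewrite !dotE; field; by rewrite ?nu_neq0.
rewrite E; apply: (dot_inj Mhilbert) => x; rewrite !dotE; field; by rewrite ?nu_neq0.
Qed.

Lemma neg_inv_projection (P : M -> M) : orthogonal_projection dot P ->
  orthogonal_projection dot (fun f => f - P f) /\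
  neg_inv (projection_relation P) = projection_relation (fun f => f - P f).
Proof.
move=> [[lP [k Pk]] PP Psym].
have PB u v : P (u - v) = P u - P v.
  by rewrite addrC -scaleN1r lP scaleN1r addrC.
split.
  split=> [|f|f g]; last by rewrite dotBl dotBr Psym.
    split=> [a u v|]; first by rewrite lP; apply: (dot_inj Mhilbert) => x; rewrite !dotE; ring.
    exists (1 + k) => f; rewrite mulrDl mul1r; apply: le_trans (ler_normB _ _) _.
    by rewrite lerD2l.
  by rewrite PB PP subrr subr0.
apply: set_pairP => u v; rewrite neg_invE; split=> -[f _ [fv fu]].
  (* The reflection f - 2 P f keeps the component (1 - P) f and changes the sign of P f, as the swap
     with a sign in [neg_inv] requires. *)
  exists (f - P f - P f) => //=; rewrite !PB PP subrr sub0r opprK subrK fu.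
  by congr (_, _); rewrite addrAC subrr add0r -[v]opprK fv.
exists (f - P f - P f) => //; rewrite !PB PP subrr sub0r -fv -fu.
congr (_, _); first by rewrite subKr.
by rewrite opprK subrK.
Qed.

End families.

Theorem theorem4p5 (R : realType) (M : completeNormedModType R[i])
    (dot : {dot M for Num.conj})
    (Mhilbert : hilbert_norm dot) (Mseparable : separable M)
    (c : R) (c_gt0 : 0 < c) (c_neq1 : c != 1) :
  [/\ forall Q : R[i] -> set (M * M),
        stieltjes_family dot Q ->
        (forall z, slit_plane z -> Q (c%:C * z) = Q z) ->
        exists2 A, nonneg_selfadjoint dot A &
          forall z, slit_plane z -> Q z = A,
      forall Q : R[i] -> set (M * M),
        inverse_stieltjes_family dot Q ->
        (forall z, slit_plane z -> Q (c%:C * z) = Q z) ->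
        exists2 A, nonneg_selfadjoint dot A &
          forall z, slit_plane z -> Q z = rel_scale (-1) A,
      forall Q : R[i] -> set (M * M),
        stieltjes_family dot Q ->
        (forall z, slit_plane z ->
           Q (c%:C * z) = rel_scale (c%:C)^-1 (Q z)) ->
        exists2 B, nonneg_selfadjoint dot B &
          forall z, slit_plane z -> Q z = rel_scale (- z^-1) B,
      forall Q : R[i] -> set (M * M),
        inverse_stieltjes_family dot Q ->
        (forall z, slit_plane z ->
           Q (c%:C * z) = rel_scale c%:C (Q z)) ->
        exists2 C, nonneg_selfadjoint dot C &
          forall z, slit_plane z -> Q z = rel_scale z C
    & (forall Q : R[i] -> set (M * M),
         stieltjes_family dot Q ->
         (forall z, slit_plane z ->
            Q (c%:C * z) = rel_scale c%:C (Q z)) ->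
         exists2 P, orthogonal_projection dot P &
           forall z, slit_plane z -> Q z = projection_relation P) /\
      (forall Q : R[i] -> set (M * M),
         inverse_stieltjes_family dot Q ->
         (forall z, slit_plane z ->
            Q (c%:C * z) = rel_scale (c%:C)^-1 (Q z)) ->
         exists2 P, orthogonal_projection dot P &
           forall z, slit_plane z -> Q z = projection_relation P)].
Proof.
have cC_neq0 : c%:C != 0 :> R[i] by apply/eqP => -[] /eqP; rewrite gt_eqF.
split.
- move=> Q /stieltjes_family_on_cut[QS Qadj]; exact: invariant_family.
- move=> Q /(neg_inv_on_cut Mhilbert)[QS Qadj Ql] Qc.
  have [|A nA QA] := invariant_family Mhilbert QS Qadj c_gt0 c_neq1.
    by move=> z Sz; rewrite Qc.
  (* From - Q^-1 = A follows Q = - A^-1. *)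
  exists (rel_inv A); first exact: rel_inv_nonneg_selfadjoint.
  by move=> z Sz; rewrite -(neg_invK (Ql _ Sz)) QA.
- move=> Q /stieltjes_family_on_cut[QS Qadj]; exact: degree_minus_one_family.
- move=> Q /(neg_inv_on_cut Mhilbert)[QS Qadj Ql] Qc.
  have [|B nB QB] := degree_minus_one_family Mhilbert QS Qadj c_gt0 c_neq1.
    by move=> z Sz; rewrite Qc // neg_inv_scale //; exact: Ql.
  (* Degree 1 for Q is degree -1 for - Q^-1; from - Q^-1 = - z^-1 B follows Q = z B^-1. *)
  exists (rel_inv B); first exact: rel_inv_nonneg_selfadjoint.
  move=> z Sz; rewrite -(neg_invK (Ql _ Sz)) QB //.
  have z0 : z != 0 by apply: contra_notN Sz => /eqP ->; exists 0 => //=.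
  have [[lB _] _] := nB.
  rewrite neg_inv_scale // ?oppr_eq0 ?invr_eq0 // invrN invrK.
  apply: set_pairP => u v; rewrite !rel_scaleE ?oppr_eq0 // neg_invE invrN scaleNr opprK.
  by split=> [Huv|[[p q] Hpq [<- <-]]//]; exists (z^-1 *: v, u).
split.
- move=> Q /stieltjes_family_on_cut[QS Qadj]; exact: degree_one_family.
move=> Q /(neg_inv_on_cut Mhilbert)[QS Qadj Ql] Qc.
have [|P Pproj QP] := degree_one_family Mhilbert QS Qadj c_gt0 c_neq1.
  by move=> z Sz; rewrite Qc // neg_inv_scale ?invr_eq0 // ?invrK //; exact: Ql.
have [P'proj PE] := neg_inv_projection Mhilbert Pproj.
exists (fun f => f - P f) => // z Sz.
by rewrite -(neg_invK (Ql _ Sz)) QP.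
Qed.
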